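(* Let $\mathcal G$ be a group operad and $\mathcal M$ a multicategory. Then there is an isomorphism of categories $\widetilde\Phi:\mathcal M\wr\widetilde{\mathbb G}_{\mathcal G}\cong(\mathcal M\rtimes\mathcal G)\wr\widetilde{\mathbb E}_{\mathcal G}$ which is the identity on objects and is described on each hom-set by $$\widetilde\Phi([\varphi;f_1,\dots,f_n;u,x])=\left[\varphi;(f_1,\delta^{(\varphi)*}_1(u)),\dots,(f_n,\delta^{(\varphi)*}_n(u));x\right].$$ Moreover, $\widetilde\Phi$ is a $2$-natural transformation with respect to $\mathcal M\in\mathbf{MultCat}$, and the square formed by $\Phi:\mathcal M\wr\mathbb G_{\mathcal G}\xrightarrow{\cong}(\mathcal M\rtimes\mathcal G)\wr\mathbb E_{\mathcal G}$, by $\widetilde\Phi$, and by the quotient functors $\mathcal M\wr\mathbb G_{\mathcal G}\to\mathcal M\wr\widetilde{\mathbb G}_{\mathcal G}$ and $(\mathcal M\rtimes\mathcal G)\wr\mathbb E_{\mathcal G}\to(\mathcal M\rtimes\mathcal G)\wr\widetilde{\mathbb E}_{\mathcal G}$ is commutative.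
   Context: **Interval category.** $\nabla$ has objects $\langle\!\langle n\rangle\!\rangle=\{-\infty,1,\dots,n,\infty\}$ ($n\ge 0$) and morphisms the order-preserving maps sending $\pm\infty$ to $\pm\infty$ respectively. For $\varphi:\langle\!\langle m\rangle\!\rangle\to\langle\!\langle n\rangle\!\rangle$ put $k^{(\varphi)}_j=\#\varphi^{-1}\{j\}$ for $1\le j\le n$ and $k^{(\varphi)}_{\pm\infty}=\#\varphi^{-1}\{\pm\infty\}-1$; the tuple $(k^{(\varphi)}_{-\infty},k^{(\varphi)}_1,\dots,k^{(\varphi)}_n,k^{(\varphi)}_\infty)$ determines $\varphi$. $\varphi$ is active if $k^{(\varphi)}_{\pm\infty}=0$. For $1\le j\le n$ with $\varphi^{-1}\{j\}=\{i_1<\dots<i_k\}$, $k=k_j^{(\varphi)}$, let $\delta^{(\varphi)}_j:\langle\!\langle k\rangle\!\rangle\to\langle\!\langle m\rangle\!\rangle$ be $s\mapsto i_s$ (and $\pm\infty\mapsto\pm\infty$). **Group operads.** Operads are non-symmetric, in sets. $\mathfrak S$ is the operad of symmetric groups, with $\gamma(\sigma;\sigma_1,\dots,\sigma_n)$ permuting the $i$-th block by $\sigma_i$ and then moving the $i$-th block to the $\sigma(i)$-th block position. A group operad is an operad $\mathcal G$ with a group structure on each $\mathcal G(n)$ (unit $e_n$) and an operad map $\mathcal G\to\mathfrak S$ that is levelwise a homomorphism (so $x\in\mathcal G(n)$ acts on $\{1,\dots,n\}$), such that $\gamma(xy;x_1y_1,\dots,x_ny_n)=\gamma(x;x_{y^{-1}(1)},\dots,x_{y^{-1}(n)})\gamma(y;y_1,\dots,y_n)$.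 For $\varphi:\langle\!\langle m\rangle\!\rangle\to\langle\!\langle n\rangle\!\rangle$ and $x\in\mathcal G(n)$ put $\varphi^*(x)=\gamma(e_3;e_{k^{(\varphi)}_{-\infty}},\gamma(x;e_{k^{(\varphi)}_1},\dots,e_{k^{(\varphi)}_n}),e_{k^{(\varphi)}_\infty})\in\mathcal G(m)$, and let $\varphi^x:\langle\!\langle m\rangle\!\rangle\to\langle\!\langle n\rangle\!\rangle$ be the morphism with $k^{(\varphi^x)}_{x(j)}=k^{(\varphi)}_j$ ($1\le j\le n$), $k^{(\varphi^x)}_{\pm\infty}=k^{(\varphi)}_{\pm\infty}$ (a left action). **Subgroups.** For $\varphi:\langle\!\langle m\rangle\!\rangle\to\langle\!\langle n\rangle\!\rangle$: $\mathrm{RSt}_\varphi=\{x\in\mathcal G(m)\mid\varphi\psi^x=\varphi\psi\ \forall\psi\}$; $\mathrm{Dec}_\varphi\subset\mathcal G(m)$ is the subgroup of elements $\gamma(e_{n+2};x_{-\infty},x_1,\dots,x_n,x_\infty)$ with $x_j\in\mathcal G(k^{(\varphi)}_j)$; $\mathrm{Kec}_\varphi=\ker(\mathrm{Dec}_\varphi\to\mathfrak S(m))$. For $K=\mathrm{Dec},\mathrm{Kec}$, $\overline K_\varphi=\{x\in\mathrm{RSt}_\varphi\mid\psi^*(x)\in K_{\varphi\psi}$ for all $\psi$ with $\varphi\psi$ defined and active$\}$. $\mathrm{Inr}_\varphi=\{x\in\mathrm{RSt}_\varphi\mid\psi^*(x)=e$ for all $\psi$ with $\varphi\psi$ defined and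 active$\}$. **Base categories.** $\mathbb E_{\mathcal G}$: objects of $\nabla$; morphisms $\langle\!\langle m\rangle\!\rangle\to\langle\!\langle n\rangle\!\rangle$ are pairs $(\varphi,[x])$, $[x]\in\overline{\mathrm{Kec}}_\varphi\backslash\mathcal G(m)$; $(\psi,[y])\circ(\varphi,[x])=(\psi\varphi^y,[\varphi^*(y)x])$. $\mathbb G_{\mathcal G}$: same objects; morphisms are triples $(\varphi,[u],[x])$, $[u]\in\mathrm{Inr}_\varphi\backslash\overline{\mathrm{Dec}}_\varphi$, $[x]\in\overline{\mathrm{Kec}}_\varphi\backslash\mathcal G(m)$; $(\psi,[v],[y])\circ(\varphi,[u],[x])=(\psi\varphi^y,[\varphi^*(vy)u\varphi^*(y)^{-1}],[\varphi^*(y)x])$. Identity-on-objects functors $s,t:\mathbb G_{\mathcal G}\rightrightarrows\mathbb E_{\mathcal G}$: $s(\varphi,[u],[x])=(\varphi,[x])$, $t(\varphi,[u],[x])=(\varphi,[ux])$. In either category call a morphism active if $\varphi$ is, and for parallel $\alpha,\alpha'$ put $\alpha\sim\alpha'$ iff for every $\beta$ composable on the right $\alpha\beta=\alpha'\beta$ whenever $\alpha\beta$ or $\alpha'\beta$ is active; this is a congruence. $\widetilde{\mathbb E}_{\mathcal G}$, $\widetilde{\mathbb G}_{\mathcal G}$ are the quotient categories, with morphisms written $[\varphi,x]$, $[\varphi,u,x]$; $s,t$ descend to them. **Multicategories.** $\mathbf{MultCat}$ is the 2-category of (non-symmetric) multicategories, multifunctors, multinatural transformations. $\mathcal M\rtimes\mathcal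 G$ has the objects of $\mathcal M$, $(\mathcal M\rtimes\mathcal G)(a_1\dots a_n;a)=\{(f,x)\mid x\in\mathcal G(n),\ f\in\mathcal M(a_{x^{-1}(1)}\dots a_{x^{-1}(n)};a)\}$, and composition $\gamma((f,x);(f_1,x_1),\dots,(f_n,x_n))=(\gamma(f;f_{x^{-1}(1)},\dots,f_{x^{-1}(n)}),\gamma(x;x_1,\dots,x_n))$; it is a 2-functor in $\mathcal M$ via $F\mapsto((f,x)\mapsto(F(f),x))$ and $\alpha\mapsto\{(\alpha_a,e_1)\}_a$. **Wreath constructions.** For a word $\vec a=a_1\dots a_m$: $x_*\vec a=a_{x^{-1}(1)}\dots a_{x^{-1}(m)}$ for $x\in\mathcal G(m)$, and for $\varphi:\langle\!\langle m\rangle\!\rangle\to\langle\!\langle n\rangle\!\rangle$, $\vec a^\varphi_j=a_{i_1}\dots a_{i_k}$ where $\varphi^{-1}\{j\}=\{i_1<\dots<i_k\}$. $\mathcal M\wr\mathbb E_{\mathcal G}$ has objects finite words of objects of $\mathcal M$; morphisms $a_1\dots a_m\to b_1\dots b_n$ are tuples $(\varphi;f_1,\dots,f_n;[x])$ with $(\varphi,[x])\in\mathbb E_{\mathcal G}(\langle\!\langle m\rangle\!\rangle,\langle\!\langle n\rangle\!\rangle)$ and $f_j\in\mathcal M((x_*\vec a)^\varphi_j;b_j)$; composition $(\psi;\vec g;[y])\circ(\varphi;\vec f;[x])=(\psi\varphi^y;\gamma(g_1;(y_*\vec f)^\psi_1),\dots,\gamma(g_n;(y_*\vec f)^\psi_n);[\varphi^*(y)x])$.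 $\mathcal M\wr\widetilde{\mathbb E}_{\mathcal G}$ is its quotient identifying $(\varphi;\vec f;[x])$ and $(\varphi';\vec f';[x'])$ iff $[\varphi,x]=[\varphi',x']$ in $\widetilde{\mathbb E}_{\mathcal G}$ and $f_j=f'_j$ for all $j$; classes are written $[\varphi;\vec f;x]$. Both are 2-functorial in $\mathcal M$: a multifunctor $F$ acts by $F$ on letters of words and on the $f_j$, and $\alpha$ induces the natural transformation with components $[\mathrm{id};\alpha_{a_1},\dots,\alpha_{a_m};e_m]$ (resp. the same tuple with round brackets). $\mathcal M\wr\mathbb G_{\mathcal G}$ (resp. $\mathcal M\wr\widetilde{\mathbb G}_{\mathcal G}$) is the pullback of $\mathcal M\wr\mathbb E_{\mathcal G}\to\mathbb E_{\mathcal G}$ along $t:\mathbb G_{\mathcal G}\to\mathbb E_{\mathcal G}$ (resp. of the tilde versions along $t:\widetilde{\mathbb G}_{\mathcal G}\to\widetilde{\mathbb E}_{\mathcal G}$); its morphisms are written $(\varphi;\vec f;[u],[x])$ (resp. $[\varphi;\vec f;u,x]$), corresponding to the pair of $(\varphi,[u],[x])$ and $(\varphi;\vec f;[ux])$ (resp. their classes). **$\Phi$.** $\Phi:\mathcal M\wr\mathbb G_{\mathcal G}\to(\mathcal M\rtimes\mathcal G)\wr\mathbb E_{\mathcal G}$ is the identity-on-objects isomorphism of categories $\Phi(\varphi;f_1,\dots,f_n;[u],[x])=(\varphi;(f_1,\delta^{(\varphi)*}_1(u)),\dots,(f_n,\delta^{(\varphi)*}_n(u));[x])$.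
   Formalization: The group G(0) is assumed trivial: otherwise the empty word has |G(0)| endomorphisms in the source category but only one in the target, so no such isomorphism exists for any M (e.g. G(n)=A abelian with γ given by the sum). *)

(* Defs.v *)
From HB Require Import structures.
From mathcomp Require Import all_boot.
From mathcomp Require Import fingroup perm.

Set Implicit Arguments.
Unset Strict Implicit.
Unset Printing Implicit Defensive.

Local Open Scope group_scope.

(* The object <<n>> is 'I_n.+2, with ord0 = -oo, ord_max = +oo, and the       *)
(* element j of {1, ..., n} is mid (j - 1).                                   *)

Definition mid n (j : 'I_n) : 'I_n.+2 := lift ord0 (widen_ord (leqnSn n) j).

Definition is_interval_map m n (f : {ffun 'I_m.+2 -> 'I_n.+2}) : bool :=
  [&& f ord0 == ord0, f ord_max == ord_max
    & [forall i : 'I_m.+2, forall j : 'I_m.+2, (i <= j)%N ==> (f i <= f j)%N]].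

Record nabla m n := Nabla {
  nabla_fun :> {ffun 'I_m.+2 -> 'I_n.+2};
  _ : is_interval_map nabla_fun }.

HB.instance Definition _ m n := [isSub of nabla m n for @nabla_fun m n].
HB.instance Definition _ m n := [Finite of nabla m n by <:].

Lemma nabla_axiom m n (phi : nabla m n) : is_interval_map phi.
Proof. by case: phi. Qed.

Lemma nabla_id_subproof n : @is_interval_map n n [ffun i => i].
Proof.
rewrite /is_interval_map !ffunE !eqxx /=.
by apply/forallP=> i; apply/forallP=> j; rewrite !ffunE implybb.
Qed.

Definition nabla_id n : nabla n n := Nabla (nabla_id_subproof n).

Lemma nabla_comp_subproof l m n (psi : nabla m n) (phi : nabla l m) :
  is_interval_map [ffun i => psi (phi i)].
Proof.
have /and3P[/eqP p0 /eqP pM /forallP pL] := nabla_axiom phi.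
have /and3P[/eqP q0 /eqP qM /forallP qL] := nabla_axiom psi.
apply/and3P; split; rewrite ?ffunE ?p0 ?pM ?q0 ?qM //.
apply/forallP=> i; apply/forallP=> j; rewrite !ffunE; apply/implyP=> ij.
move/forallP: (pL i) => /(_ j); rewrite ij => /= pij.
by move/forallP: (qL (phi i)) => /(_ (phi j)); rewrite pij.
Qed.

Definition nabla_comp l m n (psi : nabla m n) (phi : nabla l m) : nabla l n :=
  Nabla (nabla_comp_subproof psi phi).

Definition fib m n (phi : nabla m n) (j : 'I_n.+2) : {set 'I_m.+2} :=
  [set i | phi i == j].

Definition kmid m n (phi : nabla m n) (j : 'I_n) : nat := #|fib phi (mid j)|.
Definition kminus m n (phi : nabla m n) : nat := #|fib phi ord0|.-1.
Definition kplus m n (phi : nabla m n) : nat := #|fib phi ord_max|.-1.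

Definition ktuple m n (phi : nabla m n) : seq nat :=
  kminus phi :: [seq kmid phi j | j <- enum 'I_n] ++ [:: kplus phi].

Definition active m n (phi : nabla m n) : Prop :=
  kminus phi = 0%N /\ kplus phi = 0%N.

(* delta_j : <<k_j>> -> <<m>>, s |-> i_s; enum_val enumerates the fibre       *)
(* phi^-1 {j} in increasing order.                                            *)
Definition delta_fun m n (phi : nabla m n) (j : 'I_n) :
    {ffun 'I_(kmid phi j).+2 -> 'I_m.+2} :=
  [ffun s : 'I_(kmid phi j).+2 => if s == ord0 then ord0 else
     if insub s.-1 is Some t
     then @enum_val _ (mem (fib phi (mid j))) t else ord_max].

Lemma delta_subproof m n (phi : nabla m n) j :
  is_interval_map (delta_fun phi j).
Proof.
have enum_mono (s t : 'I_(kmid phi j)) : (s <= t)%N ->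
    (@enum_val _ (mem (fib phi (mid j))) s
       <= @enum_val _ (mem (fib phi (mid j))) t)%N.
  rewrite leq_eqVlt => /predU1P[/val_inj-> // | lt_st]; apply: ltnW.
  rewrite !(enum_val_nth ord0) -!(nth_map ord0 0%N val) -?cardE //.
  apply: (sorted_ltn_nth ltn_trans);
    rewrite ?inE ?size_map -?cardE ?ltn_ord //.
  apply: (subseq_sorted ltn_trans _ (iota_ltn_sorted 0 m.+2)).
  rewrite -val_enum_ord; apply: map_subseq.
  by rewrite [X in subseq _ X]enumT; apply: filter_subseq.
apply/and3P; split; rewrite ?ffunE //=.
  by rewrite insubF ?ltnn.
apply/forallP=> s; apply/forallP=> t; apply/implyP=> le_st; rewrite !ffunE.
case: (s =P ord0) => // s0.
have spos : (0 < s)%N by rewrite lt0n; apply: contra_notN s0 => /eqP ?; apply: val_inj.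
have tpos := leq_trans spos le_st.
have -> : (t == ord0) = false by apply/negbTE; rewrite -val_eqE /= -lt0n.
case: (insubP _ t.-1) => [t' lt_t def_t | _]; last exact: leq_ord.
case: (insubP _ s.-1) => [s' lt_s def_s | /negP[]].
  by apply: enum_mono; rewrite def_s def_t -!subn1 leq_sub2r.
by apply: leq_ltn_trans lt_t; rewrite -!subn1 leq_sub2r.
Qed.

Definition delta m n (phi : nabla m n) (j : 'I_n) : nabla (kmid phi j) m :=
  Nabla (delta_subproof phi j).

(* The morphism psi with k^psi_(sigma j) = k^phi_j and k^psi_(+-oo) =         *)
(* k^phi_(+-oo); it exists and is unique, so that the default is never used.  *)
Definition nabla_act m n (sigma : {perm 'I_n}) (phi : nabla m n) : nabla m n :=
  odflt phi [pick psi : nabla m n |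
    [&& kminus psi == kminus phi, kplus psi == kplus phi
      & [forall j, kmid psi (sigma j) == kmid phi j]]].

Lemma ktuple_sum m n (phi : nabla m n) :
  (kminus phi + (sumn [tuple kmid phi j | j < n] + kplus phi))%N = m.
Proof.
have /and3P[p0 pM _] := nabla_axiom phi.
have n0 : (0 < #|fib phi ord0|)%N by apply/card_gt0P; exists ord0; rewrite inE.
have nM : (0 < #|fib phi ord_max|)%N
  by apply/card_gt0P; exists ord_max; rewrite inE.
have : (\sum_(j < n.+2) #|fib phi j|)%N = m.+2.
  rewrite -[RHS]card_ord -sum1_card (partition_big phi predT) //=.
  by apply: eq_bigr => j _; rewrite -sum1_card; apply: eq_bigl => i; rewrite inE.
rewrite big_ord_recl big_ord_recr /=.
have -> : lift ord0 ord_max = ord_max :> 'I_n.+2 by apply: val_inj.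
have -> : sumn [tuple kmid phi j | j < n] = (\sum_(j < n) #|fib phi (mid j)|)%N.
  by rewrite sumnE /= big_map big_enum.
rewrite -[in X in (X + _)%N = _](prednK n0) -[in X in (_ + (_ + X))%N = _](prednK nM).
by rewrite -/(kminus phi) -/(kplus phi) addSn !addnS; case.
Qed.

(* sigma_* w, whose i-th letter is w_(sigma^-1 i)                             *)
Definition permute A n (sigma : {perm 'I_n}) (w : n.-tuple A) : n.-tuple A :=
  [tuple tnth w (sigma^-1 i) | i < n].

(* The same for sequences, which is only relevant if size s = n.              *)
Definition permute_seq A n (sigma : {perm 'I_n}) (s : seq A) : seq A :=
  if insub s is Some w then tval (permute sigma (w : n.-tuple A)) else s.

Definition fibre A m n (phi : nabla m n) (w : m.-tuple A) (j : 'I_n) : seq A :=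
  [seq tnth w i | i <- enum 'I_m & phi (mid i) == mid j].

Record word A := Word { wlen : nat; wtup :> wlen.-tuple A }.

Definition map_word A B (f : A -> B) (w : word A) : word B :=
  Word (map_tuple f (wtup w)).

(* Operations of all arities form the type op = {n & G n}, and the operadic   *)
(* composition is a function op -> seq op -> op subject to laws only if the   *)
(* number of arguments is the arity of the first operand. (In the presence of *)
(* the axiom of choice, the choiceType structure underlying groupType is no   *)
(* restriction on the sets G n.)                                              *)

Section OperadLaws.

Variable G : nat -> groupType.
Let op : Type := {n & G n}.
Let Op n (x : G n) : op := Tagged (fun n => G n : Type) x.

Variables (sym : forall n, G n -> {perm 'I_n}).
Variables (id1 : G 1%N) (gam : op -> seq op -> op).

Record is_operad : Prop := IsOperad {
  gam_arity : forall (x : op) (s : seq op), size s = tag x ->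
    tag (gam x s) = sumn [seq tag y | y <- s];
  gamA : forall (x : op) (s : seq op) (t : seq (seq op)), size s = tag x ->
    [seq size r | r <- t] = [seq tag y | y <- s] ->
    gam (gam x s) (flatten t) = gam x [seq gam p.1 p.2 | p <- zip s t];
  gam1x : forall x : op, gam (Op id1) [:: x] = x;
  gamx1 : forall x : op, gam x (nseq (tag x) (Op id1)) = x }.

(* The permutation of positions underlying an operation.                      *)
Definition op_sym (x : op) (p : nat) : nat :=
  if insub p is Some i then val (sym (tagged x) (i : 'I_(tag x))) else p.

(* G -> S is levelwise a homomorphism, where (s t)(i) = s(t(i)) in S(n) (this *)
(* is the opposite of the product of {perm 'I_n}); and it is compatible with  *)
(* composition, where gamma(s; s_1, ..., s_n) in S(k_1 + ... + k_n) sends the *)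
(* j-th position of block i to the s_i(j)-th position of block s(i), blocks   *)
(* being of sizes k_i before and k_(s^-1 i) after. Compatibility with         *)
(* operadic units is void since S(1) is trivial.                              *)
Record is_sym_map : Prop := IsSymMap {
  symM : forall n (x y : G n) (i : 'I_n), sym (x * y) i = sym x (sym y i);
  sym_gam : forall n (x : G n) (s : n.-tuple op) (i : 'I_n)
      (j : 'I_(tag (tnth s i))),
    let k := [tuple tag (tnth s l) | l < n] in
    op_sym (gam (Op x) s) (flatten_index k i j)
    = flatten_index (permute (sym x) k) (sym x i)
                    (sym (tagged (tnth s i)) j) }.

(* gamma(xy; x_i y_i) = gamma(x; x_(y^-1 i)) gamma(y; y_i), where u and v are *)
(* the two factors on the right as elements of the same group G N.            *)
Definition gam_mul : Prop :=
  forall n (x y : G n) (k : 'I_n -> nat) (xs ys : forall i, G (k i))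
    N (u v : G N),
  Op u = gam (Op x) [tuple Op (xs ((sym y)^-1 i)) | i < n] ->
  Op v = gam (Op y) [tuple Op (ys i) | i < n] ->
  gam (Op (x * y)) [tuple Op (xs i * ys i) | i < n] = Op (u * v).

End OperadLaws.

Record group_operad := GroupOperad {
  gop :> nat -> groupType;
  gsym : forall n, gop n -> {perm 'I_n};
  gid : gop 1%N;
  gam : {n & gop n} -> seq {n & gop n} -> {n & gop n};
  gopP : is_operad gid gam;
  gsymP : is_sym_map gsym gam;
  gam_mulP : gam_mul gsym gam }.

Definition op (G : group_operad) : Type := {n & G n}.
Definition Op (G : group_operad) n (x : G n) : op G :=
  Tagged (fun n => G n : Type) x.

Section Subgroups.

Variable G : group_operad.

Definition pull_op m n (phi : nabla m n) (x : G n) : op G :=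
  gam (Op (1 : G 3))
    [:: Op (1 : G (kminus phi));
        gam (Op x) [tuple Op (1 : G (kmid phi j)) | j < n];
        Op (1 : G (kplus phi))].

Lemma pull_op_arity m n (phi : nabla m n) (x : G n) : tag (pull_op phi x) = m.
Proof.
rewrite /pull_op; set s := [tuple Op _ | j < n].
have s_ar : tag (gam (Op x) s) = sumn [tuple kmid phi j | j < n].
  rewrite (gam_arity (gopP G)) ?size_tuple //; congr sumn.
  by rewrite /= -map_comp.
by rewrite (gam_arity (gopP G)) //= s_ar addn0 ktuple_sum.
Qed.

Definition pull m n (phi : nabla m n) (x : G n) : G m :=
  etagged (pull_op_arity phi x).

Definition act m n (x : G n) (phi : nabla m n) : nabla m n :=
  nabla_act (gsym x) phi.

Definition RSt m n (phi : nabla m n) (x : G m) : Prop :=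
  forall l (psi : nabla l m),
    nabla_comp phi (act x psi) = nabla_comp phi psi.

Definition Dec m n (phi : nabla m n) (x : G m) : Prop :=
  exists s : seq (op G), [seq tag y | y <- s] = ktuple phi
    /\ Op x = gam (Op (1 : G n.+2)) s.

Definition Kec m n (phi : nabla m n) (x : G m) : Prop :=
  Dec phi x /\ gsym x = 1.

Definition overline (K : forall m n, nabla m n -> G m -> Prop)
    m n (phi : nabla m n) (x : G m) : Prop :=
  RSt phi x /\
  forall l (psi : nabla l m),
    active (nabla_comp phi psi) -> K l n (nabla_comp phi psi) (pull psi x).

Definition DecBar := overline Dec.
Definition KecBar := overline Kec.

Definition Inr m n (phi : nabla m n) (x : G m) : Prop :=
  RSt phi x /\
  forall l (psi : nabla l m),
    active (nabla_comp phi psi) -> pull psi x = 1.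

End Subgroups.

Definition same_coset (T : groupType) (K : T -> Prop) (x x' : T) : Prop :=
  K (x' * x^-1).

(* The hom-set from a to b is the set of all f : raw a b such that hom f,     *)
(* modulo heq: morphisms are given by representatives. Composition is a       *)
(* function of representatives; is_category includes that it is well defined  *)
(* on hom-sets.                                                               *)

Record catdata (O : Type) := CatData {
  raw : O -> O -> Type;
  hom : forall a b, raw a b -> Prop;
  heq : forall a b, raw a b -> raw a b -> Prop;
  idm : forall a, raw a a;
  cmp : forall a b c, raw b c -> raw a b -> raw a c }.

Arguments hom {O} C {a b} : rename.
Arguments heq {O} C {a b} : rename.
Arguments idm {O} C a : rename.
Arguments cmp {O} C {a b c} : rename.

Record is_category O (C : catdata O) : Prop := IsCategory {
  heq_refl : forall a b (f : raw C a b), hom C f -> heq C f f;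
  heq_sym : forall a b (f g : raw C a b), hom C f -> hom C g ->
    heq C f g -> heq C g f;
  heq_trans : forall a b (f g h : raw C a b),
    hom C f -> hom C g -> hom C h ->
    heq C f g -> heq C g h -> heq C f h;
  hom_idm : forall a, hom C (idm C a);
  hom_cmp : forall a b c (g : raw C b c) (f : raw C a b),
    hom C g -> hom C f -> hom C (cmp C g f);
  cmp_heq : forall a b c (g g' : raw C b c) (f f' : raw C a b),
    hom C g -> hom C g' -> hom C f -> hom C f' ->
    heq C g g' -> heq C f f' -> heq C (cmp C g f) (cmp C g' f');
  cmpA : forall a b c d (h : raw C c d) (g : raw C b c) (f : raw C a b),
    hom C h -> hom C g -> hom C f ->
    heq C (cmp C h (cmp C g f)) (cmp C (cmp C h g) f);
  cmp1f : forall a b (f : raw C a b), hom C f -> heq C (cmp C (idm C b) f) f;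
  cmpf1 : forall a b (f : raw C a b), hom C f -> heq C (cmp C f (idm C a)) f }.

Record functor O P (C : catdata O) (D : catdata P) := Functor {
  fob :> O -> P;
  fmor : forall a b, raw C a b -> raw D (fob a) (fob b) }.

Record is_functor O P (C : catdata O) (D : catdata P) (F : functor C D) : Prop
    := IsFunctor {
  fmor_hom : forall a b (f : raw C a b), hom C f -> hom D (fmor F f);
  fmor_heq : forall a b (f g : raw C a b), hom C f -> hom C g ->
    heq C f g -> heq D (fmor F f) (fmor F g);
  fmor_idm : forall a, heq D (fmor F (idm C a)) (idm D (F a));
  fmor_cmp : forall a b c (g : raw C b c) (f : raw C a b),
    hom C g -> hom C f ->
    heq D (fmor F (cmp C g f)) (cmp D (fmor F g) (fmor F f)) }.

(* Functors that are the identity on objects.                                 *)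
Definition iofunctor O (C D : catdata O) : Type :=
  forall a b, raw C a b -> raw D a b.

Definition functor_of_io O (C D : catdata O) (F : iofunctor C D) :
    functor C D :=
  @Functor O O C D (fun a => a) F.

Definition is_isomorphism O (C D : catdata O) (F : iofunctor C D) : Prop :=
  [/\ is_category C, is_category D, is_functor (functor_of_io F)
    & exists F' : iofunctor D C, [/\ is_functor (functor_of_io F'),
        forall a b (f : raw C a b), hom C f -> heq C (F' a b (F a b f)) f
      & forall a b (g : raw D a b), hom D g -> heq D (F a b (F' a b g)) g]].

Definition transformation O P (C : catdata O) (D : catdata P)
    (F F' : functor C D) : Type :=
  forall a, raw D (F a) (F' a).

(* The quotient of C by the congruence ~ defined by a class of morphisms.     *)
Definition tilde O (C : catdata O) (act : forall a b, raw C a b -> Prop) :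
    catdata O :=
  {| raw := raw C;
     hom := @hom O C;
     heq := fun a b (f f' : raw C a b) =>
       forall c (g : raw C c a), hom C g ->
         act c b (cmp C f g) \/ act c b (cmp C f' g) ->
         heq C (cmp C f g) (cmp C f' g);
     idm := idm C;
     cmp := @cmp O C |}.

Definition quotient_functor O (C : catdata O)
    (act : forall a b, raw C a b -> Prop) : iofunctor C (tilde act) :=
  fun a b f => f.

(* The pullback of F along T. As T is the identity on objects, an object of   *)
(* the pullback is determined by its component in C.                          *)
Definition pullback O P (C : catdata O) (D E : catdata P)
    (F : functor C E) (T : iofunctor D E) : catdata O :=
  {| raw := fun a b => (raw C a b * raw D (F a) (F b))%type;
     hom := fun a b fg =>
       [/\ hom C fg.1, hom D fg.2 & heq E (fmor F fg.1) (T _ _ fg.2)];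
     heq := fun a b fg fg' => heq C fg.1 fg'.1 /\ heq D fg.2 fg'.2;
     idm := fun a => (idm C a, idm D (F a));
     cmp := fun a b c fg fg' => (cmp C fg.1 fg'.1, cmp D fg.2 fg'.2) |}.

Section Base.

Variable G : group_operad.

Record emor m n := EMor { ephi : nabla m n; eel : G m }.

Definition Ecat : catdata nat :=
  {| raw := emor;
     hom := fun m n _ => True;
     heq := fun m n p p' =>
       ephi p = ephi p' /\ same_coset (KecBar (ephi p)) (eel p) (eel p');
     idm := fun n => EMor (nabla_id n) 1;
     cmp := fun l m n q p =>
       EMor (nabla_comp (ephi q) (act (eel q) (ephi p)))
            (pull (ephi p) (eel q) * eel p) |}.

Record gmor m n := GMor { gphi : nabla m n; gu : G m; gel : G m }.

Definition Gcat : catdata nat :=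
  {| raw := gmor;
     hom := fun m n p => DecBar (gphi p) (gu p);
     heq := fun m n p p' =>
       [/\ gphi p = gphi p', same_coset (Inr (gphi p)) (gu p) (gu p')
         & same_coset (KecBar (gphi p)) (gel p) (gel p')];
     idm := fun n => GMor (nabla_id n) 1 1;
     cmp := fun l m n q p =>
       GMor (nabla_comp (gphi q) (act (gel q) (gphi p)))
            (pull (gphi p) (gu q * gel q) * gu p * (pull (gphi p) (gel q))^-1)
            (pull (gphi p) (gel q) * gel p) |}.

Definition tfun m n (p : gmor m n) : emor m n :=
  EMor (gphi p) (gu p * gel p).

Definition eactive m n (p : emor m n) : Prop := active (ephi p).
Definition gactive m n (p : gmor m n) : Prop := active (gphi p).

Definition Etilde : catdata nat := @tilde nat Ecat eactive.
Definition Gtilde : catdata nat := @tilde nat Gcat gactive.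

Definition t : iofunctor Gcat Ecat := tfun.
Definition ttilde : iofunctor Gtilde Etilde := tfun.

End Base.

(* The hom-sets M(a_1 ... a_n; b) are the subsets mhom [:: a_1; ...; a_n] b   *)
(* of an ambient type of multimorphisms; composition is subject to laws only  *)
(* on composable families.                                                    *)

Record mcatdata := MCatData {
  mob : Type;
  marr : Type;
  mhom : seq mob -> mob -> marr -> Prop;
  mid1 : mob -> marr;
  mcomp : marr -> seq marr -> marr }.

Arguments mhom : clear implicits.
Arguments mid1 : clear implicits.
Arguments mcomp : clear implicits.

(* f_i : ass_i -> b_i for all i, the three sequences being of the same length *)
Fixpoint mhoms (M : mcatdata) (ass : seq (seq (mob M))) (bs : seq (mob M))
    (fs : seq (marr M)) : Prop :=
  match ass, bs, fs with
  | [::], [::], [::] => True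
  | a :: ass', b :: bs', f :: fs' => mhom M a b f /\ mhoms ass' bs' fs'
  | _, _, _ => False
  end.

Record is_multicategory (M : mcatdata) : Prop := IsMulticategory {
  mhom_id : forall a, mhom M [:: a] a (mid1 M a);
  mhom_comp : forall ass bs c g fs,
    mhom M bs c g -> mhoms ass bs fs -> mhom M (flatten ass) c (mcomp M g fs);
  mcompA : forall zss ass bs c g fs hss,
    mhom M bs c g -> mhoms ass bs fs ->
    [seq size hs | hs <- hss] = [seq size a | a <- ass] ->
    mhoms zss (flatten ass) (flatten hss) ->
    mcomp M (mcomp M g fs) (flatten hss)
    = mcomp M g [seq mcomp M p.1 p.2 | p <- zip fs hss];
  mcomp1f : forall a b f, mhom M a b f -> mcomp M (mid1 M b) [:: f] = f;
  mcompf1 : forall a b f, mhom M a b f ->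
    mcomp M f [seq mid1 M c | c <- a] = f }.

Record mfunctor (M N : mcatdata) := MFunctor {
  mfob : mob M -> mob N;
  mfarr : marr M -> marr N }.

Record is_multifunctor M N (F : mfunctor M N) : Prop := IsMultifunctor {
  mfarr_hom : forall a b f, mhom M a b f ->
    mhom N [seq mfob F c | c <- a] (mfob F b) (mfarr F f);
  mfarr_id : forall a, mfarr F (mid1 M a) = mid1 N (mfob F a);
  mfarr_comp : forall ass bs c g fs, mhom M bs c g -> mhoms ass bs fs ->
    mfarr F (mcomp M g fs) = mcomp N (mfarr F g) [seq mfarr F f | f <- fs] }.

Record is_multinatural M N (F F' : mfunctor M N) (alpha : mob M -> marr N) :
    Prop := IsMultinatural {
  mnat_hom : forall a, mhom N [:: mfob F a] (mfob F' a) (alpha a);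
  mnat_nat : forall a b f, mhom M a b f ->
    mcomp N (alpha b) [:: mfarr F f]
    = mcomp N (mfarr F' f) [seq alpha c | c <- a] }.

Section Semidirect.

Variable G : group_operad.

Definition semidirect (M : mcatdata) : mcatdata :=
  {| mob := mob M;
     marr := (marr M * op G)%type;
     mhom := fun a b fx => tag fx.2 = size a
       /\ mhom M (permute_seq (gsym (tagged fx.2)) a) b fx.1;
     mid1 := fun a => (mid1 M a, Op (gid G));
     mcomp := fun fx s =>
       (mcomp M fx.1 (permute_seq (gsym (tagged fx.2)) [seq p.1 | p <- s]),
        gam fx.2 [seq p.2 | p <- s]) |}.

Definition semidirect_map M N (F : mfunctor M N) :
    mfunctor (semidirect M) (semidirect N) :=
  @MFunctor (semidirect M) (semidirect N) (mfob F)
    (fun fx => (mfarr F fx.1, fx.2)).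

Definition semidirect_trans M N (alpha : mob M -> marr N) :
    mob (semidirect M) -> marr (semidirect N) :=
  fun a => (alpha a, Op (1 : G 1%N)).

Record wmor (M : mcatdata) m n := WMor {
  wphi : nabla m n;
  warr : n.-tuple (marr M);
  wel : G m }.

Section Wreath.

Variable M : mcatdata.

Definition wraw (a b : word (mob M)) : Type := wmor M (wlen a) (wlen b).

Definition wemor m n (p : wmor M m n) : emor G m n := EMor (wphi p) (wel p).

Definition whom (a b : word (mob M)) (p : wraw a b) : Prop :=
  forall j, mhom M (fibre (wphi p) (permute (gsym (wel p)) (wtup a)) j)
                   (tnth (wtup b) j) (tnth (warr p) j).

Definition widm (a : word (mob M)) : wraw a a :=
  WMor (nabla_id (wlen a)) [tuple mid1 M (tnth (wtup a) i) | i < wlen a] 1.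

Definition wcmp (a b c : word (mob M)) (q : wraw b c) (p : wraw a b) :
    wraw a c :=
  WMor (nabla_comp (wphi q) (act (wel q) (wphi p)))
       [tuple mcomp M (tnth (warr q) j)
          (fibre (wphi q) (permute (gsym (wel q)) (warr p)) j) | j < wlen c]
       (pull (wphi p) (wel q) * wel p).

Definition wreathE : catdata (word (mob M)) :=
  {| raw := wraw; hom := whom; idm := widm; cmp := wcmp;
     heq := fun a b p p' =>
       heq (Ecat G) (wemor p) (wemor p') /\ warr p = warr p' |}.

Definition wreathEtilde : catdata (word (mob M)) :=
  {| raw := wraw; hom := whom; idm := widm; cmp := wcmp;
     heq := fun a b p p' =>
       heq (Etilde G) (wemor p) (wemor p') /\ warr p = warr p' |}.

Definition projE : functor wreathE (Ecat G) :=
  @Functor _ _ wreathE (Ecat G) (@wlen (mob M)) (fun a b p => wemor p).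
Definition projEtilde : functor wreathEtilde (Etilde G) :=
  @Functor _ _ wreathEtilde (Etilde G) (@wlen (mob M)) (fun a b p => wemor p).

Definition wreathG : catdata (word (mob M)) :=
  pullback projE (@t G).
Definition wreathGtilde : catdata (word (mob M)) :=
  pullback projEtilde (@ttilde G).

Definition quotE : iofunctor wreathE wreathEtilde := fun a b p => p.
Definition quotG : iofunctor wreathG wreathGtilde := fun a b p => p.

Definition wgmor (a b : word (mob M)) (phi : nabla (wlen a) (wlen b))
    (f : (wlen b).-tuple (marr M)) (u x : G (wlen a)) :
    wraw a b * gmor G (wlen a) (wlen b) :=
  (WMor phi f (u * x), GMor phi u x).

End Wreath.

Definition wmap M N (F : mfunctor M N) m n (p : wmor M m n) : wmor N m n :=
  WMor (wphi p) (map_tuple (mfarr F) (warr p)) (wel p).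

Definition wreathEtilde_map M N (F : mfunctor M N) :
    functor (wreathEtilde M) (wreathEtilde N) :=
  @Functor _ _ (wreathEtilde M) (wreathEtilde N)
    (map_word (mfob F)) (fun a b p => wmap F p).

Definition wreathGtilde_map M N (F : mfunctor M N) :
    functor (wreathGtilde M) (wreathGtilde N) :=
  @Functor _ _ (wreathGtilde M) (wreathGtilde N)
    (map_word (mfob F)) (fun a b pg => (wmap F pg.1, pg.2)).

Definition wtrans M N (alpha : mob M -> marr N) (a : word (mob M)) :
    wmor N (wlen a) (wlen a) :=
  WMor (nabla_id (wlen a)) (map_tuple alpha (wtup a)) 1.

Definition wreathEtilde_trans M N (F F' : mfunctor M N)
    (alpha : mob M -> marr N) :
    transformation (wreathEtilde_map F) (wreathEtilde_map F') :=
  fun a => wtrans alpha a.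

Definition wreathGtilde_trans M N (F F' : mfunctor M N)
    (alpha : mob M -> marr N) :
    transformation (wreathGtilde_map F) (wreathGtilde_map F') :=
  fun a => (wtrans alpha a, idm (Gtilde G) (wlen a)).

Definition phi_formula M m n (phi : nabla m n) (f : n.-tuple (marr M))
    (u x : G m) : wmor (semidirect M) m n :=
  WMor (M := semidirect M) phi
    [tuple (tnth f j, Op (pull (delta phi j) u)) | j < n] x.

Definition Phi M : iofunctor (wreathG M) (wreathE (semidirect M)) :=
  fun a b pg =>
    phi_formula (gphi pg.2) (warr pg.1) (gu pg.2) (gel pg.2).

(* Since every T M is the identity on objects, the two conditions are the     *)
(* equality of the two composite functors, and of the two whiskerings.        *)
Definition is_2natural
    (T : forall M, iofunctor (wreathGtilde M) (wreathEtilde (semidirect M))) :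
    Prop :=
  (forall M N (F : mfunctor M N), is_multicategory M -> is_multicategory N ->
     is_multifunctor F ->
     forall a b (p : raw (wreathGtilde M) a b), hom (wreathGtilde M) p ->
     heq (wreathEtilde (semidirect N))
       (T N _ _ (fmor (wreathGtilde_map F) p))
       (fmor (wreathEtilde_map (semidirect_map F)) (T M a b p)))
  /\
  (forall M N (F F' : mfunctor M N) (alpha : mob M -> marr N),
     is_multicategory M -> is_multicategory N ->
     is_multifunctor F -> is_multifunctor F' -> is_multinatural F F' alpha ->
     forall a : word (mob M),
     heq (wreathEtilde (semidirect N))
       (T N _ _ (wreathGtilde_trans F F' alpha a))
       (wreathEtilde_trans (semidirect_map F) (semidirect_map F')
          (semidirect_trans alpha) a)).

End Semidirect.

(* Main.v *)
(* Everything is tested on active composites. A map psi with phi psi^x active  *)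
(* sees of (phi, x) only phi psi^x and the class of psi^*(x) modulo Kec, and   *)
(* of (phi, u, x) in addition the element (psi^x)^*(u), which lies in Dec for  *)
(* an active map and is therefore determined by its components delta_j^*.      *)
(* Choosing psi with psi^x = delta_j shows that equivalent representatives     *)
(* have the same elements delta_j^*(u); conversely, every component of         *)
(* (psi^x)^*(u) is a pullback of some delta_j^*(u). So the functor given by    *)
(* the formula of Phi is well defined and faithful, and it is full because any *)
(* family (d_j) is the family of delta_j^*(u) for                              *)
(* u = gamma(e_{n+2}; e, d_1, ..., d_n, e). Coordinates in the blocks of arity *)
(* 0 do not matter because G 0 is trivial.                                     *)

Require Import Defs.
From mathcomp Require Import all_boot.
From mathcomp Require Import fingroup perm.

Set Implicit Arguments.
Unset Strict Implicit.
Unset Printing Implicit Defensive.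

Local Open Scope group_scope.

(** The calculus rests on three facts about [pull]: it is functorial in the interval map
    ([pull_comp]), it is a crossed homomorphism ([pullM]), and it covers the action on points
    ([pull_square]). They are obtained by rewriting [pull] as one inflation by fibre sizes and by
    the fact that fibre sizes determine an interval map.

    The quotient relation is then reduced to conditions on representatives, [relE] and [relG],
    tested by bare interval maps ([heq_EtildeP], [heq_GtildeP]): the group label of a test morphism
    cancels, and its decomposable label only enters through a conjugate that depends on a
    permutation alone ([conj_sym_eq]). For an active map a decomposable element is the block sum of
    its components ([Dec_comps], [Dec_sep]). Hence, over equivalent underlying morphisms (phi, x),
    two triples are equivalent exactly when all delta_j^* u agree ([relG_delta], [relG_of_delta]):
    the formula is well defined and injective on hom-sets.

    It preserves composition because delta_j^* of the second component of a composite is an operadic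
    composite ([pull_delta_cmp]), while the source words match by [fibre_RSt] and [fibre_comp]. It
    is surjective because a block sum has arbitrary prescribed components
    ([pull_delta_section_elt]). [isomorphism_of_section] assembles this. The square and 2-naturality
    are componentwise, since the functor is given on representatives by the formula of [Phi]. *)

(** * Sorted sequences cut into fibres *)

Lemma eq_from_all_nth (T : Type) (s t : seq T) : size s = size t ->
  (forall x0 i, (i < size s)%N -> nth x0 s i = nth x0 t i) -> s = t.
Proof.
by case: s => [|x0 s] st nth_st; [case: t st nth_st | apply: (eq_from_nth (x0 :=
  x0)) => // i; apply: nth_st].
Qed.

Lemma card_count (T : finType) (A : {pred T}) : #|A| = count [in A] (enum T).
Proof. by rewrite cardE {1}/enum_mem size_filter enumT. Qed.

(** Elements with the same value of f are adjacent in s, so raising the bound from N to N+1 appends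
    exactly the run of value N. *)
Lemma flatten_filter_iota (T : Type) (f : T -> nat) (N : nat) (s : seq T) :
  sorted (fun x y => f x <= f y)%N s ->
  flatten [seq [seq x <- s | f x == j] | j <- iota 0 N]
  = [seq x <- s | (f x < N)%N].
Proof.
move=> s_sorted; elim: N => [|N IHN].
  by rewrite /= -(filter_pred0 s); apply: eq_filter => x.
rewrite -addn1 iotaD map_cat flatten_cat IHN /= cats0 add0n addn1.
elim: s s_sorted {IHN} => //= x s IHs x_s.
have {IHs}IH := IHs (path_sorted x_s); rewrite [(f x < N.+1)%N]ltnS [(f x <=
  N)%N]leq_eqVlt.
case: (ltngtP (f x) N) => /= fx; rewrite -IH //.
  suff -> : [seq y <- s | (f y < N)%N] = [::] by [].
have tr: transitive (fun x y => f x <= f y)%N by move=> ? ? ?; apply: leq_trans.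
have := order_path_min tr x_s; elim: s {IH x_s} => //= y s IHs /andP[xy /IHs->].
by rewrite ltnNge -fx xy.
Qed.

Lemma flatten_fibre (T : Type) (N : nat) (f : T -> 'I_N) (s : seq T) :
  sorted (fun x y => f x <= f y)%N s ->
  flatten [seq [seq x <- s | f x == j] | j <- enum 'I_N] = s.
Proof.
move=> s_sorted; have := flatten_filter_iota N s_sorted.
rewrite (eq_filter (a2 := predT)) ?filter_predT; last by move=> x /=; rewrite ltn_ord.
by rewrite -val_enum_ord -map_comp.
Qed.

Lemma ord_enum_sorted m : sorted (fun i j : 'I_m => i <= j)%N (enum 'I_m).
Proof. by have := iota_sorted 0 m; rewrite -val_enum_ord sorted_map. Qed.

Lemma sorted_ord_monotone m N (f : 'I_m -> 'I_N) (s : seq 'I_m) :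
  {homo f : i j / (i <= j)%N >-> (i <= j)%N} -> subseq s (enum 'I_m) ->
  sorted (fun i j => f i <= f j)%N s.
Proof.
move=> f_homo s_sub.
have f_sub : subrel (fun i j : 'I_m => i <= j)%N (fun i j => f i <= f j)%N by
  move=> i j; apply: f_homo.
apply: (sub_sorted f_sub).
apply: subseq_sorted s_sub (ord_enum_sorted m).
by move=> ? ? ?; apply: leq_trans.
Qed.

Lemma ltn_ord_enum_sorted m : sorted (fun i j : 'I_m => i < j)%N (enum 'I_m).
Proof. by have := iota_ltn_sorted 0 m; rewrite -val_enum_ord sorted_map. Qed.

(** * Interval maps and their fibres *)

Lemma mid_inj n : injective (@mid n).
Proof. by move=> i j /lift_inj /(congr1 val) /= /val_inj. Qed.

Lemma mid_neq0 n (j : 'I_n) : (mid j == ord0) = false.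
Proof. by rewrite -val_eqE. Qed.

Lemma mid_neq_max n (j : 'I_n) : (mid j == ord_max) = false.
Proof. by rewrite -val_eqE /= /bump /= add1n eqSS ltn_eqF. Qed.

Variant mid_spec n : 'I_n.+2 -> Type :=
  | MidSpec0 : mid_spec ord0
  | MidSpecMax : mid_spec ord_max
  | MidSpec j : mid_spec (mid j).

Lemma midP n (i : 'I_n.+2) : mid_spec i.
Proof.
case: (unliftP ord0 i) => [i1 ->|->]; last exact: MidSpec0.
case: (unliftP ord_max i1) => [j ->|->].
  suff -> : lift ord0 (lift ord_max j) = mid j by apply: MidSpec.
  by apply: val_inj; rewrite /= [bump n j]/bump leqNgt ltn_ord.
suff -> : lift ord0 (@ord_max n) = ord_max by apply: MidSpecMax.
by apply: val_inj.
Qed.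

Lemma mid_mono n (i j : 'I_n) : (mid i <= mid j)%N = (i <= j)%N.
Proof. by []. Qed.

Lemma enum_mid n : enum 'I_n.+2 = ord0 :: rcons [seq mid j | j <- enum 'I_n] ord_max.
Proof.
apply: (inj_map val_inj); rewrite val_enum_ord map_cons map_rcons -map_comp.
rewrite (eq_map (g := (addn 1 \o val))) // map_comp val_enum_ord -iotaDl.
by have := iotaD 0 n.+1 1; rewrite addn1 cats1.
Qed.

Definition unmid n (i : 'I_n.+2) : option 'I_n := [pick j | mid j == i].

Lemma unmid_mid n (j : 'I_n) : unmid (mid j) = Some j.
Proof.
by rewrite /unmid; case: pickP => [i /eqP/mid_inj->|/(_ j)] //; rewrite eqxx.
Qed.

Lemma unmid0 n : unmid (ord0 : 'I_n.+2) = None.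
Proof. by rewrite /unmid; case: pickP => // j; rewrite mid_neq0. Qed.

Lemma unmid_max n : unmid (ord_max : 'I_n.+2) = None.
Proof. by rewrite /unmid; case: pickP => // j; rewrite mid_neq_max. Qed.

(** The permutation of <<n>> fixing both ends, in general not monotone, through which operations act
    on points. *)
Definition ext n (s : {perm 'I_n}) (i : 'I_n.+2) : 'I_n.+2 :=
  if unmid i is Some j then mid (s j) else i.

Section Ext.

Variable n : nat.
Implicit Types s t : {perm 'I_n}.

Lemma ext_mid s j : ext s (mid j) = mid (s j).
Proof. by rewrite /ext unmid_mid. Qed.

Lemma ext0 s : ext s ord0 = ord0.
Proof. by rewrite /ext unmid0. Qed.

Lemma ext_max s : ext s ord_max = ord_max.
Proof. by rewrite /ext unmid_max. Qed.

Lemma extK s : cancel (ext s) (ext s^-1).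
Proof. by move=> i; case: (midP i) => [||j]; rewrite ?ext0 ?ext_max ?ext_mid
  ?permK. Qed.

Lemma extKV s : cancel (ext s^-1) (ext s).
Proof. by move=> i; case: (midP i) => [||j]; rewrite ?ext0 ?ext_max ?ext_mid
  ?permKV. Qed.

Lemma ext_inj s : injective (ext s).
Proof. exact: can_inj (extK s). Qed.

Lemma extM s t i : ext (s * t) i = ext t (ext s i).
Proof. by case: (midP i) => [||j]; rewrite ?ext0 ?ext_max ?ext_mid ?permM. Qed.

Lemma ext1 i : ext (1 : {perm 'I_n}) i = i.
Proof. by case: (midP i) => [||j]; rewrite ?ext0 ?ext_max ?ext_mid ?perm1. Qed.

End Ext.

Section Nabla.

Lemma nabla0 m n (phi : nabla m n) : phi ord0 = ord0.
Proof. by have /and3P[/eqP] := nabla_axiom phi. Qed.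

Lemma nabla_max m n (phi : nabla m n) : phi ord_max = ord_max.
Proof. by have /and3P[_ /eqP] := nabla_axiom phi. Qed.

Lemma nabla_homo m n (phi : nabla m n) :
  {homo phi : i j / (i <= j)%N >-> (i <= j)%N}.
Proof.
by have /and3P[_ _ /forallP phiL] := nabla_axiom phi => i j ij; have /forallP/(_
  j)/implyP := phiL i; apply.
Qed.

Lemma nablaP m n (phi psi : nabla m n) : phi =1 psi -> phi = psi.
Proof. by move=> eq_pp; apply: val_inj; apply/ffunP. Qed.

Lemma nabla_compE l m n (psi : nabla m n) (phi : nabla l m) i :
  nabla_comp psi phi i = psi (phi i).
Proof. by rewrite ffunE. Qed.

Lemma nabla_idE n i : nabla_id n i = i.
Proof. by rewrite ffunE. Qed.

Lemma nabla_compA k l m n (chi : nabla m n) (psi : nabla l m) (phi : nabla k l) :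
  nabla_comp chi (nabla_comp psi phi) = nabla_comp (nabla_comp chi psi) phi.
Proof. by apply: nablaP => i; rewrite !nabla_compE. Qed.

Lemma nabla_comp1 m n (phi : nabla m n) : nabla_comp phi (nabla_id m) = phi.
Proof. by apply: nablaP => i; rewrite nabla_compE nabla_idE. Qed.

Lemma nabla_1comp m n (phi : nabla m n) : nabla_comp (nabla_id n) phi = phi.
Proof. by apply: nablaP => i; rewrite nabla_compE nabla_idE. Qed.

(** The values of a monotone map form constant runs whose lengths are the fibre sizes; hence those
    sizes determine the map. *)
Lemma nabla_codom m n (phi : nabla m n) :
  [seq phi i | i <- enum 'I_m.+2]
  = flatten [seq nseq #|fib phi j| j | j <- enum 'I_n.+2].
Proof.
rewrite -{1}(@flatten_fibre _ _ phi (enum 'I_m.+2)); last first.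
  by apply: sorted_ord_monotone (subseq_refl _); apply: nabla_homo.
rewrite map_flatten -map_comp; congr flatten; apply: eq_map => j /=.
have -> : #|fib phi j| = size [seq i <- enum 'I_m.+2 | phi i == j].
  by rewrite card_count size_filter; apply: eq_count => i; rewrite /= inE.
by elim: (enum _) => //= i s IHs; case: eqP => //= ->; rewrite IHs.
Qed.

Lemma nabla_eq_card m n (phi psi : nabla m n) :
  (forall j, #|fib phi j| = #|fib psi j|) -> phi = psi.
Proof.
move=> eq_card; apply: nablaP; have : [seq phi i | i <- enum 'I_m.+2] = [seq psi
  i | i <- enum 'I_m.+2].
  by rewrite !nabla_codom; congr flatten; apply: eq_map => j; rewrite eq_card.
by move/eq_in_map => eq_pp i; apply: eq_pp; rewrite mem_enum.
Qed.

(** An injective self-map of a finite set is bijective, so composing with it does not change fibre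
    sizes. *)
Lemma nabla_eq_inj m n (phi psi : nabla m n) (f : 'I_m.+2 -> 'I_m.+2) :
  injective f -> (forall i, phi (f i) = psi i) -> phi = psi.
Proof.
move=> f_inj eq_pp; apply: nabla_eq_card => j.
rewrite -(card_imset (mem (fib psi j)) f_inj); apply: eq_card => i.
have [g _ gK] := injF_bij f_inj.
by rewrite -[i in LHS]gK inE eq_pp -[i in RHS]gK mem_imset // inE.
Qed.

(** The map is read off the word repeating each j exactly k j times; nonempty runs at both ends make
    it preserve the ends. *)
Lemma nabla_ex m n (k : 'I_n.+2 -> nat) :
  (0 < k ord0)%N -> (0 < k ord_max)%N -> sumn [seq k j | j <- enum 'I_n.+2] = m.+2 ->
  exists psi : nabla m n, forall j, #|fib psi j| = k j.
Proof.
move=> k0 kM k_sum; pose ss := [seq nseq (k j) j | j <- enum 'I_n.+2].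
have shape_ss : shape ss = [seq k j | j <- enum 'I_n.+2].
  by rewrite /shape -map_comp; apply: eq_map => j /=; rewrite size_nseq.
have size_ss : size (flatten ss) = m.+2 by rewrite size_flatten shape_ss.
pose h (i : 'I_m.+2) := nth ord0 (flatten ss) i.
have hE : [seq h i | i <- enum 'I_m.+2] = flatten ss.
  by rewrite (map_comp (nth ord0 (flatten ss)) val) val_enum_ord -size_ss
    map_nth_iota0 ?take_size.
(* The letter at i is the index of the run containing i, which makes monotonicity an instance of
   [reshape_leq]. *)
have h_val (i : 'I_m.+2) : h i = reshape_index (shape ss) i :> nat.
  have i_lt : (i < sumn (shape ss))%N by rewrite shape_ss k_sum.
  have := reshape_indexP i_lt; have := reshape_offsetP i_lt.
  rewrite /h nth_flatten; set r := reshape_index _ _; set c := reshape_offset _ _.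
  rewrite shape_ss size_map size_enum_ord => c_lt r_lt.
  have c_lt' : (c < k (Ordinal r_lt))%N.
    by move: c_lt; rewrite (nth_map ord0) ?size_enum_ord // (nth_ord_enum ord0
      (Ordinal r_lt)).
  rewrite (nth_map ord0) ?size_enum_ord // (nth_ord_enum ord0 (Ordinal r_lt)).
  by rewrite nth_nseq c_lt'.
have h_homo (i j : 'I_m.+2) : (i <= j)%N -> (h i <= h j)%N.
  rewrite (reshape_leq (shape ss)) -!h_val.
  by case/orP => [/ltnW//|/andP[/eqP->]].
have h_surj j : (0 < k j)%N -> exists i, h i = j.
  move=> kj; have : j \in [seq h i | i <- enum 'I_m.+2].
    rewrite hE; apply/flattenP; exists (nseq (k j) j); last by rewrite mem_nseq kj eqxx.
    by apply/map_f; rewrite mem_enum.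
  by case/mapP => i _ ->; exists i.
have h_int : is_interval_map [ffun i => h i].
  apply/and3P; split; rewrite ?ffunE.
  - have [i hi] := h_surj _ k0; have := h_homo ord0 i isT.
    by rewrite hi leqn0 -val_eqE.
  - have [i hi] := h_surj _ kM; have := h_homo i ord_max (leq_ord i).
    by rewrite hi -val_eqE eqn_leq leq_ord => ->.
  - by apply/forallP=> i; apply/forallP => j; rewrite !ffunE; apply/implyP;
    apply: h_homo.
exists (Nabla h_int) => j.
have -> : #|fib (Nabla h_int) j| = count (pred1 j) [seq h i | i <- enum 'I_m.+2].
  rewrite count_map card_count; apply: eq_count => i.
  by rewrite inE /= ffunE.
rewrite hE count_flatten -map_comp sumnE big_map big_enum /= (bigD1 j) //=.
rewrite count_nseq /= eqxx mul1n big1 ?addn0 // => i /negbTE ij.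
by rewrite count_nseq /= ij.
Qed.

End Nabla.

(** * Fibres as words of inner points *)

Section Fibres.

(** Lists only inner points of the source, whereas j may be an end; the sizes are therefore the
    entries of [ktuple]. *)
Definition block m n (phi : nabla m n) (j : 'I_n.+2) : seq 'I_m :=
  [seq i <- enum 'I_m | phi (mid i) == j].

Lemma card_fib m n (phi : nabla m n) j :
  #|fib phi j| = ((ord0 == j) + (size (block phi j) + (ord_max == j)))%N.
Proof.
rewrite card_count enum_mid /= -cats1 count_cat /= addn0 !inE nabla0 nabla_max.
rewrite count_map size_filter; congr (_ + (_ + _))%N.
by apply: eq_count => i; rewrite /= inE.
Qed.

Lemma kmid_block m n (phi : nabla m n) j : kmid phi j = size (block phi (mid j)).
Proof.
by rewrite /kmid card_fib ![_ == mid j]eq_sym mid_neq0 mid_neq_max addn0.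
Qed.

Lemma kmid_id n (i : 'I_n) : kmid (nabla_id n) i = 1%N.
Proof.
have <- : count_mem i (enum 'I_n) = 1%N by rewrite count_uniq_mem ?enum_uniq //
  mem_enum.
rewrite kmid_block size_filter.
by apply: eq_count => i' /=; rewrite nabla_idE (inj_eq (@mid_inj n)).
Qed.

Lemma kminus_block m n (phi : nabla m n) : kminus phi = size (block phi ord0).
Proof. by rewrite /kminus card_fib eqxx addn0. Qed.

Lemma kplus_block m n (phi : nabla m n) : kplus phi = size (block phi ord_max).
Proof. by rewrite /kplus card_fib eqxx addn1. Qed.

Lemma ktuple_block m n (phi : nabla m n) :
  ktuple phi = [seq size (block phi j) | j <- enum 'I_n.+2].
Proof.
rewrite /ktuple enum_mid /= map_rcons -map_comp kminus_block kplus_block cats1.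
by congr (_ :: rcons _ _); apply: eq_map => j /=; rewrite kmid_block.
Qed.

Definition full m n (phi : nabla m n) : seq nat :=
  [seq #|fib phi j| | j <- enum 'I_n.+2].

Definition kseq m n (phi : nabla m n) : seq nat :=
  [seq kmid phi j | j <- enum 'I_n].

Lemma full_kseq m n (phi : nabla m n) :
  full phi = (kminus phi).+1 :: rcons (kseq phi) (kplus phi).+1.
Proof.
rewrite /full enum_mid /= map_rcons -map_comp !card_fib kminus_block kplus_block.
by rewrite !eqxx /= addn0 addn1.
Qed.

Lemma sumn_full m n (phi : nabla m n) : sumn (full phi) = m.+2.
Proof.
rewrite full_kseq /= sumn_rcons addSn !addnS; congr _.+2.
by rewrite -[RHS](ktuple_sum phi) /kseq /= enumT.
Qed.

Lemma flatten_block m n (phi : nabla m n) :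
  flatten [seq block phi j | j <- enum 'I_n.+2] = enum 'I_m.
Proof.
rewrite (flatten_fibre (f := fun i => phi (mid i))) //.
by apply: sorted_ord_monotone (subseq_refl _) => i j ij; apply: nabla_homo.
Qed.

Lemma sumn_ktuple m n (phi : nabla m n) : sumn (ktuple phi) = m.
Proof.
by rewrite ktuple_block -[RHS]size_enum_ord -(flatten_block phi) size_flatten
  /shape -[in RHS]map_comp.
Qed.

Lemma mem_block m n (phi : nabla m n) i j : (i \in block phi j) = (phi (mid i) == j).
Proof. by rewrite mem_filter mem_enum andbT. Qed.

Lemma activeP m n (phi : nabla m n) :
  active phi <-> forall i, exists j, phi (mid i) = mid j.
Proof.
rewrite /active kminus_block kplus_block; split=> [[k0 kM] i | act_phi].
  have := mem_block phi i (phi (mid i)); rewrite eqxx.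
  case: (midP (phi (mid i))) => [||j]; last by exists j.
    by rewrite (size0nil k0).
  by rewrite (size0nil kM).
have aux j : (forall l, j != mid l) -> size (block phi j) = 0%N.
  move=> j_mid; case def_b: (block phi j) => [//|i b].
  have := mem_block phi i j; rewrite def_b mem_head => /esym/eqP phi_i.
  by have [l] := act_phi i; rewrite phi_i => jl; have := j_mid l; rewrite jl eqxx.
by split; apply: aux => l; rewrite eq_sym ?mid_neq0 ?mid_neq_max.
Qed.

Lemma active_comp_r l m n (psi : nabla m n) (phi : nabla l m) :
  active (nabla_comp psi phi) -> active phi.
Proof.
move/activeP=> act_pp; apply/activeP => i; have [j] := act_pp i; rewrite nabla_compE.
case: (midP (phi (mid i))) => [||j' _]; last by exists j'.
  by move/esym/eqP; rewrite nabla0 mid_neq0.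
by move/esym/eqP; rewrite nabla_max mid_neq_max.
Qed.

Lemma active_id n : active (nabla_id n).
Proof. by apply/activeP => i; exists i; rewrite nabla_idE. Qed.

Lemma block_flatten m n (f : 'I_n.+2 -> bool) (g : nabla m n) :
  flatten [seq block g j | j <- enum 'I_n.+2 & f j]
  = [seq i <- enum 'I_m | f (g (mid i))].
Proof.
rewrite -[in RHS](flatten_block g) filter_flatten -map_comp.
elim: (enum _) => //= j s <-.
have -> : [seq i <- block g j | f (g (mid i))] = if f j then block g j else [::].
  rewrite -filter_predI; case: ifP => fj.
    by apply: eq_filter => i /=; case: eqP => [->|]; rewrite ?fj ?andbF.
  rewrite -(filter_pred0 (enum 'I_m)); apply: eq_filter => i /=.
  by case: eqP => [->|]; rewrite ?fj ?andbF.
by case: ifP.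
Qed.

Lemma block_comp l m n (psi : nabla m n) (phi : nabla l m) (j : 'I_n) :
  block (nabla_comp psi phi) (mid j)
  = flatten [seq block phi (mid i) | i <- block psi (mid j)].
Proof.
have -> : block (nabla_comp psi phi) (mid j) = [seq i <- enum 'I_l | psi (phi
  (mid i)) == mid j].
  by apply: eq_filter => i; rewrite nabla_compE.
rewrite -(block_flatten (fun i => psi i == mid j)) enum_mid /= nabla0.
rewrite eq_sym mid_neq0 -cats1 filter_cat /= nabla_max eq_sym mid_neq_max cats0.
by rewrite filter_map -map_comp.
Qed.

(** Over an end j, inner points that phi itself sends to that end would be missing on the right;
    activity of phi excludes them. *)
Lemma block_comp_active l m n (psi : nabla m n) (phi : nabla l m) j :
  active phi ->
  block (nabla_comp psi phi) j = flatten [seq block phi (mid i) | i <- block psi j].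
Proof.
move=> act_phi.
have -> : block (nabla_comp psi phi) j = [seq i <- enum 'I_l | psi (phi (mid i)) == j].
  by apply: eq_filter => i; rewrite nabla_compE.
case: act_phi; rewrite kminus_block kplus_block => /size0nil b0 /size0nil bM.
rewrite -(block_flatten (fun i => psi i == j)) enum_mid -cat1s -cats1.
rewrite !filter_cat !map_cat !flatten_cat filter_map -map_comp.
by rewrite /= ; do 2 case: ifP => _ /=; rewrite ?b0 ?bM ?cats0.
Qed.

End Fibres.

(** * The inclusions of fibres *)

Section Delta.

Variables (m n : nat) (phi : nabla m n) (j : 'I_n).

Lemma size_block_mid : size (block phi (mid j)) == kmid phi j.
Proof. by rewrite kmid_block. Qed.

Definition dval (s : 'I_(kmid phi j)) : 'I_m := tnth (Tuple size_block_mid) s.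

Lemma map_dval : [seq dval s | s <- enum 'I_(kmid phi j)] = block phi (mid j).
Proof. by rewrite -[RHS]/(tval (Tuple size_block_mid)) -[in RHS]map_tnth_enum. Qed.

Lemma delta_mid s : delta phi j (mid s) = mid (dval s).
Proof.
rewrite ffunE mid_neq0 insubT /= => [|lt_s]; first exact: ltn_ord.
have fibE : enum (fib phi (mid j)) = [seq mid i | i <- block phi (mid j)].
  rewrite {1}/enum_mem -enumT enum_mid /= -cats1 filter_cat /= !inE nabla0 nabla_max.
  rewrite ![_ == mid j]eq_sym mid_neq0 mid_neq_max cats0 filter_map; congr map.
  by apply: eq_filter => i; rewrite /= inE.
by rewrite /dval (tnth_nth (dval s)) (enum_val_nth ord0) fibE (nth_map (dval s))
  -?kmid_block //.
Qed.

Lemma phi_dval s : phi (mid (dval s)) = mid j.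
Proof. by apply/eqP; rewrite -mem_block -map_dval map_f ?mem_enum. Qed.

Lemma dval_inj : injective dval.
Proof.
move=> s t; rewrite /dval !(tnth_nth (dval s)) /= => /eqP.
rewrite nth_uniq ?(eqP size_block_mid) //; last by rewrite filter_uniq ?enum_uniq.
by move/eqP/val_inj.
Qed.

End Delta.

Section DeltaLike.

Variables (m n : nat) (phi : nabla m n) (j : 'I_n).

Lemma phi_delta s : phi (delta phi j (mid s)) = mid j.
Proof. by rewrite delta_mid phi_dval. Qed.

Lemma kmid_delta i : kmid (delta phi j) i = (phi (mid i) == mid j).
Proof.
rewrite kmid_block size_filter.
rewrite (eq_count (a2 := pred1 i \o @dval _ _ phi j)); last first.
  by move=> s /=; rewrite delta_mid (inj_eq (@mid_inj _)).
rewrite -count_map map_dval count_uniq_mem ?mem_block //.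
by rewrite filter_uniq ?enum_uniq.
Qed.

Lemma active_delta : active (delta phi j).
Proof. by apply/activeP => s; rewrite delta_mid; exists (dval s). Qed.

Lemma active_comp_delta : active (nabla_comp phi (delta phi j)).
Proof. by apply/activeP => s; exists j; rewrite nabla_compE phi_delta. Qed.

(** Characterises [delta phi j] with k left free, because fibre sizes of different maps agree only
    propositionally. [delta_like_unique] turns it into an equality of dependent pairs. *)
Definition delta_like k (psi : nabla k m) : Prop :=
  [/\ k = kmid phi j, injective psi & forall s, phi (psi (mid s)) = mid j].

Lemma delta_inj : injective (delta phi j).
Proof.
move=> s t; case: (midP s) => [||{}s]; case: (midP t) => [||{}t];
  rewrite ?nabla0 ?nabla_max ?delta_mid // => /eqP; rewrite ?[ord0 == mid
    _]eq_sym ?[ord_max == mid _]eq_sym ?mid_neq0 ?mid_neq_max //.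
by move/eqP/mid_inj/dval_inj->.
Qed.

Lemma delta_likeP : delta_like (delta phi j).
Proof. by split=> //; [apply: delta_inj | apply: phi_delta]. Qed.

(** Both maps list their images in strictly increasing order, and equal cardinality makes the nested
    images equal. *)
Lemma nabla_inj_image k (psi psi' : nabla k m) : injective psi -> injective psi' ->
  (forall i, exists i', psi i = psi' i') -> psi = psi'.
Proof.
move=> psi_inj psi'_inj psi_sub; apply: nablaP.
suff: [seq psi i | i <- enum 'I_k.+2] = [seq psi' i | i <- enum 'I_k.+2].
  by move/eq_in_map => eq_pp i; apply: eq_pp; rewrite mem_enum.
have sorted_inj (chi : nabla k m) : injective chi ->
    sorted (fun i j : 'I_m.+2 => i < j)%N [seq chi i | i <- enum 'I_k.+2].
  move=> chi_inj; rewrite sorted_map.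
  have: sorted (fun i j : 'I_k.+2 => i < j)%N (enum 'I_k.+2) by apply:
    ltn_ord_enum_sorted.
  apply: sub_sorted => s t /= st.
  rewrite ltn_neqAle nabla_homo ?(ltnW st) // andbT (inj_eq val_inj) (inj_eq chi_inj).
  by rewrite -val_eqE ltn_eqF.
apply: (irr_sorted_eq (leT := fun i j : 'I_m.+2 => i < j)%N); rewrite ?sorted_inj //.
- by move=> ? ? ?; apply: ltn_trans.
- by move=> ?; apply: ltnn.
have sub_pp : {subset [seq psi i | i <- enum 'I_k.+2] <= [seq psi' i | i <- enum
  'I_k.+2]}.
  by move=> _ /mapP[i _ ->]; have [i' ->] := psi_sub i; rewrite map_f ?mem_enum.
have uniq_psi : uniq [seq psi i | i <- enum 'I_k.+2] by rewrite map_inj_uniq ?enum_uniq.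
by have [|_ eq_mem x] := uniq_min_size uniq_psi sub_pp; rewrite ?size_map ?eq_mem.
Qed.

(** The image of [delta phi j] is the fibre over j with the two ends, so psi lifts; the lift is
    monotone since delta is monotone and injective. *)
Lemma delta_like_factor l (psi : nabla l m) :
  (forall s, phi (psi (mid s)) = mid j) ->
  exists chi, psi = nabla_comp (delta phi j) chi.
Proof.
move=> phi_psi.
have psi_im i : exists i', psi i == delta phi j i'.
  case: (midP i) => [||s]; first by exists ord0; rewrite !nabla0.
    by exists ord_max; rewrite !nabla_max.
  have [t psi_s] : exists t, psi (mid s) = mid t.
    apply/activeP: s; apply: (active_comp_r (psi := phi)); apply/activeP => s.
    by exists j; rewrite nabla_compE.
  have: t \in block phi (mid j) by rewrite mem_block -psi_s phi_psi.
  rewrite -map_dval => /mapP[s' _ def_t]; exists (mid s').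
  by rewrite psi_s def_t delta_mid.
pose chi i := xchoose (psi_im i); have chiE i : delta phi j (chi i) = psi i.
  by have /eqP := xchooseP (psi_im i).
have chi_int : is_interval_map [ffun i => chi i].
  apply/and3P; split; rewrite ?ffunE.
  - by rewrite -(inj_eq delta_inj) chiE !nabla0.
  - by rewrite -(inj_eq delta_inj) chiE !nabla_max.
  apply/forallP => s; apply/forallP => t; apply/implyP => st; rewrite !ffunE.
  rewrite leqNgt; apply/negP => lt_ts.
  have le_ts : (psi t <= psi s)%N by rewrite -!chiE; apply/nabla_homo/ltnW.
  have /val_inj : val (psi s) = psi t by apply/eqP; rewrite eqn_leq le_ts nabla_homo.
  by rewrite -!chiE => /delta_inj eq_st; rewrite eq_st ltnn in lt_ts.
by exists (Nabla chi_int); apply: nablaP => i; rewrite nabla_compE -chiE; congr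
  (delta phi j _); rewrite ffunE.
Qed.

Lemma delta_like_unique k (psi : nabla k m) : delta_like psi ->
  existT (fun k => nabla k m) k psi = existT _ (kmid phi j) (delta phi j).
Proof.
case=> def_k; subst k => psi_inj phi_psi; congr existT.
apply: nabla_inj_image => //; first exact: delta_inj.
have [chi ->] := delta_like_factor phi_psi.
by move=> i; exists (chi i); rewrite nabla_compE.
Qed.

End DeltaLike.

(** * Composition with units in a group operad *)

Section Operad.

Variable G : group_operad.
Implicit Types (x y : op G) (s t : seq (op G)).

Definition eop k : op G := Op (1 : G k).

Lemma Op_inj n : injective (@Op G n).
Proof. by move=> x y; apply: eq_from_Tagged. Qed.

Lemma tag_gam x s : size s = tag x -> tag (gam x s) = sumn [seq tag y | y <- s].
Proof. exact: gam_arity (gopP G) x s. Qed.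

Lemma gam_map_assoc (T : Type) x (r : seq T) (a : T -> op G) (b : T -> seq (op G)) :
  size r = tag x -> (forall i, size (b i) = tag (a i)) ->
  gam (gam x [seq a i | i <- r]) (flatten [seq b i | i <- r])
  = gam x [seq gam (a i) (b i) | i <- r].
Proof.
move=> size_r size_b; rewrite (gamA (gopP G)) ?size_map //.
  by congr gam; rewrite zip_map -map_comp.
by rewrite -!map_comp; apply: eq_map => i /=.
Qed.

(** [{perm 'I_n}] composes from left to right, whence the reversed order. *)
Lemma gsymM n (x y : G n) : gsym (x * y) = gsym y * gsym x.
Proof. by apply/permP => i; rewrite permM (symM (gsymP G)). Qed.

Lemma gsym1 n : gsym (1 : G n) = 1.
Proof. by apply: (mulgI (gsym (1 : G n))); rewrite -gsymM !mulg1. Qed.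

Lemma gsymV n (x : G n) : gsym x^-1 = (gsym x)^-1.
Proof. by apply: (mulIg (gsym x)); rewrite -gsymM mulgV gsym1 mulVg. Qed.

(** The product of operations of equal arity, made total so that propositionally equal arities need
    no transport; on other pairs a default is returned. *)
Definition omul x y : op G :=
  untag x (fun z : G (tag x) => Op (tagged x * z)) y.

Lemma omulE n (x y : G n) : omul (Op x) (Op y) = Op (x * y).
Proof. by rewrite /omul (untagE _ _ (erefl : tag (Op y) = tag (Op x))). Qed.

Lemma size_map_enum (T : Type) n (a : 'I_n -> T) : size [seq a i | i <- enum 'I_n] = n.
Proof. by rewrite size_map size_enum_ord. Qed.

Lemma tag_gam_enum n (x : G n) (a : 'I_n -> op G) :
  tag (gam (Op x) [seq a i | i <- enum 'I_n]) = (\sum_(i < n) tag (a i))%N.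
Proof.
rewrite tag_gam ?size_map_enum //.
by rewrite -map_comp sumnE big_map big_enum.
Qed.

(** The law [gam_mul], with the family of the left factor indexed after the permutation by y, which
    absorbs the inverse. *)
Lemma gam_omul n (x y : G n) (a b : 'I_n -> op G) :
  (forall i, tag (a (gsym y i)) = tag (b i)) ->
  gam (Op (x * y)) [seq omul (a (gsym y i)) (b i) | i <- enum 'I_n]
  = omul (gam (Op x) [seq a i | i <- enum 'I_n])
         (gam (Op y) [seq b i | i <- enum 'I_n]).
Proof.
move=> tag_ab; set u := gam _ [seq a i | i <- _]; set v := gam _ [seq b i | i <- _].
have tag_u : tag u = tag v.
  rewrite !tag_gam_enum (reindex_inj (@perm_inj _ (gsym y))) /=.
  by apply: eq_bigr => i _.
pose N := tag v; pose k i := tag (b i).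
pose u' : G N := etagged tag_u; pose v' : G N := tagged v.
have Ou : Op u' = u by apply: etaggedK.
have Ov : Op v' = v by apply: taggedK.
pose xs i : G (k i) := etagged (tag_ab i).
pose ys i : G (k i) := tagged (b i).
have Oxs i : Op (xs i) = a (gsym y i) by apply: etaggedK.
have Oys i : Op (ys i) = b i by apply: taggedK.
rewrite -Ou -Ov omulE.
have <- : gam (Op (x * y)) [seq Op (xs i * ys i) | i <- enum 'I_n] = Op (u' * v').
  apply: (gam_mulP (k := k) (xs := xs) (ys := ys)).
    by rewrite [LHS]Ou; congr gam; apply: eq_map => i; rewrite -[RHS]/(Op (xs
      ((gsym y)^-1 i))) Oxs permKV.
  by rewrite [LHS]Ov; congr gam; apply: eq_map => i; rewrite -[RHS]/(Op (ys i)) Oys.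
by congr gam; apply: eq_map => i /=; rewrite -Oxs -Oys omulE.
Qed.

(** By the multiplication law this composite is idempotent in a group. *)
Lemma gam_eops n (r : seq nat) : size r = n ->
  gam (eop n) [seq eop k | k <- r] = eop (sumn r).
Proof.
move=> <- {n}; pose a (i : 'I_(size r)) := eop (nth 0%N r i).
have rE : [seq eop k | k <- r] = [seq a i | i <- enum 'I_(size r)].
  rewrite (map_comp (fun k => eop (nth 0%N r k)) val) val_enum_ord (map_comp eop
    (nth 0%N r)).
  by rewrite map_nth_iota0 ?take_size.
rewrite rE; set u := gam _ _.
have tag_u : tag u = sumn r.
  by rewrite /u -rE tag_gam ?size_map // -map_comp map_id.
have : omul u u = u.
  rewrite -gam_omul => [|i]; last by rewrite gsym1 perm1.
  by rewrite mulg1; congr gam; apply: eq_map => i; rewrite gsym1 perm1 omulE mulg1.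
have -> : u = Op (etagged tag_u) by rewrite [RHS]etaggedK.
by rewrite omulE => /Op_inj uu; congr Op; apply: (mulgI (etagged tag_u)); rewrite
  uu mulg1.
Qed.

(** An Eckmann-Hilton argument: the composite of id e with e id is computed directly and by the
    multiplication law. *)
Lemma Op_gid : Op (gid G) = eop 1.
Proof.
have u1 (x : op G) : gam (Op (gid G)) [:: x] = x by rewrite (gam1x (gopP G)).
have u2 : gam (eop 1) [:: Op (gid G)] = eop 1 := gamx1 (gopP G) (eop 1).
have := @gam_omul 1 (gid G) 1 (fun=> eop 1) (fun=> Op (gid G)) (fun=> erefl).
have enum1 : enum 'I_1 = [:: ord0] by apply: (inj_map val_inj); rewrite val_enum_ord.
rewrite enum1 /= (u1 (eop 1)) mulg1 (u1 (omul _ _)) -[Op 1]/(eop 1) u2.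
by rewrite !omulE mulg1 mul1g.
Qed.

Lemma gam_eop1 x : gam (eop 1) [:: x] = x.
Proof. by rewrite -Op_gid (gam1x (gopP G)). Qed.

Lemma gam_nseq_eop1 x : gam x (nseq (tag x) (eop 1)) = x.
Proof. by rewrite -Op_gid (gamx1 (gopP G)). Qed.

(* Adding an outer input at either end of x turns pull into one inflation over *)
(* all the points of <<n>>, the ends included: see pad_pull.                   *)
Definition pad_op x : op G := gam (eop 3) [:: eop 1; x; eop 1].

Lemma tag_pad n (x : G n) : tag (pad_op (Op x)) = n.+2.
Proof. by rewrite /pad_op tag_gam //= addn1. Qed.

Definition pad n (x : G n) : G n.+2 := etagged (tag_pad x).

Lemma Op_pad n (x : G n) : Op (pad x) = gam (eop 3) [:: eop 1; Op x; eop 1].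
Proof. exact: etaggedK. Qed.

(** Replaces the i-th input of x by r_i parallel inputs. *)
Definition infl x (r : seq nat) : op G := gam x [seq eop k | k <- r].

(** Associativity, with e_1 written as gam(e_3; e_0, e_1, e_0). *)
Lemma gam3_single x : gam (eop 3) [:: eop 0; x; eop 0] = x.
Proof.
have e1 : eop 1 = gam (eop 3) [:: eop 0; eop 1; eop 0].
  by rewrite (@gam_eops 3 [:: 0; 1; 0]%N).
rewrite -[RHS]gam_eop1 e1.
have := gamA (gopP G) (x := eop 3) (s := [:: eop 0; eop 1; eop 0])
  (t := [:: [::]; [:: x]; [::]]) erefl erefl.
by rewrite /= gam_eop1 (@gam_eops 0 [::]).
Qed.

Lemma infl_pad n (x : G n) (r : seq nat) a b : size r = n ->
  infl (Op (pad x)) (a :: rcons r b) = gam (eop 3) [:: eop a; infl (Op x) r; eop b].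
Proof.
move=> size_r; rewrite Op_pad /infl.
have := gamA (gopP G) (x := eop 3) (s := [:: eop 1; Op x; eop 1])
  (t := [:: [:: eop a]; [seq eop k | k <- r]; [:: eop b]]) erefl.
rewrite /= size_map size_r => /(_ erefl); rewrite !gam_eop1 => <-.
by rewrite /= map_rcons -cats1.
Qed.

Lemma size_kseq m n (phi : nabla m n) : size (kseq phi) = n.
Proof. by rewrite size_map size_enum_ord. Qed.

Lemma pullE m n (phi : nabla m n) (x : G n) :
  Op (pull phi x) = gam (eop 3) [:: eop (kminus phi); infl (Op x) (kseq phi); eop
    (kplus phi)].
Proof.
rewrite [LHS]etaggedK /pull_op /infl /kseq -map_comp.
by congr gam; congr [:: _; gam _ _; _]; apply: eq_map.
Qed.

Lemma pull_active m n (phi : nabla m n) (x : G n) : active phi ->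
  Op (pull phi x) = infl (Op x) (kseq phi).
Proof. by case=> k0 kM; rewrite pullE k0 kM gam3_single. Qed.

(** The unit of arity 5 is bracketed as 1+3+1 and as 2+1+2; associativity for each gives the two
    sides. *)
Lemma gam3_pad a b x :
  gam (eop 3) [:: eop 1; gam (eop 3) [:: eop a; x; eop b]; eop 1]
  = gam (eop 3) [:: eop a.+1; x; eop b.+1].
Proof.
have e5 : eop 5 = gam (eop 3) [:: eop 1; eop 3; eop 1] by rewrite (@gam_eops 3
  [:: 1; 3; 1]%N).
have e5' : eop 5 = gam (eop 3) [:: eop 2; eop 1; eop 2] by rewrite (@gam_eops 3
  [:: 2; 1; 2]%N).
have A := gamA (gopP G) (x := eop 3) (s := [:: eop 1; eop 3; eop 1])
  (t := [:: [:: eop 1]; [:: eop a; x; eop b]; [:: eop 1]]) erefl erefl.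
have B := gamA (gopP G) (x := eop 3) (s := [:: eop 2; eop 1; eop 2])
  (t := [:: [:: eop 1; eop a]; [:: x]; [:: eop b; eop 1]]) erefl erefl.
rewrite -e5 /= !gam_eop1 in A; rewrite -e5' /= !gam_eop1 in B.
rewrite -A B (@gam_eops 2 [:: 1; a]%N) // (@gam_eops 2 [:: b; 1]%N) //=.
by rewrite addn1 !add1n addn0.
Qed.

Lemma pad_pull m n (phi : nabla m n) (x : G n) :
  Op (pad (pull phi x)) = infl (Op (pad x)) (full phi).
Proof. by rewrite Op_pad pullE gam3_pad full_kseq infl_pad ?size_kseq. Qed.

(** Inflation by 0, 1, ..., 1, 0 deletes the added outer inputs again. *)
Lemma pad_inj n : injective (@pad n).
Proof.
move=> x y eq_xy; apply: Op_inj; have plusK (z : G n) : Op z = infl (Op (pad z))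
  (0%N :: rcons (nseq n 1%N) 0%N).
  by rewrite infl_pad ?size_nseq // gam3_single /infl map_nseq gam_nseq_eop1.
by rewrite (plusK x) (plusK y) eq_xy.
Qed.

Lemma infl_flatten (T : Type) x (r : seq T) (b : T -> seq nat) : size r = tag x ->
  infl (infl x [seq size (b i) | i <- r]) (flatten [seq b i | i <- r])
  = infl x [seq sumn (b i) | i <- r].
Proof.
move=> size_r; rewrite /infl map_flatten -!map_comp gam_map_assoc ?size_map //.
  by congr gam; apply: eq_map => i /=; rewrite gam_eops.
by move=> i; rewrite /= size_map.
Qed.

Lemma inflM n (x y : G n) (k : 'I_n -> nat) :
  infl (Op (x * y)) [seq k (gsym y i) | i <- enum 'I_n]
  = omul (infl (Op x) [seq k i | i <- enum 'I_n])
         (infl (Op y) [seq k (gsym y i) | i <- enum 'I_n]).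
Proof.
have E (l : 'I_n -> nat) : [seq eop k | k <- [seq l i | i <- enum 'I_n]] = [seq
  eop (l i) | i <- enum 'I_n].
  by rewrite -map_comp.
rewrite /infl !E -(@gam_omul n x y (fun i => eop (k i)) (fun i => eop (k (gsym y
  i)))) //.
by congr gam; apply: eq_map => i /=; rewrite omulE mulg1.
Qed.

End Operad.

(** * The action on interval maps and the pullback of operations *)

Lemma nth_map_enum (T : Type) n (x0 : T) (a : 'I_n -> T) (i : 'I_n) :
  nth x0 [seq a j | j <- enum 'I_n] i = a i.
Proof. by rewrite (nth_map i) ?size_enum_ord // nth_ord_enum. Qed.

Section Action.

Lemma nth_full m n (phi : nabla m n) (j : 'I_n.+2) : nth 0%N (full phi) j = #|fib
  phi j|.
Proof. exact: nth_map_enum. Qed.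

Lemma nabla_reshape m n (phi : nabla m n) (p : 'I_m.+2) :
  reshape_index (full phi) p = phi p /\ (reshape_offset (full phi) p < #|fib phi
    (phi p)|)%N.
Proof.
pose ss := [seq nseq #|fib phi j| j | j <- enum 'I_n.+2].
have shape_ss : shape ss = full phi.
  by rewrite /shape /full -map_comp; apply: eq_map => j /=; rewrite size_nseq.
have p_lt : (p < sumn (full phi))%N by rewrite sumn_full.
have r_lt : (reshape_index (full phi) p < n.+2)%N.
  by have := reshape_indexP p_lt; rewrite /full size_map_enum.
have c_lt := reshape_offsetP p_lt.
rewrite -[reshape_index _ _]/(val (Ordinal r_lt)) nth_full in c_lt.
have phiE : phi p = Ordinal r_lt.
  rewrite -(nth_map_enum ord0 phi p) nabla_codom nth_flatten shape_ss.
  rewrite -[reshape_index _ _]/(val (Ordinal r_lt)) nth_map_enum nth_nseq.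
  by rewrite c_lt.
by rewrite phiE.
Qed.

Lemma nabla_act_exists m n (s : {perm 'I_n}) (phi : nabla m n) :
  exists psi : nabla m n, forall j, #|fib psi (ext s j)| = #|fib phi j|.
Proof.
have [|||psi psiE] := @nabla_ex m n (fun j => #|fib phi (ext s^-1 j)|).
- by rewrite ext0 card_fib eqxx.
- by rewrite ext_max card_fib eqxx addn1 addnS.
- apply: etrans (sumn_full phi); rewrite /full !sumnE big_map [RHS]big_map !big_enum /=.
  rewrite (reindex_inj (@ext_inj _ s)) /=.
  by apply: eq_bigr => j _; rewrite extK.
by exists psi => j; rewrite psiE extK.
Qed.

(** The search in [nabla_act] succeeds by [nabla_act_exists], so its default is never returned. *)
Lemma card_fib_act m n (s : {perm 'I_n}) (phi : nabla m n) j :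
  #|fib (nabla_act s phi) (ext s j)| = #|fib phi j|.
Proof.
rewrite /nabla_act; case: pickP => [psi /and3P[/eqP k0 /eqP kM /forallP k]|no] /=.
  case: (midP j) => [||i]; rewrite ?ext0 ?ext_max ?ext_mid.
  - have := k0; rewrite !kminus_block !card_fib => ->.
    by rewrite !eqxx.
  - have := kM; rewrite !kplus_block !card_fib => ->.
    by rewrite !eqxx.
  - exact: eqP (k i).
have [psi psiE] := nabla_act_exists s phi; have /negP[] := negbT (no psi).
apply/and3P; split.
- by have := psiE ord0; rewrite ext0 /kminus => ->.
- by have := psiE ord_max; rewrite ext_max /kplus => ->.
- by apply/forallP => i; rewrite /kmid -psiE ext_mid.
Qed.

Lemma nabla_act_unique m n (s : {perm 'I_n}) (phi psi : nabla m n) :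
  (forall j, #|fib psi (ext s j)| = #|fib phi j|) -> psi = nabla_act s phi.
Proof.
by move=> psiE; apply: nabla_eq_card => j; rewrite -(extKV s j) psiE card_fib_act.
Qed.

Lemma nabla_act1 m n (phi : nabla m n) : nabla_act 1 phi = phi.
Proof. by apply/esym/nabla_act_unique => j; rewrite ext1. Qed.

Lemma nabla_actM m n (s t : {perm 'I_n}) (phi : nabla m n) :
  nabla_act t (nabla_act s phi) = nabla_act (s * t) phi.
Proof. by apply/nabla_act_unique => j; rewrite extM !card_fib_act. Qed.

(** A bijection of the source covering s carries fibres onto fibres. Identities for the action are
    thereby reduced to pointwise squares. *)
Lemma nabla_act_square m n (s : {perm 'I_n}) (phi psi : nabla m n)
    (f : 'I_m.+2 -> 'I_m.+2) : injective f ->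
  (forall p, psi (f p) = ext s (phi p)) -> psi = nabla_act s phi.
Proof.
move=> f_inj psi_f; apply: nabla_act_unique => j.
rewrite -(card_imset (mem (fib phi j)) f_inj); apply: eq_card => i.
have [g _ gK] := injF_bij f_inj.
by rewrite -[i in LHS]gK inE psi_f (inj_eq (@ext_inj _ s)) -[i in RHS]gK
  mem_imset // inE.
Qed.

Lemma active_act m n (s : {perm 'I_n}) (phi : nabla m n) :
  active (nabla_act s phi) <-> active phi.
Proof.
have c0 := card_fib_act s phi ord0; have cM := card_fib_act s phi ord_max.
by rewrite ext0 in c0; rewrite ext_max in cM; rewrite /active /kminus /kplus c0 cM.
Qed.

Variable G : group_operad.

Definition psym (x : op G) (p : nat) : nat := op_sym (@gsym G) x p.

Lemma psymE n (x : G n) (i : 'I_n) : psym (Op x) i = gsym x i.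
Proof. by rewrite /psym /op_sym /= valK. Qed.

Lemma psym_eop n p : psym (eop G n) p = p.
Proof.
rewrite /psym /op_sym /=; case: insubP => //= i _ <-.
by rewrite gsym1 perm1.
Qed.

Lemma psym_gam n (x : G n) (a : 'I_n -> op G) (i : 'I_n) j : (j < tag (a i))%N ->
  psym (gam (Op x) [seq a l | l <- enum 'I_n])
    (flatten_index [seq tag (a l) | l <- enum 'I_n] i j)
  = flatten_index [seq tag (a ((gsym x)^-1 l)) | l <- enum 'I_n] (gsym x i) (psym
    (a i) j).
Proof.
move=> j_lt; pose s := [tuple a l | l < n].
have j_lt' : (j < tag (tnth s i))%N by rewrite tnth_mktuple.
have := @sym_gam _ _ _ (gsymP G) n x s i (Ordinal j_lt').
cbv zeta; rewrite -/(psym _ _).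
have -> : (gsym (tagged (tnth s i)) (Ordinal j_lt') : nat) = psym (a i) j.
  rewrite -[j]/(val (Ordinal j_lt')) /psym /op_sym; move: (Ordinal j_lt').
  by rewrite tnth_mktuple => j'; rewrite valK.
have -> : tval [tuple tag (tnth s l) | l < n] = [seq tag (a l) | l <- enum 'I_n].
  by apply: eq_map => l; rewrite tnth_mktuple.
suff -> : tval (permute (gsym x) [tuple tag (tnth s l) | l < n]) = [seq tag (a
  ((gsym x)^-1 l)) | l <- enum 'I_n] by [].
by apply: eq_map => l; rewrite !tnth_mktuple.
Qed.

Lemma map_nth_enum (T : Type) (x0 : T) (s : seq T) n : size s = n ->
  [seq nth x0 s i | i : 'I_n <- enum 'I_n] = s.
Proof.
move=> <-; rewrite (map_comp (nth x0 s) val) val_enum_ord.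
by rewrite map_nth_iota0 ?take_size.
Qed.

Lemma psym_gam_eop n (s : seq (op G)) i j : size s = n -> (i < n)%N ->
  (j < tag (nth (eop G 0) s i))%N ->
  psym (gam (eop G n) s) (flatten_index [seq tag y | y <- s] i j)
  = flatten_index [seq tag y | y <- s] i (psym (nth (eop G 0) s i) j).
Proof.
move=> size_s i_lt j_lt; have := @psym_gam n 1 (fun l : 'I_n => nth (eop G 0) s
  l) (Ordinal i_lt) j j_lt.
rewrite gsym1 perm1 /= map_nth_enum //.
have -> : [seq tag (nth (eop G 0) s l) | l : 'I_n <- enum 'I_n] = [seq tag y | y <- s].
  by rewrite -[X in _ = map _ X](map_nth_enum (eop G 0) size_s) -[RHS]map_comp.
by move=> ->; congr flatten_index; rewrite -[X in _ = map _ X](map_nth_enum (eop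
  G 0) size_s) -[RHS]map_comp; apply: eq_map => l /=; rewrite invg1 perm1.
Qed.

Lemma gsym_pad n (x : G n) p : gsym (pad x) p = ext (gsym x) p.
Proof.
apply: val_inj; rewrite /= -psymE Op_pad.
have S i j := @psym_gam_eop 3 [:: eop G 1; Op x; eop G 1] i j erefl.
case: (midP p) => [||{}p]; rewrite ?ext0 ?ext_max ?ext_mid.
- by have := S 0%N 0%N isT isT; rewrite psym_eop.
- by have := S 2 0%N isT isT; rewrite psym_eop /flatten_index /= !addn0 add1n.
- by have := S 1%N p isT (ltn_ord p); rewrite /= psymE /flatten_index /= !addn0 !add1n.
Qed.

(** A pullback moves each fibre of phi rigidly: the block index changes by x, the offset in the
    block is kept. Padding makes the ends ordinary blocks. *)
Lemma gsym_pad_pull m n (phi : nabla m n) (x : G n) p :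
  gsym (pad (pull phi x)) p
  = flatten_index [seq #|fib phi ((gsym (pad x))^-1 l)| | l <- enum 'I_n.+2]
      (gsym (pad x) (phi p)) (reshape_offset (full phi) p) :> nat.
Proof.
have [pE c_lt] := nabla_reshape phi p; set c := reshape_offset _ _ in c_lt *.
have := @psym_gam _ (pad x) (fun j => eop G #|fib phi j|) (phi p) c c_lt.
rewrite psym_eop /= -/(full phi) -[in X in X = _]pE reshape_indexK.
have -> : gam (Op (pad x)) [seq eop G #|fib phi l| | l <- enum 'I_n.+2] = Op (pad
  (pull phi x)).
  by rewrite pad_pull /infl /full -map_comp.
by rewrite psymE.
Qed.

(** Both sides are the index of the block into which the pulled-back permutation moves p, by
    [gsym_pad_pull]. *)
Lemma pull_square m n (phi : nabla m n) (x : G n) p :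
  act x phi (ext (gsym (pull phi x)) p) = ext (gsym x) (phi p).
Proof.
set psi := act x phi.
have full_psi : full psi = [seq #|fib phi ((gsym (pad x))^-1 l)| | l <- enum 'I_n.+2].
  apply: eq_map => l; rewrite -[l in LHS](permKV (gsym (pad x))) gsym_pad.
  by rewrite card_fib_act.
have [pE c_lt] := nabla_reshape phi p.
have sym_p := gsym_pad_pull phi x p; rewrite -full_psi in sym_p.
rewrite -!gsym_pad; apply: val_inj => /=.
have [<- _] := nabla_reshape psi (gsym (pad (pull phi x)) p).
by rewrite sym_p flatten_indexKl // nth_full gsym_pad card_fib_act.
Qed.

Lemma gsym_pull_eq m n (psi : nabla m n) (x y : G n) :
  gsym x = gsym y -> gsym (pull psi x) = gsym (pull psi y).
Proof.
move=> eq_xy; have eq_pad : gsym (pad x) = gsym (pad y).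
  by apply/permP => i; rewrite !gsym_pad eq_xy.
apply/permP => i; apply: mid_inj; rewrite -!ext_mid -!gsym_pad.
by apply: val_inj; rewrite /= !gsym_pad_pull eq_pad.
Qed.

Lemma actM m n (x y : G n) (phi : nabla m n) : act x (act y phi) = act (x * y) phi.
Proof. by rewrite /act nabla_actM gsymM. Qed.

Lemma act1 m n (phi : nabla m n) : act (1 : G n) phi = phi.
Proof. by rewrite /act gsym1 nabla_act1. Qed.

Lemma actK m n (x : G n) (phi : nabla m n) : act x^-1 (act x phi) = phi.
Proof. by rewrite actM mulVg act1. Qed.

Lemma actKV m n (x : G n) (phi : nabla m n) : act x (act x^-1 phi) = phi.
Proof. by rewrite actM mulgV act1. Qed.

Lemma act_sym m n (x y : G n) (phi : nabla m n) : gsym x = gsym y -> act x phi =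
  act y phi.
Proof. by rewrite /act => ->. Qed.

(** After padding, both sides are inflations, and inflating in two steps adds up fibre sizes
    ([infl_flatten]). *)
Lemma pull_comp l m n (psi : nabla m n) (phi : nabla l m) (x : G n) :
  pull (nabla_comp psi phi) x = pull phi (pull psi x).
Proof.
apply/pad_inj/Op_inj; rewrite !pad_pull.
pose b (j : 'I_n.+2) := [seq #|fib phi i| | i <- enum 'I_m.+2 & psi i == j].
have b_size (j : 'I_n.+2) : size (b j) = #|fib psi j|.
  by rewrite size_map size_filter card_count; apply: eq_count => i; rewrite inE.
have b_sum j : sumn (b j) = #|fib (nabla_comp psi phi) j|.
  rewrite sumnE big_map big_filter big_enum_cond /= -sum1_card.
  rewrite (partition_big phi (fun i => psi i == j)) /=; last by move=> i; rewrite
    inE nabla_compE.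
  apply: eq_bigr => i /eqP psi_i; rewrite -sum1_card; apply: eq_bigl => p.
  by rewrite !inE nabla_compE andb_idl // => /eqP->; rewrite psi_i.
have full_phi : full phi = flatten [seq b j | j <- enum 'I_n.+2].
  rewrite /full -{1}(@flatten_fibre _ _ psi (enum 'I_m.+2)).
    by rewrite map_flatten -map_comp.
  by apply: sorted_ord_monotone (subseq_refl _); apply: nabla_homo.
rewrite full_phi.
have -> : full psi = [seq size (b j) | j <- enum 'I_n.+2] by apply: eq_map => j;
  rewrite b_size.
have -> : full (nabla_comp psi phi) = [seq sumn (b j) | j <- enum 'I_n.+2] by
  apply: eq_map => j; rewrite b_sum.
by rewrite infl_flatten ?size_enum_ord.
Qed.

Lemma padM n (x y : G n) : pad (x * y) = pad x * pad y.
Proof.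
apply: Op_inj; rewrite -omulE !Op_pad.
have en3 : enum 'I_3 = [:: ord0; @Ordinal 3 1 isT; @Ordinal 3 2 isT].
  by apply: (inj_map val_inj); rewrite val_enum_ord.
have := @gam_omul G 3 1 1 (fun i => nth (eop G 0) [:: eop G 1; Op x; eop G 1] i)
  (fun i => nth (eop G 0) [:: eop G 1; Op y; eop G 1] i).
rewrite en3 /= gsym1 !perm1 /= !omulE !mulg1 -/(eop G 1) -/(eop G 3).
by apply=> -[[|[|[|]]] ?] //; rewrite perm1.
Qed.

(** The crossed homomorphism law: in [inflM] the left factor sees the fibre sizes of psi moved by
    y. *)
Lemma pullM m n (psi : nabla m n) (x y : G n) :
  pull psi (x * y) = pull (act y psi) x * pull psi y.
Proof.
apply/pad_inj/Op_inj; rewrite padM -omulE !pad_pull padM.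
have full_psi : full psi = [seq #|fib (act y psi) (gsym (pad y) j)| | j <- enum
  'I_n.+2].
  by apply: eq_map => j; rewrite gsym_pad card_fib_act.
by rewrite full_psi (inflM (pad x) (pad y) (fun j => #|fib (act y psi) j|)).
Qed.

Lemma pull1 m n (psi : nabla m n) : pull psi (1 : G n) = 1.
Proof. by apply: (mulgI (pull psi (1 : G n))); rewrite -{1}[psi](act1 psi) -pullM
  !mulg1. Qed.

Lemma pullV m n (psi : nabla m n) (x : G n) :
  pull psi x^-1 = (pull (act x^-1 psi) x)^-1.
Proof.
apply: (mulgI (pull (act x^-1 psi) x)).
by rewrite -pullM mulgV pull1 mulgV.
Qed.

Lemma pull_id n (x : G n) : pull (nabla_id n) x = x.
Proof.
apply: Op_inj; rewrite pull_active; last exact: active_id.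
have -> : kseq (nabla_id n) = nseq n 1%N.
  rewrite -[in RHS](size_kseq (nabla_id n)); apply/all_pred1P/allP => _ /mapP[i _
    ->] /=.
  by rewrite kmid_id.
by rewrite /infl map_nseq gam_nseq_eop1.
Qed.

(** Two instances of [pull_square] pasted together. *)
Lemma act_comp l m n (phi : nabla m n) (psi : nabla l m) (z : G n) :
  act z (nabla_comp phi psi) = nabla_comp (act z phi) (act (pull phi z) psi).
Proof.
apply/esym; apply: (nabla_act_square (f := ext (gsym (pull psi (pull phi z))))).
  exact: ext_inj.
by move=> p; rewrite !nabla_compE !pull_square.
Qed.

End Action.

(** * Decomposable elements *)

Lemma block_reshape m n (phi : nabla m n) (i : 'I_m) :
  reshape_index (ktuple phi) i = phi (mid i)
  /\ (reshape_offset (ktuple phi) i < size (block phi (phi (mid i))))%N.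
Proof.
rewrite ktuple_block.
pose ss := [seq nseq (size (block phi j)) j | j <- enum 'I_n.+2].
have shape_ss : shape ss = [seq size (block phi j) | j <- enum 'I_n.+2].
  by rewrite /shape -map_comp; apply: eq_map => j /=; rewrite size_nseq.
have codomE : [seq phi (mid i) | i <- enum 'I_m] = flatten ss.
  rewrite -{1}(flatten_block phi) map_flatten -map_comp; congr flatten.
  apply: eq_map => j /=; rewrite /block.
  by elim: (enum 'I_m) => //= p s IHs; case: eqP => //= ->; rewrite IHs.
have i_lt : (i < sumn [seq size (block phi j) | j <- enum 'I_n.+2])%N.
  by rewrite -ktuple_block sumn_ktuple.
have := reshape_indexP i_lt; have := reshape_offsetP i_lt.
set r := reshape_index _ _; set c := reshape_offset _ _; rewrite size_map_enum =>
  c_lt r_lt.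
rewrite -[r]/(val (Ordinal r_lt)) nth_map_enum in c_lt.
have phiE : phi (mid i) = Ordinal r_lt.
  rewrite -(nth_map_enum ord0 (fun i => phi (mid i)) i) codomE nth_flatten shape_ss.
  by rewrite -/r -/c -[r]/(val (Ordinal r_lt)) nth_map_enum nth_nseq c_lt.
by rewrite phiE.
Qed.

Section Stabilizers.

Variable G : group_operad.

Lemma RStP m n (phi : nabla m n) (x : G m) :
  RSt phi x <-> forall p, phi (ext (gsym x) p) = phi p.
Proof.
split=> [RSt_x p|phi_x l psi]; last first.
  apply: (nabla_eq_inj (@ext_inj _ (gsym (pull psi x)))) => p.
  by rewrite !nabla_compE pull_square phi_x.
case: (midP p) => [||i]; rewrite ?ext0 ?ext_max //.
(* The inclusion of the single inner point i, used as a test map that detects it. *)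
pose d := delta (nabla_id m) i.
have d_mid s : d (mid s) = mid i.
  by rewrite -[LHS]nabla_idE phi_delta.
have [s _ _] : exists2 s : 'I_(kmid (nabla_id m) i), s \in enum 'I_(kmid
  (nabla_id m) i) & i = dval s.
  by apply/mapP; rewrite map_dval mem_block nabla_idE.
have /(congr1 (fun f : nabla _ _ => f (ext (gsym (pull d x)) (mid s)))) := RSt_x _ d.
by rewrite !nabla_compE pull_square (d_mid s) !ext_mid (d_mid (gsym (pull d x)
  s)) => ->.
Qed.

Lemma RStM m n (phi : nabla m n) (x y : G m) : RSt phi x -> RSt phi y -> RSt phi
  (x * y).
Proof. by move=> /RStP x_phi /RStP y_phi; apply/RStP => p; rewrite gsymM extM
  x_phi. Qed.

Lemma RSt_sym1 m n (phi : nabla m n) (x : G m) : gsym x = 1 -> RSt phi x.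
Proof. by move=> x1; apply/RStP => p; rewrite x1 ext1. Qed.

Lemma RSt_comp l m n (psi : nabla m n) (phi : nabla l m) (x : G l) :
  RSt phi x -> RSt (nabla_comp psi phi) x.
Proof. by move=> /RStP x_phi; apply/RStP => p; rewrite !nabla_compE x_phi. Qed.

Lemma DecP m n (phi : nabla m n) (x : G m) :
  Dec phi x <-> exists d : forall j, G (size (block phi j)),
    Op x = gam (eop G n.+2) [seq Op (d j) | j <- enum 'I_n.+2].
Proof.
rewrite /Dec ktuple_block; split=> [[s [tag_s ->]]|[d ->]]; last first.
  by exists [seq Op (d j) | j <- enum 'I_n.+2]; split=> //; rewrite -map_comp.
have size_s : size s = n.+2 by rewrite -(size_map tag) tag_s size_map_enum.
have tag_nth (j : 'I_n.+2) : tag (nth (eop G 0) s j) = size (block phi j).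
  have := nth_map_enum 0%N (fun j => size (block phi j)) j.
  by rewrite -tag_s (nth_map (eop G 0)) ?size_s // => ->.
exists (fun j => etagged (tag_nth j)); congr gam.
rewrite -[LHS](map_nth_enum (eop G 0) size_s); apply: eq_map => j.
by rewrite [RHS]etaggedK.
Qed.

Lemma Dec1 m n (phi : nabla m n) : Dec phi (1 : G m).
Proof.
apply/DecP; exists (fun=> 1).
rewrite (map_comp (eop G) (fun j => size (block phi j))) gam_eops ?size_map_enum //.
by rewrite -ktuple_block sumn_ktuple.
Qed.

Lemma DecM m n (phi : nabla m n) (x y : G m) : Dec phi x -> Dec phi y -> Dec phi
  (x * y).
Proof.
move=> /DecP[d dx] /DecP[e ey]; apply/DecP; exists (fun j => d j * e j).
rewrite -omulE dx ey -(@gam_omul G _ 1 1 (fun j => Op (d j)) (fun j => Op (e j)))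
  => [|j].
  by rewrite mulg1; congr gam; apply: eq_map => j; rewrite gsym1 perm1 omulE.
by rewrite gsym1 perm1.
Qed.

Lemma tag_Dec m n (phi : nabla m n) (d : forall j, G (size (block phi j))) :
  tag (gam (eop G n.+2) [seq Op (d j) | j <- enum 'I_n.+2]) = m.
Proof.
rewrite tag_gam ?size_map_enum // -[RHS](sumn_ktuple phi) ktuple_block.
by rewrite -[in LHS]map_comp.
Qed.

Lemma DecV m n (phi : nabla m n) (x : G m) : Dec phi x -> Dec phi x^-1.
Proof.
move=> /DecP[d dx]; pose y : G m := etagged (tag_Dec (fun j => (d j)^-1)).
have Dec_y : Op y = gam (eop G n.+2) [seq Op (d j)^-1 | j <- enum 'I_n.+2] by
  apply: etaggedK.
suff -> : x^-1 = y by apply/DecP; exists (fun j => (d j)^-1).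
apply: (mulgI x); rewrite mulgV; apply: Op_inj; rewrite -omulE dx Dec_y.
rewrite -(@gam_omul G _ 1 1 (fun j => Op (d j)) (fun j => Op (d j)^-1)) => [|j].
  rewrite mulg1 -[LHS]/(eop G m) -[m in LHS](sumn_ktuple phi) ktuple_block.
  rewrite -[LHS](@gam_eops G n.+2) ?size_map_enum // -[in LHS]map_comp.
  by congr gam; apply: eq_map => j; rewrite gsym1 perm1 omulE mulgV.
by rewrite gsym1 perm1.
Qed.

Lemma psym_lt (x : op G) p : (p < tag x)%N -> (psym x p < tag x)%N.
Proof. by rewrite /psym /op_sym; case: insubP => // i _ _ _; apply: ltn_ord. Qed.

(** A block sum keeps each position inside its block, on which phi is constant. *)
Lemma Dec_RSt m n (phi : nabla m n) (x : G m) : Dec phi x -> RSt phi x.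
Proof.
move=> /DecP[d dx]; apply/RStP => p; case: (midP p) => [||i]; rewrite ?ext0
  ?ext_max // ext_mid.
have [iE c_lt] := block_reshape phi i; set c := reshape_offset _ _ in c_lt.
set j := phi (mid i) in iE c_lt *.
have := @psym_gam G _ 1 (fun j => Op (d j)) j c c_lt.
rewrite gsym1 perm1 -[Op 1]/(eop G n.+2) -dx.
have -> : [seq tag (Op (d ((1 : {perm 'I_n.+2})^-1 l))) | l <- enum 'I_n.+2] =
  ktuple phi.
  by rewrite ktuple_block; apply: eq_map => l; rewrite invg1 perm1.
have -> : [seq tag (Op (d l)) | l <- enum 'I_n.+2] = ktuple phi by rewrite ktuple_block.
rewrite -{1}iE reshape_indexK psymE => sym_i.
apply: val_inj => /=; have [<- _] := block_reshape phi (gsym x i).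
rewrite sym_i flatten_indexKl // ktuple_block (nth_map_enum 0%N (fun j => size
  (block phi j))).
exact: (@psym_lt (Op (d j))).
Qed.

Lemma omul1l (x : op G) : omul (eop G (tag x)) x = x.
Proof. by case: x => n x; rewrite -[existT _ _ _]/(Op x) omulE mul1g. Qed.

Lemma omul1r (x : op G) : omul x (eop G (tag x)) = x.
Proof. by case: x => n x; rewrite -[existT _ _ _]/(Op x) omulE mulg1. Qed.

(** By associativity, an active map inflates every block separately. *)
Lemma pull_blocks l m n (phi : nabla m n) (psi : nabla l m) (x : G m)
    (d : 'I_n.+2 -> op G) : active psi ->
  Op x = gam (eop G n.+2) [seq d j | j <- enum 'I_n.+2] ->
  (forall j, tag (d j) = size (block phi j)) ->
  Op (pull psi x) = gam (eop G n.+2)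
    [seq infl (d j) [seq kmid psi i | i <- block phi j] | j <- enum 'I_n.+2].
Proof.
move=> act_psi dx tag_d; rewrite pull_active // dx /infl /kseq.
rewrite -{1}(flatten_block phi) map_flatten -[X in flatten X]map_comp map_flatten
  -[X in flatten X]map_comp.
by apply: gam_map_assoc => [|j]; rewrite ?size_enum_ord //= !size_map.
Qed.

Lemma Dec_pull l m n (phi : nabla m n) (psi : nabla l m) (x : G m) :
  active psi -> Dec phi x -> Dec (nabla_comp phi psi) (pull psi x).
Proof.
move=> act_psi /DecP[d dx]; have xE := pull_blocks act_psi dx (fun=> erefl).
exists [seq infl (Op (d j)) [seq kmid psi i | i <- block phi j] | j <- enum 'I_n.+2].
split=> //; rewrite ktuple_block -[in LHS]map_comp; apply: eq_map => j /=.
rewrite block_comp_active // size_flatten /shape -map_comp /infl tag_gam ?size_map //.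
by rewrite -map_comp map_id; congr sumn; apply: eq_map => i /=; rewrite kmid_block.
Qed.

Lemma Kec_pull l m n (phi : nabla m n) (psi : nabla l m) (x : G m) :
  active psi -> Kec phi x -> Kec (nabla_comp phi psi) (pull psi x).
Proof.
move=> act_psi [Dec_x x1]; split; first exact: Dec_pull.
by rewrite (gsym_pull_eq psi (y := 1)) ?gsym1 // pull1 gsym1.
Qed.

End Stabilizers.

(** * Pullbacks preserve the order inside fibres *)

Section OrderPreserving.

Variable G : group_operad.

(** Points of one fibre are moved to one block with their offsets unchanged. *)
Lemma pull_mono m n (phi : nabla m n) (y : G n) p q : phi p = phi q -> (p < q)%N ->
  (ext (gsym (pull phi y)) p < ext (gsym (pull phi y)) q)%N.
Proof.
move=> phi_pq; rewrite -!gsym_pad !gsym_pad_pull phi_pq.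
have [pE _] := nabla_reshape phi p; have [qE _] := nabla_reshape phi q.
rewrite -[X in (X < _)%N -> _](reshape_indexK (full phi)) pE.
rewrite -[X in (_ < X)%N -> _](reshape_indexK (full phi)) qE phi_pq.
by rewrite /flatten_index !ltn_add2l.
Qed.

Lemma perm_mono1 k (s : {perm 'I_k}) : (forall i j : 'I_k, (i < j)%N -> (s i < s
  j)%N) -> s = 1.
Proof.
move=> s_mono; have s_sorted : sorted (fun i j : 'I_k => i < j)%N [seq s i | i <-
  enum 'I_k].
  by rewrite sorted_map; apply: sub_sorted (ltn_ord_enum_sorted k) => i j; apply:
    s_mono.
have : [seq s i | i <- enum 'I_k] = enum 'I_k.
  apply: (irr_sorted_eq (leT := fun i j : 'I_k => i < j)%N) => //.
  - by move=> ? ? ?; apply: ltn_trans.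
  - by move=> ?; apply: ltnn.
  - exact: ltn_ord_enum_sorted.
  by move=> i; rewrite mem_enum -[i](permKV s) mem_map ?mem_enum //; apply: perm_inj.
move=> sE; apply/permP => i; rewrite perm1.
by rewrite -(nth_map_enum i s i) sE nth_ord_enum.
Qed.

Lemma pull_const_sym k n (phi : nabla k n) (y : G n) j :
  (forall s, phi (mid s) = j) -> gsym (pull phi y) = 1.
Proof.
move=> phi_j; apply: perm_mono1 => i i' lt_ii'.
have := @pull_mono _ _ phi y (mid i) (mid i'); rewrite !phi_j !ext_mid => /(_
  erefl lt_ii').
by [].
Qed.

Lemma act_injective m n (phi : nabla m n) (y : G n) : injective phi -> injective
  (act y phi).
Proof.
move=> phi_inj p q; rewrite -(extKV (gsym (pull phi y)) p) -(extKV (gsym (pull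
  phi y)) q).
by rewrite !pull_square => /ext_inj/phi_inj->.
Qed.

Lemma kmid_act m n (phi : nabla m n) (y : G n) j : kmid (act y phi) (gsym y j) =
  kmid phi j.
Proof. by rewrite /kmid -(card_fib_act (gsym y) phi (mid j)) ext_mid. Qed.

Lemma delta_like_act k m n (phi : nabla m n) (y : G n) j (psi : nabla k m) :
  delta_like phi j psi -> delta_like (act y phi) (gsym y j) (act (pull phi y) psi).
Proof.
case=> def_k psi_inj phi_psi; split; first by rewrite kmid_act.
  exact: act_injective.
move=> s; rewrite -nabla_compE -act_comp -(permKV (gsym (pull (nabla_comp phi
  psi) y)) s).
by rewrite -ext_mid pull_square nabla_compE phi_psi ext_mid.
Qed.

(** The translate by x is again injective with inner values in the fibre over j, and there is only
    one such map. *)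
Lemma delta_like_RSt k m n (phi : nabla m n) (x : G m) j (psi : nabla k m) :
  RSt phi x -> delta_like phi j psi -> act x psi = psi.
Proof.
move=> RSt_x psi_like; have [def_k psi_inj phi_psi] := psi_like.
have act_like : delta_like phi j (act x psi).
  by split=> // [|s]; [apply: act_injective | rewrite -nabla_compE RSt_x nabla_compE].
have E1 := delta_like_unique psi_like; have E2 := delta_like_unique act_like.
exact: (@eq_from_Tagged _ (fun k => nabla k m) _ _ _ (etrans E2 (esym E1))).
Qed.

Lemma delta_like_pull k m n (phi : nabla m n) j (psi : nabla k m) (u : G m) :
  delta_like phi j psi -> Op (pull psi u) = Op (pull (delta phi j) u).
Proof.
move=> /delta_like_unique E.
exact: (congr1 (fun p : {k & nabla k m} => Op (pull (projT2 p) u)) E).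
Qed.

End OrderPreserving.

(** * Components of decomposable elements *)

Section Blocks.

Variable G : group_operad.
Hypothesis G0 : forall u : G 0, u = 1.

Lemma op0 (x : op G) : tag x = 0%N -> x = eop G 0.
Proof. by case: x => n x /= n0; subst n; rewrite (G0 x). Qed.

(** Triviality of [G 0] enters here: a nullary component is e_0. Writing the outer unit as a
    composite of e_0's and e_1's, associativity deletes the former inputs and keeps the latter. *)
Lemma gam_filter (T : Type) (r : seq T) (f : pred T) (a : T -> op G) :
  (forall i, ~~ f i -> tag (a i) = 0%N) ->
  gam (eop G (size r)) [seq a i | i <- r]
  = gam (eop G (size [seq i <- r | f i])) [seq a i | i <- r & f i].
Proof.
move=> a0; have := @gam_map_assoc G T (eop G (size r)) r (fun i => eop G (f i))
  (fun i => if f i then [:: a i] else [::]) erefl.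
have -> : flatten [seq if f i then [:: a i] else [::] | i <- r] = [seq a i | i <-
  r & f i].
  by elim: r => //= i r; case: (f i) => /= ->.
have -> : gam (eop G (size r)) [seq eop G (f i) | i <- r] = eop G (size [seq i <-
  r | f i]).
  rewrite (map_comp (eop G) (fun i => nat_of_bool (f i))) gam_eops ?size_map //.
  by rewrite sumn_count size_filter.
move=> ->; last by move=> i; case: (f i).
congr gam; apply: eq_map => i; case: ifP => [_|/negbT/a0/op0->]; first by rewrite
  gam_eop1.
by rewrite -[[::]]/(map (eop G) [::]) gam_eops.
Qed.

Lemma gam_single n (a : 'I_n -> op G) (j : 'I_n) :
  (forall i, i != j -> tag (a i) = 0%N) ->
  gam (eop G n) [seq a i | i <- enum 'I_n] = a j.
Proof.
move=> a0; rewrite -[n in eop G n](size_enum_ord n) (gam_filter _ (f := pred1 j)) //.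
have -> : [seq i <- enum 'I_n | pred1 j i] = [:: j].
  by rewrite filter_pred1_uniq ?enum_uniq ?mem_enum.
by rewrite gam_eop1.
Qed.

(** Along delta_j each input of block j is kept once and every other block becomes nullary. *)
Lemma pull_delta_blocks m n (phi : nabla m n) (x : G m) (d : 'I_n.+2 -> op G) (j
  : 'I_n) :
  Op x = gam (eop G n.+2) [seq d j | j <- enum 'I_n.+2] ->
  (forall j, tag (d j) = size (block phi j)) ->
  Op (pull (delta phi j) x) = d (mid j).
Proof.
move=> dx tag_d; rewrite (pull_blocks (active_delta phi j) dx tag_d).
have kmapE l : [seq kmid (delta phi j) i | i <- block phi l] = nseq (tag (d l))
  (l == mid j : nat).
  rewrite tag_d -[in RHS](size_map (kmid (delta phi j))).
  apply/all_pred1P/allP => _ /mapP[i i_in ->] /=; rewrite kmid_delta.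
  by move: i_in; rewrite mem_block => /eqP->.
rewrite (gam_single (j := mid j)) => [|l /negbTE lj].
  by rewrite kmapE eqxx /infl map_nseq gam_nseq_eop1.
rewrite kmapE lj /infl tag_gam ?size_map ?size_nseq //.
by rewrite -map_comp map_id sumn_nseq.
Qed.

Definition comps m n (phi : nabla m n) (x : G m) : seq (op G) :=
  [seq Op (pull (delta phi j) x) | j <- enum 'I_n].

Lemma active_blocks m n (alpha : nabla m n) (d : 'I_n.+2 -> op G) : active alpha ->
  (forall j, tag (d j) = size (block alpha j)) ->
  gam (eop G n.+2) [seq d j | j <- enum 'I_n.+2]
  = gam (eop G n) [seq d (mid j) | j <- enum 'I_n].
Proof.
move=> [k0 kM] tag_d; rewrite kminus_block in k0; rewrite kplus_block in kM.
have <- : eop G (size (enum 'I_n.+2)) = eop G n.+2 by rewrite size_enum_ord.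
rewrite (gam_filter _ (f := fun i => (i != ord0) && (i != ord_max))); last first.
  by move=> i; rewrite negb_and !negbK => /orP[]/eqP->; rewrite tag_d ?k0 ?kM.
have -> : [seq i <- enum 'I_n.+2 | (i != ord0) && (i != ord_max)] = [seq mid j |
  j <- enum 'I_n].
  rewrite enum_mid /= -cats1 filter_cat /= eqxx /= cats0.
  by apply/all_filterP/allP => _ /mapP[i _ ->]; rewrite mid_neq0 mid_neq_max.
by rewrite size_map size_enum_ord -map_comp.
Qed.

Lemma Dec_comps m n (alpha : nabla m n) (x : G m) : active alpha -> Dec alpha x ->
  Op x = gam (eop G n) (comps alpha x).
Proof.
move=> act_a /DecP[d dx]; rewrite {1}dx (active_blocks act_a (d := fun j => Op (d
  j))) //.
congr gam; apply: eq_map => j.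
by rewrite (pull_delta_blocks j dx).
Qed.

Lemma Dec_sep m n (alpha : nabla m n) (x y : G m) : active alpha ->
  Dec alpha x -> Dec alpha y ->
  (forall j, pull (delta alpha j) x = pull (delta alpha j) y) -> x = y.
Proof.
move=> act_a Dx Dy eq_xy; apply: Op_inj.
rewrite (Dec_comps act_a Dx) (Dec_comps act_a Dy); congr gam.
by apply: eq_map => j; rewrite eq_xy.
Qed.

Lemma Dec_intro m n (alpha : nabla m n) (x : G m) (d : 'I_n -> op G) : active alpha ->
  (forall j, tag (d j) = kmid alpha j) ->
  Op x = gam (eop G n) [seq d j | j <- enum 'I_n] -> Dec alpha x.
Proof.
move=> act_a tag_d dx; pose d' (j : 'I_n.+2) := if unmid j is Some i then d i
  else eop G 0.
have tag_d' j : tag (d' j) = size (block alpha j).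
  rewrite /d'; case: (midP j) => [||i]; rewrite ?unmid0 ?unmid_max ?unmid_mid.
  - by case: act_a; rewrite kminus_block => ->.
  - by case: act_a => _; rewrite kplus_block => ->.
  - by rewrite tag_d kmid_block.
exists [seq d' j | j <- enum 'I_n.+2]; split.
  by rewrite ktuple_block -map_comp; apply: eq_map => j /=; rewrite tag_d'.
rewrite (active_blocks act_a tag_d') dx; congr gam; apply: eq_map => j.
by rewrite /d' unmid_mid.
Qed.

(** The blocks of alpha are grouped along beta: e_m is itself a block sum of units over the blocks
    of beta. *)
Lemma Dec_mono l m n (beta : nabla m n) (alpha : nabla l m) (x : G l) : active alpha ->
  Dec alpha x -> Dec (nabla_comp beta alpha) x.
Proof.
move=> act_a Dx; have := Dec_comps act_a Dx; rewrite /comps -(flatten_block beta)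
  map_flatten.
have e_m : eop G m = gam (eop G n.+2) [seq eop G (size (block beta j)) | j <-
  enum 'I_n.+2].
  rewrite (map_comp (eop G) (fun j => size (block beta j))) gam_eops ?size_map_enum //.
  by rewrite -ktuple_block sumn_ktuple.
rewrite -[X in flatten X]map_comp {1}e_m.
rewrite (@gam_map_assoc G _ (eop G n.+2) (enum 'I_n.+2) (fun j => eop G (size
  (block beta j)))); last 2 first.
- by rewrite size_enum_ord.
- by move=> j; rewrite size_map.
move=> xE; eexists; split; last exact: xE.
rewrite ktuple_block -[in LHS]map_comp; apply: eq_map => j /=.
rewrite tag_gam ?size_map // -map_comp block_comp_active // size_flatten /shape
  -map_comp.
by congr sumn; apply: eq_map => i /=; rewrite kmid_block.
Qed.

(** With z the pullback of y and W the right-hand side, z w and W z both equal gam(y; d), by the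
    multiplication law with units in one factor. *)
Lemma conj_blocks m n (alpha : nabla m n) (w : G m) (d : 'I_n -> op G) (y : G n) :
  active alpha -> (forall j, tag (d j) = kmid alpha j) ->
  Op w = gam (eop G n) [seq d j | j <- enum 'I_n] ->
  Op (pull alpha y * w * (pull alpha y)^-1)
  = gam (eop G n) [seq d ((gsym y)^-1 j) | j <- enum 'I_n].
Proof.
move=> act_a tag_d dw; set z := pull alpha y; set W := gam _ [seq d _ | j <- _].
have Oz : Op z = gam (Op y) [seq eop G (kmid alpha j) | j <- enum 'I_n].
  by rewrite pull_active // /infl /kseq -map_comp.
have tag_W : tag W = m.
  rewrite /W tag_gam_enum -[RHS]/(tag (Op w)) dw tag_gam_enum.
  rewrite (reindex_inj (@perm_inj _ (gsym y))) /=.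
  by apply: eq_bigr => j _; rewrite permK.
pose w' : G m := etagged tag_W; have Ow' : Op w' = W by apply: etaggedK.
rewrite -Ow'; congr Op; apply: (mulIg z); rewrite mulgKV; apply: Op_inj.
rewrite -!omulE Ow' Oz dw.
rewrite -(@gam_omul G n y 1 (fun j => eop G (kmid alpha j)) d) => [|j]; last by
  rewrite gsym1 perm1 tag_d.
rewrite -(@gam_omul G n 1 y (fun j => d ((gsym y)^-1 j)) (fun j => eop G (kmid
  alpha j))) => [|j]; last by rewrite permK tag_d.
rewrite mulg1 mul1g; congr gam; apply: eq_map => j.
by rewrite gsym1 perm1 permK -tag_d omul1l omul1r.
Qed.

Lemma tag_comp m n (phi : nabla m n) (x : G m) j : tag (Op (pull (delta phi j)
  x)) = kmid phi j.
Proof. by []. Qed.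

Lemma conj_Dec m n (alpha : nabla m n) (w : G m) (y : G n) : active alpha -> Dec
  alpha w ->
  Dec (act y alpha) (pull alpha y * w * (pull alpha y)^-1).
Proof.
move=> act_a Dw; have := conj_blocks y act_a (fun j => tag_comp alpha w j)
  (Dec_comps act_a Dw).
apply: Dec_intro => [|j]; first by apply/active_act.
by rewrite -[j in RHS](permKV (gsym y)) kmid_act.
Qed.

(* The nonempty blocks of act z alpha appear in the order prescribed by the   *)
(* permutation of positions underlying pull alpha z.                          *)
Lemma conj_sym_eq m n (alpha : nabla m n) (w : G m) (z z' : G n) :
  active alpha -> Dec alpha w -> gsym (pull alpha z) = gsym (pull alpha z') ->
  pull alpha z * w * (pull alpha z)^-1 = pull alpha z' * w * (pull alpha z')^-1.
Proof.
move=> act_a Dw eq_z; apply: Op_inj.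
have dw := Dec_comps act_a Dw.
pose d j := Op (pull (delta alpha j) w).
rewrite !(conj_blocks (d := d) _ act_a (fun j => tag_comp alpha w j) dw).
(* Empty blocks are discarded, so that only the order of the nonempty ones matters. *)
have gamE (y : G n) : gam (eop G n) [seq d ((gsym y)^-1 j) | j <- enum 'I_n]
  = let r := [seq i <- [seq (gsym y)^-1 j | j <- enum 'I_n] | (0 < kmid alpha i)%N] in
    gam (eop G (size r)) [seq d i | i <- r].
  rewrite /= -(gam_filter _ (a := d)); last by move=> i; rewrite -leqNgt leqn0 => /eqP.
  by rewrite size_map_enum -[in RHS]map_comp.
rewrite !gamE; cbv zeta; suff -> : [seq i <- [seq (gsym z)^-1 j | j <- enum 'I_n]
  | (0 < kmid alpha i)%N]
   = [seq i <- [seq (gsym z')^-1 j | j <- enum 'I_n] | (0 < kmid alpha i)%N] by [].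
(* The position to which the first element of block i is moved. Both lists of nonempty blocks are
   strictly sorted by it and have the same elements. *)
pose key i := if block alpha (mid i) is p :: _ then val (gsym (pull alpha z) p)
  else 0%N.
have key_mono (y : G n) : gsym (pull alpha z) = gsym (pull alpha y) ->
    sorted (fun i i' => key i < key i')%N
      [seq i <- [seq (gsym y)^-1 j | j <- enum 'I_n] | (0 < kmid alpha i)%N].
  move=> eq_y; rewrite filter_map sorted_map.
  have : sorted (fun i j : 'I_n => i < j)%N [seq j <- enum 'I_n | preim (gsym
    y)^-1 (fun i => 0 < kmid alpha i)%N j].
    by apply: (sorted_filter _ _ (ltn_ord_enum_sorted n)) => ? ? ?; apply: ltn_trans.
  apply: (sub_in_sorted (P := [pred j | 0 < kmid alpha ((gsym y)^-1 j)]%N)); last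
    exact: filter_all.
  move=> j j'; rewrite !inE /key !kmid_block => kj kj' lt_jj'.
  case def_j: (block _ _) kj => [//|p b] _; case def_j': (block _ _) kj' =>
    [//|p' b'] _.
  have ap : alpha (mid p) = mid ((gsym y)^-1 j).
    by apply/eqP; rewrite -mem_block def_j mem_head.
  have ap' : alpha (mid p') = mid ((gsym y)^-1 j').
    by apply/eqP; rewrite -mem_block def_j' mem_head.
  rewrite /= def_j def_j' ltnNge; apply/negP => le_pp'.
  have := @nabla_homo _ _ (act y alpha) (mid (gsym (pull alpha z) p')) (mid (gsym
    (pull alpha z) p)) le_pp'.
  rewrite -!ext_mid eq_y !pull_square ap ap' !ext_mid !permKV mid_mono.
  by rewrite leqNgt lt_jj'.
apply: (irr_sorted_eq (leT := fun i i' => key i < key i')%N).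
- by move=> ? ? ?; apply: ltn_trans.
- by move=> ?; apply: ltnn.
- exact: key_mono.
- exact: key_mono.
move=> i; rewrite !mem_filter; congr andb.
have mem_all (s : {perm 'I_n}) : i \in [seq s j | j <- enum 'I_n].
  by rewrite -[i](permKV s) map_f ?mem_enum.
by rewrite !mem_all.
Qed.

(** Since u stabilises phi, both outer factors of the crossed product are pulled back along the same
    map phi chi1. *)
Lemma pull_conj l m n (phi : nabla m n) (chi : nabla l m) (u : G m) (y : G n) :
  RSt phi u -> let chi1 := act (pull phi y)^-1 chi in let z := pull (nabla_comp
    phi chi1) y in
  pull chi (pull phi y * u * (pull phi y)^-1) = z * pull chi1 u * z^-1.
Proof.
move=> RSt_u chi1 z; rewrite pullM -/chi1 pullM pullV -/chi1 -pull_comp RSt_u.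
by rewrite [in RHS]/z pull_comp.
Qed.

End Blocks.

(** * The quotient base categories *)

Section Quotients.

Variable G : group_operad.
Hypothesis G0 : forall u : G 0, u = 1.

Lemma active_of_act m n (phi : nabla m n) (x : G n) : active (act x phi) -> active phi.
Proof. by move/active_act. Qed.

Lemma Kec1 m n (phi : nabla m n) : Kec phi (1 : G m).
Proof. by split; [apply: Dec1 | apply: gsym1]. Qed.

Lemma KecM m n (phi : nabla m n) (x y : G m) : Kec phi x -> Kec phi y -> Kec phi
  (x * y).
Proof. by move=> [Dx x1] [Dy y1]; split; [apply: DecM | rewrite gsymM x1 y1 mulg1]. Qed.

Lemma KecV m n (phi : nabla m n) (x : G m) : Kec phi x -> Kec phi x^-1.
Proof. by move=> [Dx x1]; split; [apply: DecV | rewrite gsymV x1 invg1]. Qed.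

Lemma Kec_Dec_conj m n (phi : nabla m n) (d k : G m) :
  Dec phi d -> Kec phi k -> Kec phi (d * k * d^-1).
Proof.
move=> Dd [Dk k1]; split; first by apply: DecM; [apply: DecM | apply: DecV].
by rewrite !gsymM k1 gsymV mul1g mulVg.
Qed.

Lemma KecBar_active m n (phi : nabla m n) (x : G m) : active phi -> KecBar phi x
  <-> Kec phi x.
Proof.
move=> act_phi; split=> [[_ /(_ _ (nabla_id m))]|Kx].
  by rewrite nabla_comp1 pull_id; apply.
split=> [|l psi act_pp]; first by apply: RSt_sym1; case: Kx.
by apply: Kec_pull Kx; apply: active_comp_r act_pp.
Qed.

Lemma Dec_DecBar m n (phi : nabla m n) (x : G m) : Dec phi x -> DecBar phi x.
Proof.
move=> Dx; split=> [|l psi act_pp]; first exact: Dec_RSt.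
by apply: Dec_pull Dx; apply: active_comp_r act_pp.
Qed.

Lemma DecBar_active m n (phi : nabla m n) (x : G m) : active phi -> DecBar phi x
  -> Dec phi x.
Proof. by move=> act_phi [_ /(_ _ (nabla_id m))]; rewrite nabla_comp1 pull_id;
  apply. Qed.

Lemma DecBar1 m n (phi : nabla m n) : DecBar phi (1 : G m).
Proof. exact/Dec_DecBar/Dec1. Qed.

Lemma RSt_pull l m n (psi : nabla m n) (phi : nabla l m) (v : G m) :
  RSt psi v -> RSt (nabla_comp psi phi) (pull phi v).
Proof.
move=> RSt_v; apply/RStP => p; rewrite -(RSt_v _ phi) !nabla_compE pull_square.
by rewrite -!nabla_compE (RSt_v _ phi) !nabla_compE; move/RStP: RSt_v => ->.
Qed.

Lemma RSt_conj m n (phi : nabla m n) (u : G m) (y : G n) :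
  RSt phi u -> RSt (act y phi) (pull phi y * u * (pull phi y)^-1).
Proof.
move=> /RStP RSt_u; apply/RStP => p; set Y := gsym (pull phi y).
rewrite -(extKV Y p) !gsymM gsymV !extM -/Y extK !pull_square RSt_u.
by [].
Qed.

(* The second component of a composite of G_G, pulled back along a test map.  *)
Lemma pull_cmp l k m n (psi : nabla m n) (phi : nabla k m) (chi : nabla l k) (v y
  : G m) (u : G k) :
  RSt psi v -> RSt phi u ->
  pull (act (pull phi y) chi) (pull phi (v * y) * u * (pull phi y)^-1)
  = pull (act y (nabla_comp phi chi)) v
    * (pull (nabla_comp phi chi) y * pull chi u * (pull (nabla_comp phi chi) y)^-1).
Proof.
move=> RSt_v RSt_u; have RSt_b := RSt_conj y RSt_u.
rewrite (pullM phi) -!(mulgA (pull (act y phi) v)) pullM -pull_comp RSt_b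
  -act_comp; congr (_ * _).
by rewrite pull_conj // actK.
Qed.

(** By [pull_cmp] a pullback splits into one of v, decomposable by hypothesis, and a conjugate from
    u, decomposable for a finer active map and hence for the composite by [Dec_mono]. *)
Lemma DecBar_cmp k m n (psi : nabla m n) (phi : nabla k m) (v y : G m) (u : G k) :
  DecBar psi v -> DecBar phi u ->
  DecBar (nabla_comp psi (act y phi)) (pull phi (v * y) * u * (pull phi y)^-1).
Proof.
move=> Dv Du; have [RSt_v Dec_v] := Dv; have [RSt_u Dec_u] := Du; split.
  rewrite pullM -(mulgA (pull (act y phi) v)) -(mulgA (pull (act y phi) v)).
  by apply: RStM; [apply: RSt_pull | apply/RSt_comp/RSt_conj].
move=> l chi; rewrite -(actKV (pull phi y) chi); move: (act _ chi) => chi1 {chi}.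
rewrite -nabla_compA -act_comp (pull_cmp _ _ RSt_v RSt_u) => act_pp.
have act_y := active_comp_r act_pp.
have act_b : active (nabla_comp phi chi1) by apply: active_of_act act_y.
apply: DecM; first exact: Dec_v.
by apply: Dec_mono => //; apply: conj_Dec => //; apply: Dec_u.
Qed.

(** One direction of the congruence on representatives, tested by maps without group label. *)
Definition relE m n (p p' : emor G m n) : Prop :=
  forall l (psi : nabla l m), active (nabla_comp (ephi p) (act (eel p) psi)) ->
  nabla_comp (ephi p) (act (eel p) psi) = nabla_comp (ephi p') (act (eel p') psi)
  /\ Kec (nabla_comp (ephi p) (act (eel p) psi)) (pull psi (eel p') * (pull psi
    (eel p))^-1).

Lemma relE_refl m n (p : emor G m n) : relE p p.
Proof. by move=> l psi act_p; split; rewrite ?mulgV //; apply: Kec1. Qed.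

Lemma relE_trans m n (p p' p'' : emor G m n) : relE p p' -> relE p' p'' -> relE p p''.
Proof.
move=> pp' p'p'' l psi act_p; have [eq1 K1] := pp' _ _ act_p.
rewrite eq1 in act_p K1 *; have [eq2 K2] := p'p'' _ _ act_p; split=> //.
have -> : pull psi (eel p'') * (pull psi (eel p))^-1
    = pull psi (eel p'') * (pull psi (eel p'))^-1 * (pull psi (eel p') * (pull
      psi (eel p))^-1).
  by rewrite mulgA mulgKV.
exact: KecM.
Qed.

(** The label y of a test morphism multiplies both labels on the right and cancels in the quotient
    defining the coset. *)
Lemma heq_EtildeP m n (p p' : emor G m n) :
  heq (Etilde G) p p' <-> relE p p' /\ relE p' p.
Proof.
have cosetE l (psi : nabla l m) (y : G l) (q q' : emor G m n) :
    pull psi (eel q') * y * (pull psi (eel q) * y)^-1 = pull psi (eel q') * (pull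
      psi (eel q))^-1.
  by rewrite invMg mulgA mulgK.
split=> [E|[pp' p'p] l [psi y] _ /= act_pp].
  split=> l psi act_p.
    have [|/= eq_phi] := E _ (EMor psi 1) I; first by left.
    rewrite /same_coset cosetE => K.
    by split=> //; apply/KecBar_active.
  have [|/= eq_phi] := E _ (EMor psi 1) I; first by right.
  rewrite /same_coset cosetE => K; rewrite -eq_phi; rewrite -eq_phi in act_p.
  split=> //; rewrite -[_ * _]invgK; apply: KecV; apply/KecBar_active => //.
  by rewrite invMg invgK.
rewrite /same_coset cosetE.
have act_p : active (nabla_comp (ephi p) (act (eel p) psi)).
  by case: act_pp => // act_p'; have [<-] := p'p _ _ act_p'.
by have [eq1 K1] := pp' _ _ act_p; split=> //; apply/KecBar_active.
Qed.

Lemma nabla_cmp l m n k (chi : nabla m n) (z : G m) (phi : nabla l m) (x : G l)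
  (psi : nabla k l) :
  nabla_comp (nabla_comp chi (act z phi)) (act (pull phi z * x) psi)
  = nabla_comp chi (act z (nabla_comp phi (act x psi))).
Proof. by rewrite -actM -nabla_compA act_comp. Qed.

Lemma pull_cmp_el l m k (z : G m) (phi : nabla l m) (x : G l) (psi : nabla k l) :
  pull psi (pull phi z * x) = pull (nabla_comp phi (act x psi)) z * pull psi x.
Proof. by rewrite pullM pull_comp. Qed.

Lemma relE_cmp l m n (q q' : emor G m n) (p p' : emor G l m) :
  relE q q' -> relE p p' -> relE (cmp (Ecat G) q p) (cmp (Ecat G) q' p').
Proof.
move=> qq' pp' k psi; rewrite /= !nabla_cmp !pull_cmp_el => act_qp.
set beta := nabla_comp (ephi p) (act (eel p) psi) in act_qp *.
have act_b : active beta by apply: active_of_act (active_comp_r act_qp).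
have [eq_p Kp] := pp' _ psi act_b; have [eq_q Kq] := qq' _ beta act_qp.
rewrite -eq_p -/beta; split=> //.
set w := pull psi (eel p); set w' := pull psi (eel p').
set z := pull beta (eel q); set z' := pull beta (eel q').
(* The first factor lies in [Kec] by equivalence of q and q', the second is a conjugate of an
   element of [Kec] given by p and p'. *)
have -> : z' * w' * (z * w)^-1 = (z' * z^-1) * (z * (w' * w^-1) * z^-1).
  by rewrite invMg !mulgA mulgKV.
apply: KecM => //; split.
  by apply: Dec_mono => //; [apply: active_comp_r act_qp | apply: conj_Dec => //;
    case: Kp].
by rewrite !gsymM; case: Kp; rewrite gsymM => _ ->; rewrite mul1g gsymV mulVg.
Qed.

Lemma Ecat_cmpA k l m n (r : emor G m n) (q : emor G l m) (p : emor G k l) :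
  cmp (Ecat G) r (cmp (Ecat G) q p) = cmp (Ecat G) (cmp (Ecat G) r q) p.
Proof. by rewrite /= nabla_cmp pull_cmp_el !mulgA. Qed.

Lemma Ecat_cmp1 m n (p : emor G m n) : cmp (Ecat G) (idm (Ecat G) n) p = p.
Proof. by case: p => phi x; rewrite /= act1 nabla_1comp pull1 mul1g. Qed.

Lemma Ecat_1cmp m n (p : emor G m n) : cmp (Ecat G) p (idm (Ecat G) m) = p.
Proof.
case: p => phi x; rewrite /= pull_id mulg1; congr EMor.
suff -> : act x (nabla_id m) = nabla_id m by rewrite nabla_comp1.
apply/esym/(nabla_act_square (@ext_inj _ (gsym x))) => p.
by rewrite !nabla_idE.
Qed.

Lemma heq_Etilde_refl m n (p : emor G m n) : heq (Etilde G) p p.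
Proof. by apply/heq_EtildeP; split; apply: relE_refl. Qed.

Lemma heq_Etilde_sym m n (p p' : emor G m n) : heq (Etilde G) p p' -> heq (Etilde
  G) p' p.
Proof. by move=> /heq_EtildeP[? ?]; apply/heq_EtildeP. Qed.

Lemma heq_Etilde_trans m n (p p' p'' : emor G m n) :
  heq (Etilde G) p p' -> heq (Etilde G) p' p'' -> heq (Etilde G) p p''.
Proof.
move=> /heq_EtildeP[? ?] /heq_EtildeP[? ?]; apply/heq_EtildeP.
by split; [apply: relE_trans; eassumption | apply: relE_trans; eassumption].
Qed.

Lemma heq_Etilde_cmp l m n (q q' : emor G m n) (p p' : emor G l m) :
  heq (Etilde G) q q' -> heq (Etilde G) p p' ->
  heq (Etilde G) (cmp (Ecat G) q p) (cmp (Ecat G) q' p').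
Proof. by move=> /heq_EtildeP[? ?] /heq_EtildeP[? ?]; apply/heq_EtildeP; split;
  apply: relE_cmp. Qed.

Lemma Etilde_category : is_category (Etilde G).
Proof.
split=> //.
- by move=> *; apply: heq_Etilde_refl.
- by move=> *; apply: heq_Etilde_sym.
- by move=> a b f g h _ _ _; apply: heq_Etilde_trans.
- by move=> *; apply: heq_Etilde_cmp.
- by move=> *; rewrite [cmp (Etilde G) _ _]Ecat_cmpA; apply: heq_Etilde_refl.
- by move=> *; rewrite [cmp (Etilde G) _ _]Ecat_cmp1; apply: heq_Etilde_refl.
- by move=> *; rewrite [cmp (Etilde G) _ _]Ecat_1cmp; apply: heq_Etilde_refl.
Qed.

(** * The quotient of [Gcat] *)

Definition relG m n (p p' : gmor G m n) : Prop :=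
  forall l (psi : nabla l m), active (nabla_comp (gphi p) (act (gel p) psi)) ->
  [/\ nabla_comp (gphi p) (act (gel p) psi) = nabla_comp (gphi p') (act (gel p') psi),
      Kec (nabla_comp (gphi p) (act (gel p) psi)) (pull psi (gel p') * (pull psi
        (gel p))^-1)
    & pull (act (gel p) psi) (gu p) = pull (act (gel p') psi) (gu p')].

Lemma Kec_gsym m n (phi : nabla m n) (x y : G m) : Kec phi (y * x^-1) -> gsym x =
  gsym y.
Proof.
case=> _; rewrite gsymM gsymV => /(congr1 (mulg (gsym x))).
by rewrite mulgA mulgV mul1g mulg1.
Qed.

(** For an active map [Inr] is trivial, so cosets of u become equalities. The label v of a test
    morphism enters through its conjugates by the pulled-back labels of p and p'; these agree by
    [conj_sym_eq], as the labels differ by an element of [Kec]. *)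
Lemma heq_GtildeP m n (p p' : gmor G m n) : hom (Gtilde G) p -> hom (Gtilde G) p' ->
  (heq (Gtilde G) p p' <-> relG p p' /\ relG p' p).
Proof.
move=> /= Dp Dp'.
have cosetE l (psi : nabla l m) (y : G l) (q q' : gmor G m n) :
    pull psi (gel q') * y * (pull psi (gel q) * y)^-1 = pull psi (gel q') * (pull
      psi (gel q))^-1.
  by rewrite invMg mulgA mulgK.
have pullE l (psi : nabla l m) (q : gmor G m n) :
    pull psi (gu q * gel q) * 1 * (pull psi (gel q))^-1 = pull (act (gel q) psi) (gu q).
  by rewrite mulg1 pullM mulgK.
have InrE l k (alpha : nabla l k) (x y : G l) : active alpha -> Inr alpha (y *
  x^-1) -> x = y.
  move=> act_a [_ /(_ _ (nabla_id l))]; rewrite nabla_comp1 pull_id => /(_ act_a)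
    /(canRL (mulgKV _)).
  by rewrite mul1g.
split=> [E|[pp' p'p] l [psi v y] /= Dv act_pp].
  split=> l psi act_p.
    have [|/= eq_phi] := E _ (GMor psi 1 1) (DecBar1 psi); first by left.
    rewrite /same_coset cosetE !pullE => /InrE ? K.
    by split=> //; [apply/KecBar_active | auto].
  have [|/= eq_phi] := E _ (GMor psi 1 1) (DecBar1 psi); first by right.
  rewrite /same_coset cosetE !pullE => /InrE ? K; rewrite -eq_phi; rewrite
    -eq_phi in act_p.
  split=> //; last by symmetry; auto.
  rewrite -[_ * _]invgK; apply: KecV; apply/KecBar_active => //.
  by rewrite invMg invgK.
have act_p : active (nabla_comp (gphi p) (act (gel p) psi)).
  by case: act_pp => // act_p'; have [<-] := p'p _ _ act_p'.
have act_psi : active psi by apply: active_of_act (active_comp_r act_p).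
have [eq1 K1 eq_u] := pp' _ _ act_p; split=> //; last first.
  by rewrite /same_coset cosetE; apply/KecBar_active.
have eq_conj := conj_sym_eq G0 act_psi (DecBar_active act_psi Dv) (Kec_gsym K1).
have cmpE q : pull psi (gu q * gel q) * v * (pull psi (gel q))^-1
    = pull (act (gel q) psi) (gu q) * (pull psi (gel q) * v * (pull psi (gel q))^-1).
  by rewrite pullM !mulgA.
rewrite /same_coset !cmpE eq_u eq_conj mulgV.
by split=> [|k chi _]; rewrite ?pull1 //; apply/RSt_sym1/gsym1.
Qed.

Lemma relG_refl m n (p : gmor G m n) : relG p p.
Proof. by move=> l psi act_p; split; rewrite ?mulgV //; apply: Kec1. Qed.

Lemma relG_relE m n (p p' : gmor G m n) : relG p p' ->
  relE (EMor (gphi p) (gel p)) (EMor (gphi p') (gel p')).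
Proof. by move=> pp' l psi act_p; have [] := pp' l psi act_p. Qed.

Lemma relG_trans m n (p p' p'' : gmor G m n) : relG p p' -> relG p' p'' -> relG p p''.
Proof.
move=> pp' p'p'' l psi act_p; have [_ _ eq_u] := pp' _ _ act_p.
have [eq_phi K] := relE_trans (relG_relE pp') (relG_relE p'p'') act_p.
split=> //; have [eq1 _ _] := pp' _ _ act_p; rewrite eq1 in act_p.
by have [_ _ <-] := p'p'' _ _ act_p.
Qed.

Lemma relG_cmp l m n (q q' : gmor G m n) (p p' : gmor G l m) :
  DecBar (gphi q) (gu q) -> DecBar (gphi q') (gu q') ->
  DecBar (gphi p) (gu p) -> DecBar (gphi p') (gu p') ->
  relG q q' -> relG p p' -> relG (cmp (Gcat G) q p) (cmp (Gcat G) q' p').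
Proof.
move=> [RSt_v _] [RSt_v' _] [RSt_u Dec_u] [RSt_u' _] qq' pp' k psi act_qp.
have [/= eq_phi K] := relE_cmp (relG_relE qq') (relG_relE pp') act_qp.
split=> //; move: act_qp => /=; rewrite nabla_cmp => act_qp.
set beta := nabla_comp (gphi p) (act (gel p) psi) in act_qp.
have act_b : active beta by apply: active_of_act (active_comp_r act_qp).
have [eq_p Kp eq_u] := pp' _ psi act_b; have [eq_q Kq eq_v] := qq' _ beta act_qp.
rewrite -!actM (pull_cmp _ _ RSt_v RSt_u) (pull_cmp _ _ RSt_v' RSt_u') -eq_p
  -/beta eq_v -eq_u; congr (_ * _).
apply: (conj_sym_eq G0 act_b) (Kec_gsym Kq).
exact: Dec_u.
Qed.

Lemma RSt_act l m n (psi : nabla m n) (v y : G m) (phi : nabla l m) : RSt psi v ->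
  nabla_comp psi (act (v * y) phi) = nabla_comp psi (act y phi).
Proof. by move=> RSt_v; rewrite -actM RSt_v. Qed.

Lemma Gcat_cmpA k l m n (r : gmor G m n) (q : gmor G l m) (p : gmor G k l) :
  DecBar (gphi q) (gu q) ->
  cmp (Gcat G) r (cmp (Gcat G) q p) = cmp (Gcat G) (cmp (Gcat G) r q) p.
Proof.
move=> [RSt_v _]; rewrite /= nabla_cmp pull_cmp_el !mulgA; congr GMor.
rewrite mulgKV -(mulgA (pull (gphi q) _)).
have pullE A : pull (gphi p) (pull (gphi q) A * (gu q * gel q))
    = pull (nabla_comp (gphi q) (act (gel q) (gphi p))) A * pull (gphi p) (gu q *
      gel q).
  by rewrite pullM -pull_comp (RSt_act (gel q) (gphi p) RSt_v).
by rewrite pullE invMg !mulgA.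
Qed.

Lemma Gcat_cmp1 m n (p : gmor G m n) : cmp (Gcat G) (idm (Gcat G) n) p = p.
Proof. by case: p => phi u x; rewrite /= act1 nabla_1comp !mul1g pull1 mul1g
  invg1 mulg1 mul1g. Qed.

Lemma Gcat_1cmp m n (p : gmor G m n) : cmp (Gcat G) p (idm (Gcat G) m) = p.
Proof.
case: p => phi u x; have /= := Ecat_1cmp (EMor phi x).
by rewrite !pull_id !mulg1 mulgK => -[->].
Qed.

Lemma heq_Gtilde_refl m n (p : gmor G m n) : DecBar (gphi p) (gu p) -> heq
  (Gtilde G) p p.
Proof. by move=> Dp; apply/heq_GtildeP => //; split; apply: relG_refl. Qed.

Lemma hom_Gtilde_cmp l m n (q : gmor G m n) (p : gmor G l m) :
  hom (Gtilde G) q -> hom (Gtilde G) p -> hom (Gtilde G) (cmp (Gtilde G) q p).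
Proof. exact: DecBar_cmp. Qed.

Lemma Gtilde_category : is_category (Gtilde G).
Proof.
split.
- by move=> a b f Df; apply: heq_Gtilde_refl.
- by move=> a b f g Df Dg /heq_GtildeP[] // ? ?; apply/heq_GtildeP.
- move=> a b f g h Df Dg Dh /heq_GtildeP[] // fg gf /heq_GtildeP[] // gh hg.
  by apply/heq_GtildeP => //; split; [apply: relG_trans gh | apply: relG_trans gf].
- by move=> a; apply: DecBar1.
- exact: hom_Gtilde_cmp.
- move=> a b c g g' f f' Dg Dg' Df Df' /heq_GtildeP[] // gg' g'g /heq_GtildeP[]
  // ff' f'f.
  apply/heq_GtildeP; [exact: hom_Gtilde_cmp | exact: hom_Gtilde_cmp |].
  by split; apply: relG_cmp.
- move=> a b c d h g f Dh Dg Df; have E := Gcat_cmpA h f Dg.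
  rewrite -[cmp (Gtilde G) (cmp (Gtilde G) h g) f]E; apply: heq_Gtilde_refl.
  exact: (hom_Gtilde_cmp Dh (hom_Gtilde_cmp Dg Df)).
- by move=> a b f Df; rewrite [cmp (Gtilde G) _ _](Gcat_cmp1 f); apply: heq_Gtilde_refl.
- by move=> a b f Df; rewrite [cmp (Gtilde G) _ _](Gcat_1cmp f); apply: heq_Gtilde_refl.
Qed.

(** After pullback the quotient of the labels u x is the quotient of the labels x, conjugated by the
    common decomposable pullback of u and u'. *)
Lemma relG_tfun m n (p p' : gmor G m n) :
  DecBar (gphi p) (gu p) -> DecBar (gphi p') (gu p') ->
  relG p p' -> relE (tfun p) (tfun p').
Proof.
move=> [RSt_u Dec_u] [RSt_u' _] pp' l psi /=.
rewrite (RSt_act _ _ RSt_u) (RSt_act _ _ RSt_u') => act_p.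
have [eq_phi K eq_u] := pp' _ _ act_p; split=> //.
rewrite (pullM _ (gu p)) (pullM _ (gu p')) -eq_u invMg mulgA -(mulgA (pull _ (gu p))).
by apply: Kec_Dec_conj => //; apply: Dec_u.
Qed.

Lemma heq_tfun m n (p p' : gmor G m n) : hom (Gtilde G) p -> hom (Gtilde G) p' ->
  heq (Gtilde G) p p' -> heq (Etilde G) (tfun p) (tfun p').
Proof.
move=> Dp Dp' /heq_GtildeP[] // pp' p'p; apply/heq_EtildeP.
by split; apply: relG_tfun.
Qed.

Lemma tfun_cmp l m n (q : gmor G m n) (p : gmor G l m) : DecBar (gphi q) (gu q) ->
  tfun (cmp (Gcat G) q p) = cmp (Ecat G) (tfun q) (tfun p).
Proof. by move=> [RSt_v _]; rewrite /tfun /= (RSt_act _ _ RSt_v) !mulgA mulgKV. Qed.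

Lemma tfun_idm n : tfun (idm (Gcat G) n) = idm (Ecat G) n.
Proof. by rewrite /tfun /= mulg1. Qed.

Lemma ttilde_functor : is_functor (functor_of_io (@ttilde G)).
Proof.
split=> //.
- by move=> a b f g Df Dg; apply: heq_tfun.
- by move=> a; rewrite [X in heq _ X]tfun_idm; apply: heq_Etilde_refl.
- by move=> a b c g f Dg Df; rewrite [X in heq _ X]tfun_cmp //; apply: heq_Etilde_refl.
Qed.

(** The label of p carries theta to delta_j, whose composite is active. So p' maps theta injectively
    into its own fibre over j; by symmetry the fibre sizes agree. *)
Lemma relE_delta m n (p p' : emor G m n) (j : 'I_n) : relE p p' -> relE p' p ->
  let theta := act (eel p)^-1 (delta (ephi p) j) in
  delta_like (ephi p') j (act (eel p') theta)
  /\ gsym (pull theta (eel p)) = gsym (pull theta (eel p')).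
Proof.
have aux (q q' : emor G m n) : relE q q' ->
    let theta := act (eel q)^-1 (delta (ephi q) j) in
    [/\ forall s, ephi q' (act (eel q') theta (mid s)) = mid j,
        injective (act (eel q') theta), (kmid (ephi q) j <= kmid (ephi q') j)%N
      & gsym (pull theta (eel q)) = gsym (pull theta (eel q'))].
  move=> qq' theta; have theta_q : act (eel q) theta = delta (ephi q) j by
    rewrite actKV.
  have act_q : active (nabla_comp (ephi q) (act (eel q) theta)).
    by rewrite theta_q; apply: active_comp_delta.
  have [eq_phi K] := qq' _ _ act_q; rewrite theta_q in eq_phi.
  have mid_q' s : ephi q' (act (eel q') theta (mid s)) = mid j.
    by rewrite -nabla_compE -eq_phi nabla_compE phi_delta.
  have inj_q' : injective (act (eel q') theta).
    by do 2 apply: act_injective; apply: delta_inj.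
  split=> //; last exact: Kec_gsym K.
  have [chi chiE] := delta_like_factor mid_q'.
  have : injective chi by move=> a b ab; apply: inj_q'; rewrite chiE !nabla_compE ab.
  by move/leq_card; rewrite !card_ord.
move=> pp' p'p theta; have [mid_p' inj_p' le_k eq_s] := aux _ _ pp'; have [_ _
  le_k' _] := aux _ _ p'p.
by split=> //; split=> //; apply/eqP; rewrite eqn_leq le_k le_k'.
Qed.

Lemma relG_delta m n (p p' : gmor G m n) (j : 'I_n) : relG p p' -> relG p' p ->
  Op (pull (delta (gphi p) j) (gu p)) = Op (pull (delta (gphi p') j) (gu p')).
Proof.
move=> pp' p'p; have [like_p' _] := relE_delta j (relG_relE pp') (relG_relE p'p).
rewrite -(delta_like_pull (gu p') like_p') /=.
set theta := act _ (delta _ _).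
have theta_p : act (gel p) theta = delta (gphi p) j by rewrite actKV.
have [|_ _] := pp' _ theta; first by rewrite theta_p; apply: active_comp_delta.
by rewrite theta_p => ->.
Qed.

(** By [Dec_sep] the pullbacks are compared on components. Component j of alpha lies over the fibre
    of j, so it factors through delta_j for p and for p', with the same factor chi; both components
    are pullbacks along chi of equal elements. *)
Lemma relG_of_delta m n (p p' : gmor G m n) :
  DecBar (gphi p) (gu p) -> DecBar (gphi p') (gu p') ->
  relE (EMor (gphi p) (gel p)) (EMor (gphi p') (gel p')) ->
  relE (EMor (gphi p') (gel p')) (EMor (gphi p) (gel p)) ->
  (forall j, Op (pull (delta (gphi p) j) (gu p)) = Op (pull (delta (gphi p') j)
    (gu p'))) ->
  relG p p'.
Proof.
move=> [RSt_u Dec_u] [RSt_u' Dec_u'] pp' p'p eq_u l psi act_p.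
have [/= eq_phi K] := pp' _ _ act_p; split=> //.
have act_p' := act_p; rewrite eq_phi in act_p'.
set alpha := nabla_comp _ (act (gel p) psi) in act_p eq_phi K.
apply: (Dec_sep G0 act_p); [exact: Dec_u | by rewrite eq_phi; apply: Dec_u' | move=> j].
rewrite -!pull_comp.
(* The test map that both labels carry to block j of alpha: their pullbacks along psi have the same
   permutation. *)
pose eta := nabla_comp psi (act (pull psi (gel p))^-1 (delta alpha j)).
have eta_p : act (gel p) eta = nabla_comp (act (gel p) psi) (delta alpha j).
  by rewrite act_comp actKV.
have eta_p' : act (gel p') eta = nabla_comp (act (gel p') psi) (delta alpha j).
  rewrite act_comp; congr nabla_comp; rewrite (act_sym _ (esym (Kec_gsym K))).
  exact: actKV.
rewrite -eta_p -eta_p'.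
have [/= like_p' eq_sym] := relE_delta j pp' p'p.
set theta := act _ (delta _ _) in like_p' eq_sym.
have theta_p : act (gel p) theta = delta (gphi p) j by rewrite actKV.
have [chi chiE] : exists chi, act (gel p) eta = nabla_comp (delta (gphi p) j) chi.
  by apply: delta_like_factor => s; rewrite eta_p !nabla_compE -nabla_compE phi_delta.
have eta_theta : eta = nabla_comp theta (act (pull theta (gel p))^-1 chi).
  rewrite -(actK (gel p) eta) chiE -theta_p.
  apply: (canLR (actKV (gel p)^-1)); rewrite invgK act_comp.
  by rewrite actKV.
have chiE' : act (gel p') eta = nabla_comp (act (gel p') theta) chi.
  by rewrite eta_theta act_comp (act_sym _ (esym eq_sym)) actKV.
rewrite chiE chiE' !pull_comp; congr (pull chi _).
by apply: Op_inj; rewrite eq_u (delta_like_pull _ like_p').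
Qed.

End Quotients.

(** * Wreath products *)

Section Permute.

Variable A : Type.

Lemma tnth_permute n (s : {perm 'I_n}) (w : n.-tuple A) i :
  tnth (permute s w) i = tnth w (s^-1 i).
Proof. exact: tnth_mktuple. Qed.

Lemma permute1 n (w : n.-tuple A) : permute 1 w = w.
Proof. by apply: eq_from_tnth => i; rewrite tnth_permute invg1 perm1. Qed.

Lemma permuteM n (s t : {perm 'I_n}) (w : n.-tuple A) :
  permute t (permute s w) = permute (s * t) w.
Proof. by apply: eq_from_tnth => i; rewrite !tnth_permute invMg permM. Qed.

Lemma permute_seq_enum n (s : {perm 'I_n}) (F : 'I_n -> A) :
  permute_seq s [seq F i | i <- enum 'I_n] = [seq F (s^-1 i) | i <- enum 'I_n].
Proof.
rewrite /permute_seq; case: insubP => [w _ wE|/negP[]]; last first.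
  by rewrite /= size_map_enum.
apply: eq_map => i; rewrite (tnth_nth (F i)) wE; exact: nth_map_enum.
Qed.

Lemma size_permute_seq n (s : {perm 'I_n}) (w : seq A) : size (permute_seq s w) =
  size w.
Proof. by rewrite /permute_seq; case: insubP => // v _ <-; rewrite !size_tuple. Qed.

Lemma permute_seqE n (s : {perm 'I_n}) (w : seq A) (x0 : A) : size w = n ->
  permute_seq s w = [seq nth x0 w (s^-1 i) | i : 'I_n <- enum 'I_n].
Proof.
by move=> size_w; rewrite -{1}(map_nth_enum x0 size_w) (permute_seq_enum s (fun i
  => nth x0 w i)).
Qed.

End Permute.

Lemma map_permute_seq A B (f : A -> B) n (s : {perm 'I_n}) (w : seq A) : size w = n ->
  map f (permute_seq s w) = permute_seq s (map f w).
Proof.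
move=> size_w; case: w size_w => [|x0 w] size_w.
  have nilE (T : Type) : @permute_seq T n s [::] = [::].
    by apply: size0nil; rewrite size_permute_seq.
  by rewrite /= !nilE.
have size_fw : size (map f (x0 :: w)) = n by rewrite size_map.
rewrite (permute_seqE s x0 size_w) (permute_seqE s (f x0) size_fw) -map_comp.
by apply: eq_map => i /=; rewrite -[f x0 :: _]/(map f (x0 :: w)) (nth_map x0) ?size_w.
Qed.

Section Words.

Variable G : group_operad.
Variable A : Type.

(** A word as a partial function on <<n>>, undefined at the ends, so that it can be read along
    interval maps and [pull_square] applies. *)
Definition wext n (w : n.-tuple A) (p : 'I_n.+2) : option A := omap (tnth w) (unmid p).

Lemma wext_mid n (w : n.-tuple A) i : wext w (mid i) = Some (tnth w i).
Proof. by rewrite /wext unmid_mid. Qed.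

Lemma wext_permute n (s : {perm 'I_n}) (w : n.-tuple A) p :
  wext (permute s w) (ext s p) = wext w p.
Proof.
rewrite /wext; case: (midP p) => [||i]; rewrite ?ext0 ?ext_max ?unmid0 ?unmid_max //.
by rewrite ext_mid !unmid_mid /= tnth_permute permK.
Qed.

Lemma fibre_delta_like k m n (phi : nabla m n) j (psi : nabla k m) (w : m.-tuple A) :
  delta_like phi j psi ->
  map Some (fibre phi w j) = [seq wext w (psi (mid s)) | s <- enum 'I_k].
Proof.
move=> /delta_like_unique E.
have -> : [seq wext w (psi (mid s)) | s <- enum 'I_k]
    = [seq wext w (delta phi j (mid s)) | s <- enum 'I_(kmid phi j)].
  exact: (congr1 (fun p : {k & nabla k m} => [seq wext w (projT2 p (mid s)) | s
    <- enum 'I_(projT1 p)]) E).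
rewrite /fibre -/(block phi (mid j)) -map_dval -!map_comp.
by apply: eq_map => s /=; rewrite delta_mid wext_mid.
Qed.

Lemma wext_act k m (x : G m) (theta : nabla k m) (w : m.-tuple A) :
  [seq wext (permute (gsym x) w) (act x theta (mid s)) | s <- enum 'I_k]
  = [seq wext w (theta (mid ((gsym (pull theta x))^-1 s))) | s <- enum 'I_k].
Proof.
apply: eq_map => s; rewrite -{1}(permKV (gsym (pull theta x)) s) -ext_mid.
by rewrite pull_square wext_permute.
Qed.

Lemma some_inj (B : Type) : injective (@Some B).
Proof. by move=> x y []. Qed.

(** Both fibre words are w read along one test map with one permutation ([relE_delta]). Hence the
    source words of the f_j depend only on the class. *)
Lemma fibre_relE m n (p p' : emor G m n) (w : m.-tuple A) j : relE p p' -> relE p' p ->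
  fibre (ephi p) (permute (gsym (eel p)) w) j = fibre (ephi p') (permute (gsym
    (eel p')) w) j.
Proof.
move=> pp' p'p; have [like_p' eq_sym] := relE_delta j pp' p'p.
set theta := act _ (delta _ _) in like_p' eq_sym.
have theta_p : act (eel p) theta = delta (ephi p) j by rewrite actKV.
apply: (inj_map (@some_inj A)).
rewrite (fibre_delta_like _ (delta_likeP (ephi p) j)) (fibre_delta_like _ like_p').
by rewrite -theta_p !wext_act eq_sym.
Qed.

Lemma size_fibre m n (phi : nabla m n) (w : m.-tuple A) j : size (fibre phi w j)
  = kmid phi j.
Proof. by rewrite size_map kmid_block. Qed.

(** As u fixes delta_j, reading the permuted word along delta_j permutes its letters by delta_j^* u,
    as the typing rule of [semidirect] requires. *)
Lemma fibre_RSt m n (phi : nabla m n) (u : G m) (w : m.-tuple A) j : RSt phi u ->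
  fibre phi (permute (gsym u) w) j
  = permute_seq (gsym (pull (delta phi j) u)) (fibre phi w j).
Proof.
move=> RSt_u; apply: (inj_map (@some_inj A)).
rewrite map_permute_seq ?size_fibre //.
rewrite !(fibre_delta_like _ (delta_likeP phi j)).
rewrite -{1}(delta_like_RSt RSt_u (delta_likeP phi j)) wext_act.
by rewrite (permute_seq_enum _ (fun s => wext w (delta phi j (mid s)))).
Qed.

Lemma permute_gsymM n (v y : G n) (w : n.-tuple A) :
  permute (gsym (v * y)) w = permute (gsym v) (permute (gsym y) w).
Proof. by rewrite gsymM permuteM. Qed.

(** A pullback moves whole fibres and keeps the order inside each of them ([pull_const_sym]). *)
Lemma fibre_pull m n (phi : nabla m n) (y : G n) (w : m.-tuple A) j :
  fibre (act y phi) (permute (gsym (pull phi y)) w) j = fibre phi w ((gsym y)^-1 j).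
Proof.
set i := (gsym y)^-1 j; have -> : j = gsym y i by rewrite permKV.
have like_y := delta_like_act y (delta_likeP phi i).
apply: (inj_map (@some_inj A)).
rewrite (fibre_delta_like _ like_y) (fibre_delta_like _ (delta_likeP phi i)) wext_act.
rewrite -pull_comp (@pull_const_sym G _ _ _ y (mid i)) => [|s]; last first.
  by rewrite nabla_compE phi_delta.
by apply: eq_map => s; rewrite invg1 perm1.
Qed.

Lemma fibre_comp l m n (psi : nabla m n) (phi : nabla l m) (y : G m) (x : G l)
    (w : l.-tuple A) j :
  fibre (nabla_comp psi (act y phi)) (permute (gsym (pull phi y * x)) w) j
  = flatten [seq fibre phi (permute (gsym x) w) ((gsym y)^-1 i) | i <- block psi
    (mid j)].
Proof.
rewrite {1}/fibre -/(block _ (mid j)) block_comp map_flatten -map_comp.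
by congr flatten; apply: eq_map => i; rewrite -fibre_pull -permute_gsymM.
Qed.

Lemma fibre_permute m n (psi : nabla m n) (s : {perm 'I_m}) (T : m.-tuple A) j :
  fibre psi (permute s T) j = [seq tnth T (s^-1 i) | i <- block psi (mid j)].
Proof. by apply: eq_map => i; rewrite tnth_permute. Qed.

Lemma fibre_id n (w : n.-tuple A) j : fibre (nabla_id n) w j = [:: tnth w j].
Proof.
rewrite /fibre (eq_filter (a2 := pred1 j)) => [|i]; last first.
  by rewrite nabla_idE (inj_eq (@mid_inj n)).
by rewrite filter_pred1_uniq ?enum_uniq ?mem_enum.
Qed.

End Words.

Lemma fibre_map A B (f : A -> B) m n (phi : nabla m n) (w : m.-tuple A) j :
  fibre phi (map_tuple f w) j = map f (fibre phi w j).
Proof. by rewrite /fibre -map_comp; apply: eq_map => i; rewrite /= tnth_map. Qed.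

Lemma permute_map A B (f : A -> B) n (s : {perm 'I_n}) (w : n.-tuple A) :
  permute s (map_tuple f w) = map_tuple f (permute s w).
Proof. by apply: eq_from_tnth => i; rewrite [RHS]tnth_map !tnth_permute tnth_map. Qed.

Lemma mhoms_map (M : mcatdata) (T : Type) (r : seq T) (a : T -> seq (mob M)) (b :
  T -> mob M)
    (f : T -> marr M) : (forall i, mhom M (a i) (b i) (f i)) ->
  mhoms [seq a i | i <- r] [seq b i | i <- r] [seq f i | i <- r].
Proof. by move=> abf; elim: r => //= i r IHr; split. Qed.

Section Wreath.

Variable G : group_operad.
Hypothesis G0 : forall u : G 0, u = 1.
Variable M : mcatdata.
Hypothesis multM : is_multicategory M.

Lemma whom_idm (a : word (mob M)) : whom (widm G a).
Proof.
move=> j; rewrite /= gsym1 permute1 fibre_id tnth_mktuple; exact: mhom_id multM _.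
Qed.

Lemma whom_cmp (a b c : word (mob M)) (q : wraw G b c) (p : wraw G a b) :
  whom q -> whom p -> whom (wcmp q p).
Proof.
move=> hom_q hom_p j; rewrite fibre_comp tnth_mktuple.
apply: (mhom_comp multM (bs := fibre (wphi q) (permute (gsym (wel q)) (wtup b))
  j)) => //.
by rewrite !fibre_permute; apply: mhoms_map.
Qed.

Lemma fibre_heq A m n (p p' : emor G m n) (w : m.-tuple A) j : heq (Etilde G) p p' ->
  fibre (ephi p) (permute (gsym (eel p)) w) j = fibre (ephi p') (permute (gsym
    (eel p')) w) j.
Proof. by move=> /heq_EtildeP[]; apply: fibre_relE. Qed.

Lemma wcmpA (a b c d : word (mob M)) (r : wraw G c d) (q : wraw G b c) (p : wraw
  G a b) :
  whom r -> whom q -> whom p -> wcmp r (wcmp q p) = wcmp (wcmp r q) p.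
Proof.
move=> hom_r hom_q hom_p.
rewrite /wcmp /= nabla_cmp pull_cmp_el !mulgA; congr WMor; apply: eq_mktuple => j.
rewrite tnth_mktuple fibre_comp fibre_permute [in RHS]fibre_permute.
have sizeE (i : 'I_(wlen c)) : size (fibre (wphi q) (permute (gsym (wel q)) (warr
  p)) ((gsym (wel r))^-1 i))
    = size (fibre (wphi q) (permute (gsym (wel q)) (wtup b)) ((gsym (wel r))^-1 i)).
  by rewrite !size_fibre.
(* The intermediate words are chosen in the form of [fibre_comp], so that their concatenations are
   again fibre words. *)
rewrite (mcompA multM (c := tnth (wtup d) j)
  (bs := fibre (wphi r) (permute (gsym (wel r)) (wtup c)) j)
  (ass := [seq fibre (wphi q) (permute (gsym (wel q)) (wtup b)) ((gsym (wel
    r))^-1 i) | i <- block (wphi r) (mid j)])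
  (zss := [seq fibre (wphi p) (permute (gsym (wel p)) (wtup a)) ((gsym (pull
    (wphi q) (wel r) * wel q))^-1 i)
          | i <- block (nabla_comp (wphi r) (act (wel r) (wphi q))) (mid j)])).
- by congr mcomp; rewrite zip_map -map_comp; apply: eq_map => i /=; rewrite
  tnth_mktuple.
- exact: hom_r.
- by rewrite fibre_permute; apply: mhoms_map.
- by rewrite -!map_comp; apply: eq_map => i /=.
- by rewrite -!fibre_comp !fibre_permute; apply: mhoms_map.
Qed.

Lemma wcmp1 (a b : word (mob M)) (p : wraw G a b) : whom p -> wcmp (widm G b) p = p.
Proof.
move=> hom_p; have E := Ecat_cmp1 (wemor p); case: p hom_p E => phi f x hom_p E.
have /= E1 := congr1 (@ephi _ _ _) E; have /= E2 := congr1 (@eel _ _ _) E.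
rewrite /wcmp /= E1 E2; congr WMor; apply: eq_from_tnth => j; rewrite !tnth_mktuple.
by rewrite gsym1 permute1 fibre_id; apply: (mcomp1f multM (hom_p j)).
Qed.

Lemma w1cmp (a b : word (mob M)) (p : wraw G a b) : whom p -> wcmp p (widm G a) = p.
Proof.
move=> hom_p; have E := Ecat_1cmp (wemor p); case: p hom_p E => phi f x hom_p E.
have /= E1 := congr1 (@ephi _ _ _) E; have /= E2 := congr1 (@eel _ _ _) E.
rewrite /wcmp /= E1 E2; congr WMor; apply: eq_from_tnth => j; rewrite !tnth_mktuple.
have -> : [tuple mid1 M (tnth (wtup a) i) | i < wlen a] = map_tuple (mid1 M) (wtup a).
  by apply: eq_from_tnth => i; rewrite tnth_mktuple tnth_map.
by rewrite permute_map fibre_map; apply: (mcompf1 multM (hom_p j)).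
Qed.

Lemma wreathEtilde_category : is_category (wreathEtilde G M).
Proof.
split.
- by move=> a b f _; split=> //; apply: heq_Etilde_refl.
- by move=> a b f g _ _ [fg wfg]; split=> //; apply: heq_Etilde_sym.
- move=> a b f g h _ _ _ [fg wfg] [gh wgh]; split; last exact: etrans wgh.
  exact: heq_Etilde_trans gh.
- exact: whom_idm.
- exact: whom_cmp.
- move=> a b c g g' f f' _ _ _ _ [gg' wgg'] [ff' wff']; split.
    exact: (heq_Etilde_cmp G0 gg' ff').
  apply: eq_mktuple => j; rewrite wgg' wff'; congr mcomp.
  exact: fibre_heq gg'.
- move=> a b c d h g f hh hg hf; rewrite [X in heq _ X](wcmpA hh hg hf).
  by split=> //; apply: heq_Etilde_refl.
- move=> a b f hf; rewrite [X in heq _ X](wcmp1 hf).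
  by split=> //; apply: heq_Etilde_refl.
- move=> a b f hf; rewrite [X in heq _ X](w1cmp hf).
  by split=> //; apply: heq_Etilde_refl.
Qed.

Lemma projEtilde_functor : is_functor (projEtilde G M).
Proof.
split=> //.
- by move=> a b f g _ _ [].
- by move=> a; apply: heq_Etilde_refl.
- by move=> a b c g f _ _; apply: heq_Etilde_refl.
Qed.

End Wreath.

(** * Pullbacks of categories *)

Lemma pullback_category O P (C : catdata O) (D E : catdata P) (F : functor C E)
  (T : iofunctor D E) :
  is_category C -> is_category D -> is_category E -> is_functor F ->
  is_functor (functor_of_io T) -> is_category (pullback F T).
Proof.
move=> catC catD catE funF funT.
have Thom a b (f : raw D a b) : hom D f -> hom E (T a b f) by apply: (fmor_hom funT).
have Fhom a b (f : raw C a b) : hom C f -> hom E (fmor F f) by apply: fmor_hom.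
split=> /=.
- by move=> a b f [fC fD _]; split; apply: heq_refl.
- by move=> a b f g [fC fD _] [gC gD _] [fg1 fg2]; split; apply: heq_sym.
- move=> a b f g h [fC fD _] [gC gD _] [hC hD _] [fg1 fg2] [gh1 gh2].
  by split; [apply: (heq_trans catC (g := g.1)) | apply: (heq_trans catD (g := g.2))].
- move=> a; split; [exact: hom_idm | exact: hom_idm |].
  have FI := fmor_idm funF a; have TI := fmor_idm funT (F a).
  apply: (heq_trans catE) FI _ => //; try exact: hom_idm; try by apply: Fhom;
    apply: hom_idm.
    by apply: Thom; apply: hom_idm.
  by apply: heq_sym TI => //; [apply: Thom; apply: hom_idm | apply: hom_idm].
- move=> a b c g f [gC gD gE] [fC fD fE]; split; [exact: hom_cmp | exact: hom_cmp |].
  have Fc := fmor_cmp funF gC fC; have Tc := fmor_cmp funT gD fD.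
  have E2 := cmp_heq catE (Fhom _ _ _ gC) (Thom _ _ _ gD) (Fhom _ _ _ fC) (Thom _
    _ _ fD) gE fE.
  have h1 := Fhom _ _ _ (hom_cmp catC gC fC).
  have h2 := hom_cmp catE (Fhom _ _ _ gC) (Fhom _ _ _ fC).
  have h3 := hom_cmp catE (Thom _ _ _ gD) (Thom _ _ _ fD).
  have h4 := Thom _ _ _ (hom_cmp catD gD fD).
  apply: (heq_trans catE h1 h2 h4 Fc); apply: (heq_trans catE h2 h3 h4 E2).
  exact: (heq_sym catE h4 h3 Tc).
- move=> a b c g g' f f' [gC gD _] [gC' gD' _] [fC fD _] [fC' fD' _] [gg1 gg2]
  [ff1 ff2].
  by split; apply: cmp_heq.
- by move=> a b c d h g f [hC hD _] [gC gD _] [fC fD _]; split; apply: cmpA.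
- by move=> a b f [fC fD _]; split; apply: cmp1f.
- by move=> a b f [fC fD _]; split; apply: cmpf1.
Qed.

(** * The semidirect product multicategory *)

Section Families.

Variable M : mcatdata.

Lemma mhoms_size ass bs fs : mhoms (M := M) ass bs fs ->
  size ass = size bs /\ size fs = size bs.
Proof.
by elim: ass bs fs => [|a ass IH] [|b bs] [|f fs] //= [_ /IH[-> ->]].
Qed.

Lemma mhoms_nth a0 b0 f0 ass bs fs i : mhoms (M := M) ass bs fs -> (i < size bs)%N ->
  mhom M (nth a0 ass i) (nth b0 bs i) (nth f0 fs i).
Proof.
by elim: ass bs fs i => [|a ass IH] [|b bs] [|f fs] // [|i] /= [abf /IH]; last by apply.
Qed.

(** Indexes a composable family by ordinals. An empty family offers no default object or arrow, and
    the functions are then defined on an empty type. *)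
Lemma mhoms_family ass bs fs n : mhoms (M := M) ass bs fs -> size bs = n ->
  exists (a : 'I_n -> seq (mob M)) (b : 'I_n -> mob M) (f : 'I_n -> marr M),
    [/\ ass = [seq a i | i <- enum 'I_n], bs = [seq b i | i <- enum 'I_n],
        fs = [seq f i | i <- enum 'I_n] & forall i, mhom M (a i) (b i) (f i)].
Proof.
move=> homs size_bs; have [size_ass size_fs] := mhoms_size homs.
case: bs fs homs size_bs size_ass size_fs => [|b0 bs] [|f0 fs] homs size_bs
  size_ass size_fs //.
  have no (i : 'I_n) : False by case: i; rewrite -size_bs.
  have enum0 : enum 'I_n = [::] by apply: size0nil; rewrite size_enum_ord -size_bs.
  exists (fun=> [::]), (fun i => False_rect _ (no i)), (fun i => False_rect _ (no i)).
  by rewrite enum0 (size0nil size_ass); split=> // i; case: (no i).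
exists (fun i => nth [::] ass i), (fun i => nth b0 (b0 :: bs) i), (fun i => nth
  f0 (f0 :: fs) i).
split; rewrite ?map_nth_enum //; first by rewrite size_ass.
  by rewrite size_fs.
by move=> i; apply: mhoms_nth => //; rewrite size_bs.
Qed.

Lemma mhoms_permute n (s : {perm 'I_n}) ass bs fs : mhoms (M := M) ass bs fs ->
  size bs = n ->
  mhoms (permute_seq s ass) (permute_seq s bs) (permute_seq s fs).
Proof.
move=> homs /(mhoms_family homs)[a [b [f [-> -> -> abf]]]].
by rewrite !permute_seq_enum; apply: mhoms_map.
Qed.

End Families.

(** * Block permutations of words *)

Section BlockPermutation.

Variable G : group_operad.

Definition op_permute (x : op G) (A : Type) (s : seq A) : seq A :=
  permute_seq (gsym (tagged x)) s.

Lemma size_op_permute (x : op G) (A : Type) (s : seq A) : size (op_permute x s) =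
  size s.
Proof. exact: size_permute_seq. Qed.

Lemma nth_op_permute (x : op G) (A : Type) (x0 : A) (s : seq A) p :
  size s = tag x -> (p < tag x)%N -> nth x0 (op_permute x s) (psym x p) = nth x0 s p.
Proof.
case: x => n x /= size_s p_lt; rewrite -[existT _ _ _]/(Op x) -[p]/(val (Ordinal
  p_lt)) psymE.
rewrite /op_permute (permute_seqE _ x0 size_s).
by rewrite (nth_map_enum x0 (fun i : 'I_n => nth x0 s ((gsym x)^-1 i))) permK.
Qed.

(** The law [sym_gam] transported from positions to words; it carries both typing and associativity
    of [semidirect]. *)
Lemma op_permute_gam (A : Type) n (x : G n) (a : 'I_n -> op G) (w : 'I_n -> seq A) :
  (forall i, size (w i) = tag (a i)) ->
  op_permute (gam (Op x) [seq a i | i <- enum 'I_n]) (flatten [seq w i | i <-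
    enum 'I_n])
  = flatten [seq op_permute (a ((gsym x)^-1 i)) (w ((gsym x)^-1 i)) | i <- enum 'I_n].
Proof.
move=> size_w; set g := gam _ _; set L := op_permute g _.
have tag_g : tag g = (\sum_(i < n) tag (a i))%N by rewrite /g tag_gam_enum.
have shape_w : shape [seq w i | i <- enum 'I_n] = [seq tag (a i) | i <- enum 'I_n].
  by rewrite /shape -[LHS]map_comp; apply: eq_map => i; rewrite /= size_w.
have shape_w' : shape [seq op_permute (a ((gsym x)^-1 i)) (w ((gsym x)^-1 i)) | i
  <- enum 'I_n]
    = [seq tag (a ((gsym x)^-1 i)) | i <- enum 'I_n].
  by rewrite /shape -[LHS]map_comp; apply: eq_map => i; rewrite /=
    size_op_permute size_w.
have sum_w : sumn [seq tag (a i) | i <- enum 'I_n] = tag g.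
  by rewrite tag_g sumnE big_map big_enum.
have size_fw : size (flatten [seq w i | i <- enum 'I_n]) = tag g.
  by rewrite size_flatten shape_w.
apply: eq_from_all_nth => [|x0 q].
  rewrite size_op_permute size_fw size_flatten shape_w' sumnE big_map big_enum /= tag_g.
  by rewrite [RHS](reindex_inj (@perm_inj _ (gsym x))) /=; apply: eq_bigr => i _;
    rewrite permK.
rewrite size_op_permute size_fw => q_lt.
(* Letters are compared at the image of p, which is then split into a block i and an offset c. *)
pose p : 'I_(tag g) := (gsym (tagged g))^-1 (Ordinal q_lt).
have <- : psym g p = q by rewrite -[g in psym g]taggedK psymE permKV.
rewrite nth_op_permute //.
have p_lt : (p < sumn [seq tag (a i) | i <- enum 'I_n])%N by rewrite sum_w.
have r_lt := reshape_indexP p_lt; have c_lt := reshape_offsetP p_lt.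
rewrite size_map_enum in r_lt.
rewrite nth_flatten shape_w -[in RHS](reshape_indexK [seq tag (a i) | i <- enum
  'I_n] p).
set c := reshape_offset _ _ in c_lt *.
rewrite -[reshape_index _ _]/(val (Ordinal r_lt)); rewrite -[reshape_index _
  _]/(val (Ordinal r_lt)) in c_lt.
move: (Ordinal r_lt) c_lt => i; rewrite (nth_map_enum 0%N (fun i => tag (a i))) => c_lt.
rewrite /g psym_gam // nth_flatten shape_w' flatten_indexKl ?flatten_indexKr;
  rewrite ?(nth_map_enum 0%N (fun i => tag (a ((gsym x)^-1 i)))) ?permK ?psym_lt //.
rewrite (nth_map_enum [::] (fun i => op_permute (a ((gsym x)^-1 i)) (w ((gsym
  x)^-1 i)))).
by rewrite (nth_map_enum [::] w) permK nth_op_permute.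
Qed.

End BlockPermutation.

Section Semidirect.

Variable G : group_operad.
Variable M : mcatdata.
Hypothesis multM : is_multicategory M.

Lemma permute_seq1 (A : Type) (s : {perm 'I_1}) (a : A) : permute_seq s [:: a] = [:: a].
Proof.
rewrite (permute_seqE s a) //; apply: (@eq_from_nth _ a); rewrite ?size_map_enum //.
move=> [|//] _; rewrite -[0%N]/(val (ord0 : 'I_1)) (nth_map_enum a (fun i : 'I_1
  => nth a [:: a] (s^-1 i))).
by rewrite (ord1 (s^-1 ord0)).
Qed.

Lemma semidirect_hom_comp (ass : seq (seq (mob (semidirect G M)))) bs c g fs :
  mhom (semidirect G M) bs c g -> mhoms ass bs fs ->
  mhom (semidirect G M) (flatten ass) c (mcomp (semidirect G M) g fs).
Proof.
case: g => g [n x] /= [n_bs hom_g] homs; rewrite -[existT _ _ _]/(Op x).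
have [a [b [f [-> def_bs -> abf]]]] := mhoms_family homs (esym n_bs).
rewrite def_bs in hom_g.
have tag_f i : tag (f i).2 = size (a i) by have [] := abf i.
have snd_f : [seq p.2 | p <- [seq f i | i <- enum 'I_n]] = [seq (f i).2 | i <-
  enum 'I_n].
  by rewrite -[LHS]map_comp.
have fst_f : [seq p.1 | p <- [seq f i | i <- enum 'I_n]] = [seq (f i).1 | i <-
  enum 'I_n].
  by rewrite -[LHS]map_comp.
rewrite snd_f fst_f; split.
  rewrite tag_gam_enum size_flatten /shape -[X in sumn X]map_comp sumnE big_map
    big_enum /=.
  by apply: eq_bigr => i _; rewrite tag_f.
rewrite -/(op_permute _ _) op_permute_gam // permute_seq_enum.
apply: (mhom_comp multM (bs := permute_seq (gsym x) [seq b i | i <- enum 'I_n])) => //.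
rewrite permute_seq_enum; apply: mhoms_map => i; by have [] := abf ((gsym x)^-1 i).
Qed.

Lemma semidirect_compA (zss ass : seq (seq (mob (semidirect G M)))) bs c g fs hss :
  mhom (semidirect G M) bs c g -> mhoms ass bs fs ->
  [seq size hs | hs <- hss] = [seq size a | a <- ass] ->
  mhoms zss (flatten ass) (flatten hss) ->
  mcomp (semidirect G M) (mcomp (semidirect G M) g fs) (flatten hss)
  = mcomp (semidirect G M) g [seq mcomp (semidirect G M) p.1 p.2 | p <- zip fs hss].
Proof.
case: g => g [n x] [/= n_bs hom_g] homs size_hss homs_z; rewrite -[existT _ _ _]/(Op x).
have [a [b [f [def_ass def_bs -> abf]]]] := mhoms_family homs (esym n_bs).
rewrite def_bs in hom_g.
have size_ass : size hss = n.
  by rewrite -(size_map size) size_hss size_map def_ass size_map_enum.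
pose h (i : 'I_n) := nth [::] hss i.
have def_hss : hss = [seq h i | i <- enum 'I_n] by rewrite (map_nth_enum [::] size_ass).
have tag_f i : tag (f i).2 = size (a i) by have [] := abf i.
have size_h i : size (h i) = size (a i).
  have := nth_map_enum 0%N (fun i => size (h i)) i.
  rewrite (map_comp size h) -def_hss size_hss def_ass -[X in nth _ X]map_comp => <-.
  by rewrite (nth_map_enum 0%N (fun i => size (a i))).
have snd_f : [seq p.2 | p <- [seq f i | i <- enum 'I_n]] = [seq (f i).2 | i <-
  enum 'I_n].
  by rewrite -[LHS]map_comp.
have fst_f : [seq p.1 | p <- [seq f i | i <- enum 'I_n]] = [seq (f i).1 | i <-
  enum 'I_n].
  by rewrite -[LHS]map_comp.
have def_zip : [seq mcomp (semidirect G M) p.1 p.2 | p <- zip [seq f i | i <-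
  enum 'I_n] hss]
    = [seq mcomp (semidirect G M) (f i) (h i) | i <- enum 'I_n].
  by rewrite def_hss zip_map -[LHS]map_comp.
rewrite def_zip /= snd_f fst_f !permute_seq_enum; congr pair; last first.
  rewrite def_hss map_flatten -[X in flatten X]map_comp.
  rewrite (@gam_map_assoc G _ (Op x) (enum 'I_n) (fun i => (f i).2)) ?size_enum_ord //.
    by congr gam; rewrite -[RHS]map_comp.
  by move=> i; rewrite size_map size_h tag_f.
rewrite -[X in _ = mcomp _ _ (permute_seq _ X)]map_comp permute_seq_enum /=.
rewrite -/(op_permute _ _).
have flat_h : [seq p.1 | p <- flatten hss] = flatten [seq [seq p.1 | p <- h i] |
  i <- enum 'I_n].
  by rewrite def_hss map_flatten -[X in flatten X]map_comp.
have flat_a : flatten ass = flatten [seq a i | i <- enum 'I_n] by rewrite def_ass.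
rewrite flat_h op_permute_gam => [|i]; last by rewrite size_map size_h tag_f.
set s := gsym x; pose g' := gam (Op x) [seq (f i).2 | i <- enum 'I_n].
have tag_g' : size (flatten ass) = tag g'.
  rewrite /g' tag_gam_enum flat_a size_flatten /shape -[X in sumn X]map_comp
    sumnE big_map big_enum /=.
  by apply: eq_bigr => i _; rewrite tag_f.
(* Forgetting the operations leaves a composable family in M, whose sources are the permuted
   ones. *)
have [zz homs_zz] : exists zz, mhoms (M := M) zz (flatten ass) [seq p.1 | p <-
  flatten hss].
  elim: zss (flatten ass) (flatten hss) homs_z {flat_h flat_a tag_g'} => [|z zz
    IH] [|b1 bb] [|f1 ff] //=.
    by exists [::].
  by case=> [[_ hom_f1] /IH[zz' homs']]; exists (permute_seq (gsym (tagged f1.2))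
    z :: zz').
have := mhoms_permute (gsym (tagged g')) homs_zz tag_g'.
rewrite -!/(op_permute g' _) flat_h flat_a op_permute_gam => [|i]; last by
  rewrite tag_f.
rewrite op_permute_gam => [|i]; last by rewrite size_map size_h tag_f.
move=> homs_p.
rewrite (mcompA multM (c := c) (bs := permute_seq s [seq b i | i <- enum 'I_n]) _
  _ _ homs_p) //.
- by congr mcomp; rewrite zip_map -[LHS]map_comp.
- rewrite permute_seq_enum; apply: mhoms_map => i; by have [] := abf (s^-1 i).
- rewrite -[LHS]map_comp -[RHS]map_comp; apply: eq_map => i /=.
  by rewrite !size_op_permute size_map size_h.
Qed.

Lemma semidirect_multicategory : is_multicategory (semidirect G M).
Proof.
split.
- by move=> a; split=> //=; rewrite permute_seq1; apply: mhom_id.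
- exact: semidirect_hom_comp.
- exact: semidirect_compA.
- move=> a b [f x] /= [_ hom_f]; rewrite permute_seq1 (mcomp1f multM hom_f).
  by congr pair; apply: (gam1x (gopP G)).
- move=> a b [f x] /= [tag_x hom_f]; congr pair.
    rewrite -[X in permute_seq _ X]map_comp -(map_permute_seq (mid1 M)) //.
    exact: (mcompf1 multM hom_f).
  rewrite -[X in gam _ X]map_comp /=.
  have -> : [seq ((fun p : marr M * op G => p.2) \o (fun c => (mid1 M c, Op (gid
    G)))) c | c <- a] = nseq (tag x) (Op (gid G)).
    by rewrite tag_x; elim: a {tag_x hom_f} => //= c a ->.
  exact: (gamx1 (gopP G)).
Qed.

End Semidirect.

(** * The isomorphism *)

Section DeltaComposite.

Variable G : group_operad.
Hypothesis G0 : forall u : G 0, u = 1.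

Lemma kmid_comp_inj k m n (psi : nabla m n) (kappa : nabla k m) (i : 'I_m) (j : 'I_n) :
  injective psi -> psi (mid i) = mid j -> kmid (nabla_comp psi kappa) j = kmid kappa i.
Proof.
move=> psi_inj psi_i; apply: eq_card => p.
by rewrite !inE nabla_compE -psi_i (inj_eq psi_inj).
Qed.

(** The whole fibre of phi over i lies in the fibre of the composite over j, and delta_j hits each
    of its elements once. *)
Lemma kmid_comp_delta l m n (chi : nabla m n) (phi : nabla l m) (j : 'I_n) (i : 'I_m) :
  chi (mid i) = mid j ->
  kmid (nabla_comp phi (delta (nabla_comp chi phi) j)) i = kmid phi i.
Proof.
move=> chi_i; rewrite kmid_block [in RHS]kmid_block block_comp_active; last
  exact: active_delta.
rewrite size_flatten /shape -map_comp.
set r := (X in sumn X); suff -> : r = nseq (size r) 1%N by rewrite sumn_nseq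
  mul1n /r size_map.
apply/all_pred1P/allP => _ /mapP[q q_in ->] /=; rewrite -kmid_block kmid_delta.
by move: q_in; rewrite mem_block nabla_compE => /eqP->; rewrite chi_i eqxx.
Qed.

(** The right-hand side is the operation part of a composite in [semidirect]. [pull_cmp] splits the
    left-hand side into an inflation of delta_j^* v and a block sum of components of u; the
    multiplication law merges them. *)
Lemma pull_delta_cmp l m n (chi : nabla m n) (phi : nabla l m) (v y : G m) (u : G
  l) (j : 'I_n) :
  RSt chi v -> DecBar phi u ->
  Op (pull (delta (nabla_comp chi (act y phi)) j) (pull phi (v * y) * u * (pull
    phi y)^-1))
  = gam (Op (pull (delta chi j) v))
      [seq Op (pull (delta phi ((gsym y)^-1 i)) u) | i <- block chi (mid j)].
Proof.
move=> RSt_v [RSt_u Dec_u]; set d' := delta (nabla_comp chi (act y phi)) j.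
pose d1 := act (pull phi y)^-1 d'; pose beta := nabla_comp phi d1.
have d'E : act (pull phi y) d1 = d' by rewrite actKV.
have act_y_beta : act y beta = nabla_comp (act y phi) d' by rewrite act_comp d'E.
rewrite -d'E (pull_cmp _ _ RSt_v RSt_u) -omulE -/beta.
have act_yb : active (act y beta).
  rewrite act_y_beta; apply: (active_comp_r (psi := chi)); rewrite nabla_compA.
  exact: active_comp_delta.
have act_b : active beta by apply: active_of_act act_yb.
(* The inner values of this map lie in the fibre of chi over j, so v is seen only through delta_j^*
   v. *)
have [s|kappa kappaE] := delta_like_factor (phi := chi) (j := j) (psi := act y beta).
  by rewrite act_y_beta -nabla_compE nabla_compA nabla_compE phi_delta.
have act_k : active kappa by rewrite kappaE in act_yb; apply: active_comp_r act_yb.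
pose e i := Op (pull (delta phi ((gsym y)^-1 i)) u).
have kmidE i : chi (mid i) = mid j -> kmid (act y beta) i = kmid phi ((gsym y)^-1 i).
  move=> chi_i; rewrite act_y_beta kmid_comp_delta //.
  by rewrite -[i in LHS](permKV (gsym y)) kmid_act.
have eE i : chi (mid i) = mid j ->
    Op (pull (delta beta ((gsym y)^-1 i)) (pull d1 u)) = e i.
  move=> chi_i; rewrite -pull_comp; apply: delta_like_pull; split.
  - by rewrite -kmidE // -[i in RHS](permKV (gsym y)) kmid_act.
  - move=> p q; rewrite !nabla_compE => /act_injective pq; apply/delta_inj/pq.
    exact: delta_inj.
  - by move=> s; rewrite nabla_compE -nabla_compE phi_delta.
(* Conjugation reorders the components of u by y; those outside the fibre of chi over j are nullary
   and drop out. *)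
have conjE : Op (pull beta y * pull d1 u * (pull beta y)^-1)
    = gam (eop G (kmid chi j)) [seq e i | i <- block chi (mid j)].
  have Dd : Dec beta (pull d1 u) by apply: Dec_u.
  rewrite (conj_blocks y act_b (fun i => tag_comp beta (pull d1 u) i) (Dec_comps
    G0 act_b Dd)).
  have <- : eop G (size (enum 'I_m)) = eop G m by rewrite size_enum_ord.
  rewrite (gam_filter G0 _ (f := fun i => chi (mid i) == mid j)).
    rewrite -/(block chi (mid j)); have <- : eop G (size (block chi (mid j))) =
      eop G (kmid chi j) by rewrite kmid_block.
    congr gam.
    by apply/eq_in_map => i; rewrite mem_block => /eqP/eE.
  move=> i; apply: contraNeq; rewrite /= -lt0n -[(gsym y)^-1 i]/((gsym y)^-1 i).
  rewrite -(kmid_act beta y) permKV act_y_beta => /card_gt0P[p].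
  rewrite inE nabla_compE => /eqP phi_p; rewrite -phi_p -[chi _]nabla_compE.
  case: (midP p) phi_p => [||s] phi_p; last by rewrite phi_delta.
    by move/eqP: phi_p; rewrite !nabla0 eq_sym mid_neq0.
  by move/eqP: phi_p; rewrite !nabla_max eq_sym mid_neq_max.
rewrite conjE kappaE pull_comp pull_active // /infl.
have kseqE : [seq eop G k | k <- kseq kappa] = [seq eop G (kmid kappa s) | s <-
  enum 'I_(kmid chi j)].
  by rewrite /kseq -[LHS]map_comp.
have eE' : [seq e i | i <- block chi (mid j)] = [seq e (dval s) | s <- enum
  'I_(kmid chi j)].
  by rewrite -map_dval -[LHS]map_comp.
have tagE s : kmid kappa s = tag (e (dval s)).
  rewrite -(kmid_comp_inj kappa (@delta_inj _ _ chi j) (delta_mid s)) -kappaE.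
  exact/kmidE/phi_dval.
rewrite kseqE -/e eE' -(@gam_omul G _ (pull (delta chi j) v) 1 (fun s => eop G
  (kmid kappa s)) (fun s => e (dval s))).
  by rewrite mulg1; congr gam; apply: eq_map => s; rewrite gsym1 perm1 tagE omul1l.
by move=> s; rewrite gsym1 perm1 tagE.
Qed.

End DeltaComposite.

(** F reflects equality of morphisms, so each functor law for F' is checked after applying F, where
    F' cancels. *)
Lemma isomorphism_of_section O (C D : catdata O) (F F' : iofunctor _ _) :
  is_category C -> is_category D -> is_functor (functor_of_io F) ->
  (forall a b (f g : raw C a b), hom C f -> hom C g ->
     heq D (F a b f) (F a b g) -> heq C f g) ->
  (forall a b (g : raw D a b), hom D g -> hom C (F' a b g)) ->
  (forall a b (g : raw D a b), hom D g -> heq D (F a b (F' a b g)) g) ->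
  @is_isomorphism O C D F.
Proof.
move=> catC catD funF reflF homF' secF.
have homF a b (f : raw C a b) : hom C f -> hom D (F a b f) by apply: (fmor_hom funF).
split=> //; exists F'; split=> //; last first.
  by move=> a b f hf; apply: reflF => //; [apply/homF'/homF | apply/secF/homF].
split=> /=.
- exact: homF'.
- move=> a b f g hf hg fg; apply: reflF; [exact: homF' | exact: homF' |].
  have [hf' hg'] := (homF _ _ _ (homF' _ _ _ hf), homF _ _ _ (homF' _ _ _ hg)).
  apply: (heq_trans catD hf' hf hg' (secF _ _ _ hf)).
  by apply: (heq_trans catD hf hg hg' fg); apply: heq_sym (secF _ _ _ hg).
- move=> a; have [hC hD] := (hom_idm catC a, hom_idm catD a).
  apply: reflF => //; first exact: homF'.
  apply: (heq_trans catD (homF _ _ _ (homF' _ _ _ hD)) hD (homF _ _ _ hC) (secF _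
    _ _ hD)).
  exact: (heq_sym catD (homF _ _ _ hC) hD (fmor_idm funF a)).
- move=> a b c g f hg hf; have [hg' hf'] := (homF' _ _ _ hg, homF' _ _ _ hf).
  have [hFg hFf] := (homF _ _ _ hg', homF _ _ _ hf').
  have h1 := hom_cmp catD hg hf; have h2 := hom_cmp catC hg' hf'; have h3 :=
    hom_cmp catD hFg hFf.
  apply: reflF => //; first exact: homF'.
  apply: (heq_trans catD (homF _ _ _ (homF' _ _ _ h1)) h1 (homF _ _ _ h2) (secF _
    _ _ h1)).
  apply: (heq_trans catD h1 h3 (homF _ _ _ h2)).
    by apply: (cmp_heq catD) => //; apply: (heq_sym catD) => //; apply: secF.
  exact: (heq_sym catD (homF _ _ _ h2) h3 (fmor_cmp funF hg' hf')).
Qed.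

(** * The functor on the quotients and its inverse *)

Section PhiTilde.

Variable G : group_operad.
Hypothesis G0 : forall u : G 0, u = 1.
Variable M : mcatdata.
Hypothesis multM : is_multicategory M.

Definition phi_tilde : iofunctor (wreathGtilde G M) (wreathEtilde G (semidirect G M)) :=
  fun a b pg => phi_formula (gphi pg.2) (warr pg.1) (gu pg.2) (gel pg.2).

(** The f_j are typed by the label of the wreath component, equivalent to u x by the pullback
    condition; [fibre_heq] replaces it and [fibre_RSt] splits off u. *)
Lemma phi_tilde_hom a b (p : raw (wreathGtilde G M) a b) :
  hom (wreathGtilde G M) p -> hom (wreathEtilde G (semidirect G M)) (phi_tilde p).
Proof.
move=> [hom_f [RSt_u _] eq_t] j; rewrite tnth_mktuple /=; split.
  by rewrite size_fibre.
rewrite -(fibre_RSt _ _ RSt_u) -permute_gsymM -(fibre_heq _ _ eq_t).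
exact: hom_f.
Qed.

Lemma phi_tilde_heq a b (p p' : raw (wreathGtilde G M) a b) :
  hom (wreathGtilde G M) p -> hom (wreathGtilde G M) p' ->
  heq (wreathGtilde G M) p p' ->
  heq (wreathEtilde G (semidirect G M)) (phi_tilde p) (phi_tilde p').
Proof.
move=> [_ Dp _] [_ Dp' _] [[_ eq_f] /heq_GtildeP[] // pp' p'p]; split.
  by apply/heq_EtildeP; split; apply: relG_relE.
by apply: eq_mktuple => j; rewrite eq_f (relG_delta j pp' p'p).
Qed.

Lemma phi_tilde_reflects a b (p p' : raw (wreathGtilde G M) a b) :
  hom (wreathGtilde G M) p -> hom (wreathGtilde G M) p' ->
  heq (wreathEtilde G (semidirect G M)) (phi_tilde p) (phi_tilde p') ->
  heq (wreathGtilde G M) p p'.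
Proof.
move=> [_ Dp eq_p] [_ Dp' eq_p'] [/heq_EtildeP[pp' p'p] eq_arr].
have arrE j : (tnth (warr p.1) j, Op (pull (delta (gphi p.2) j) (gu p.2)))
    = (tnth (warr p'.1) j, Op (pull (delta (gphi p'.2) j) (gu p'.2))).
  by have := congr1 (fun t => tnth t j) eq_arr; rewrite !tnth_mktuple.
have eq_G : heq (Gtilde G) p.2 p'.2.
  have deltaE j : Op (pull (delta (gphi p.2) j) (gu p.2)) = Op (pull (delta (gphi
    p'.2) j) (gu p'.2)).
    exact: (congr1 (fun t : marr M * op G => t.2) (arrE j)).
  by apply/heq_GtildeP => //; split; apply: relG_of_delta => // j; rewrite deltaE.
split=> //; split; last by apply: eq_from_tnth => j; exact: (congr1 (fun t : marr
  M * op G => t.1) (arrE j)).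
(* The underlying class of the wreath component is forced by the pullback condition from the
   component in [Gtilde]. *)
apply: heq_Etilde_trans eq_p _; apply: heq_Etilde_trans (heq_Etilde_sym eq_p').
exact: heq_tfun.
Qed.

Lemma phi_tilde_functor : is_functor (functor_of_io phi_tilde).
Proof.
split.
- exact: phi_tilde_hom.
- exact: phi_tilde_heq.
- move=> a; split; first exact: heq_Etilde_refl.
  apply: eq_mktuple => j; rewrite /= tnth_mktuple pull1 Op_gid; congr pair.
  by rewrite -[LHS]/(eop G _) kmid_id.
- move=> a b c q p [hom_q Dq eq_q] [hom_p Dp eq_p]; split; first exact: heq_Etilde_refl.
  apply: eq_mktuple => j; rewrite !tnth_mktuple /=; congr pair.
    set T := [tuple _ | i < _].
    rewrite -[X in permute_seq _ X]fibre_map -permute_map.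
    have -> : map_tuple fst T = warr p.1 by apply: eq_from_tnth => i; rewrite
      tnth_map tnth_mktuple.
    have [RSt_v _] := Dq; rewrite -(fibre_RSt _ _ RSt_v) -permute_gsymM.
    by rewrite -(fibre_heq _ _ eq_q).
  have [RSt_v _] := Dq; rewrite (pull_delta_cmp G0 _ _ RSt_v Dp) fibre_permute.
  by congr gam; rewrite -[RHS]map_comp; apply: eq_map => i /=; rewrite tnth_mktuple.
Qed.

Section Inverse.

Variables a b : word (mob M).

(** Pullbacks along the delta_j do not see the blocks over the ends, which are filled with units. *)
Definition section_block (p : wraw G (M := semidirect G M) a b) (j : 'I_(wlen
  b).+2) : op G :=
  if unmid j is Some i then (tnth (warr p) i).2 else eop G (size (block (wphi p) j)).

(* The default value 1 is only taken outside of the hom-sets, where arities do *)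
(* not match.                                                                  *)
Definition section_elt (p : wraw G (M := semidirect G M) a b) : G (wlen a) :=
  untag (1 : G (wlen a)) id
    (gam (eop G (wlen b).+2) [seq section_block p j | j <- enum 'I_(wlen b).+2]).

Definition phi_section (p : wraw G (M := semidirect G M) a b) : raw (wreathGtilde
  G M) a b :=
  @wgmor G M a b (wphi p) (map_tuple fst (warr p)) (section_elt p) (wel p).

Variable p : wraw G (M := semidirect G M) a b.
Hypothesis hom_p : whom p.

Lemma tag_section_block j : tag (section_block p j) = size (block (wphi p) j).
Proof.
rewrite /section_block; case: (midP j) => [||i]; rewrite ?unmid0 ?unmid_max
  ?unmid_mid //.
by apply: etrans (proj1 (hom_p i)) _; rewrite size_fibre kmid_block.
Qed.

Lemma section_eltE : Op (section_elt p)
  = gam (eop G (wlen b).+2) [seq section_block p j | j <- enum 'I_(wlen b).+2].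
Proof.
have tag_g : tag (gam (eop G (wlen b).+2) [seq section_block p j | j <- enum
  'I_(wlen b).+2]) = wlen a.
  rewrite tag_gam ?size_map_enum // -[RHS](sumn_ktuple (wphi p)) ktuple_block.
  rewrite -[in LHS]map_comp; congr sumn; apply: eq_map => j /=; exact:
    tag_section_block.
by rewrite /section_elt (untagE _ _ tag_g) [LHS]etaggedK.
Qed.

Lemma Dec_section_elt : Dec (wphi p) (section_elt p).
Proof.
exists [seq section_block p j | j <- enum 'I_(wlen b).+2]; split; last exact:
  section_eltE.
rewrite ktuple_block -[LHS]map_comp; apply: eq_map => j; exact: tag_section_block.
Qed.

Lemma pull_delta_section_elt j : Op (pull (delta (wphi p) j) (section_elt p)) =
  (tnth (warr p) j).2.
Proof.
rewrite (pull_delta_blocks G0 j section_eltE tag_section_block).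
by rewrite /section_block unmid_mid.
Qed.

Lemma phi_section_hom : hom (wreathGtilde G M) (phi_section p).
Proof.
have DU := Dec_DecBar Dec_section_elt; split=> //; last exact: heq_Etilde_refl.
move=> j; have [_] := hom_p j; rewrite /= tnth_map permute_gsymM.
have [RSt_u _] := DU; rewrite (fibre_RSt _ _ RSt_u).
by rewrite -pull_delta_section_elt.
Qed.

Lemma phi_tildeK : heq (wreathEtilde G (semidirect G M)) (phi_tilde (phi_section p)) p.
Proof.
split; first exact: heq_Etilde_refl.
apply: eq_from_tnth => j; rewrite tnth_mktuple /= pull_delta_section_elt tnth_map.
by case: (tnth _ _).
Qed.

End Inverse.

Lemma phi_tilde_isomorphism : is_isomorphism phi_tilde.
Proof.
refine (@isomorphism_of_section _ (wreathGtilde G M) (wreathEtilde G (semidirect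
  G M)) phi_tilde (fun a b p => phi_section p) _ _ _ _ _ _).
- apply: pullback_category (wreathEtilde_category G0 multM) (Gtilde_category G0)
    (Etilde_category G0) (projEtilde_functor _ _) (ttilde_functor G0).
- exact: wreathEtilde_category (semidirect_multicategory G multM).
- exact: phi_tilde_functor.
- exact: phi_tilde_reflects.
- exact: phi_section_hom.
- exact: phi_tildeK.
Qed.

End PhiTilde.

(* G 0 has to be trivial: for the empty word a, distinct u in G 0 give distinct
   endomorphisms [id; ; u, 1] of a in the source, whereas a has only one
   endomorphism in the target. *)
Theorem theorem4p9 (G : group_operad) (G0_trivial : forall u : G 0, u = 1) :
  exists PhiTilde : forall M : mcatdata,
      iofunctor (wreathGtilde G M) (wreathEtilde G (semidirect G M)),
  (forall M : mcatdata, is_multicategory M ->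
    [/\ is_isomorphism (PhiTilde M),
        forall (a b : word (mob M)) (phi : nabla (wlen a) (wlen b))
          (f : (wlen b).-tuple (marr M)) (u x : G (wlen a)),
          hom (wreathGtilde G M) (wgmor phi f u x) ->
          heq (wreathEtilde G (semidirect G M))
            (PhiTilde M a b (wgmor phi f u x)) (phi_formula phi f u x)
      & forall (a b : word (mob M)) (p : raw (wreathG G M) a b),
          hom (wreathG G M) p ->
          heq (wreathEtilde G (semidirect G M))
            (PhiTilde M a b (@quotG G M a b p))
            (@quotE G (semidirect G M) a b (@Phi G M a b p))])
  /\ is_2natural PhiTilde.
Proof.
exists (@phi_tilde G); split=> [M multM|].
  split; first exact: phi_tilde_isomorphism.
  - by move=> *; split=> //; apply: heq_Etilde_refl.
  - by move=> *; split=> //; apply: heq_Etilde_refl.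
split=> [M N F _ _ _ a b p _|M N F F' alpha _ _ _ _ _ a].
  split; first exact: heq_Etilde_refl.
  by apply: eq_from_tnth => j; rewrite [LHS]tnth_mktuple /= [LHS]/= tnth_map
    [RHS]tnth_map tnth_mktuple.
split; first exact: heq_Etilde_refl.
(* Here u = 1, and its pullback is the unit of arity [kmid (nabla_id _) j], which is 1. *)
apply: eq_from_tnth => j; rewrite [LHS]tnth_mktuple [RHS]tnth_map /= tnth_map
  pull1; congr pair.
by rewrite -[LHS]/(eop G _) kmid_id.
Qed.
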